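(* Let $G$ be a group and let $\alpha=\{\alpha_t:D_{t^{-1}}\to D_t\}_{t\in G}$ be a product partial action of $G$ on an algebra $A$. Then $\alpha$ has a Morita enveloping action, which is unique up to Morita equivalence. Moreover, for every Morita enveloping action $\beta:G\times B\to B$ of $\alpha$, the skew group algebras $A\rtimes_\alpha G$ and $B\rtimes_\beta G$ are graded-equivalent.
   Context: Algebras are associative, not necessarily unital, over a fixed commutative associative unital ring $k$; $G$ is an arbitrary group. Products of subsets such as $UV$ denote the $k$-span of all products $uv$. An algebra $A$ is idempotent if $A^2=A$. A bimodule ${}_RM_S$ is unital if $RM=M=MS$. A product partial action $\alpha$ of $G$ on an algebra $A$ is a family of two-sided ideals $D_t$ of $A$ and algebra isomorphisms $\alpha_t:D_{t^{-1}}\to D_t$ such that for all $s,t\in G$: (1) $\alpha_1=\mathrm{id}_A$ (so $D_1=A$); (2) $D_t^2=D_t$, $D_sD_t=D_tD_s$; (3) $\alpha_s(D_{s^{-1}}D_t)=D_sD_{st}$; (4) $\alpha_s(\alpha_t(x))=\alpha_{st}(x)$ for $x\in D_{t^{-1}}D_{(st)^{-1}}$. Its skew group algebra is $A\rtimes_\alpha G=\bigoplus_tD_t\delta_t$ with $(a\delta_r)(b\delta_s)=\alpha_r(\alpha_r^{-1}(a)b)\delta_{rs}$, $G$-graded with $D_t\delta_t$ in degree $t$. A global action is an action of $G$ by algebra automorphisms; on an idempotent algebra it is a product partial action with all domains equal to the whole algebra. If $A$ is an idempotent two-sided ideal of $B$ and $\beta$ is a global action of $G$ on $B$ with $A\beta_t(A)=\beta_t(A)A$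 for all $t$, then $D_t:=A\beta_t(A)$, $\alpha_t:=\beta_t|_{D_{t^{-1}}}$ defines a product partial action on $A$, the restriction of $\beta$ to $A$; $\beta$ (and any global action isomorphic to it) is then called a globalization of $\alpha$. It is minimal if $B=\sum_{t\in G}\beta_t(A)$ (in which case $B^2=B$). A Morita context $(A,B,X,Y,\tau_A,\tau_B)$ consists of algebras $A,B$, an $(A,B)$-bimodule $X$, a $(B,A)$-bimodule $Y$, an $A$-bimodule map $\tau_A:X\otimes_BY\to A$ and a $B$-bimodule map $\tau_B:Y\otimes_AX\to B$ with $\tau_A(x\otimes y)x'=x\tau_B(y\otimes x')$ and $\tau_B(y\otimes x)y'=y\tau_A(x\otimes y')$; write $xy=\tau_A(x\otimes y)$, $yx=\tau_B(y\otimes x)$. Its context algebra is the algebra of matrices $\begin{pmatrix}a&x\\ y&b\end{pmatrix}$ with the evident multiplication. It is a Morita equivalence between the idempotent algebras $A,B$ if $X,Y$ are unital bimodules and $\tau_A,\tau_B$ are surjective. Morita equivalence of product partial actions: $\alpha=\{\alpha_t:D_{t^{-1}}\to D_t\}$ on $A$ and $\alpha'=\{\alpha'_t:D'_{t^{-1}}\to D'_t\}$ on $A'$ are Morita equivalent if there exist a Morita equivalence $(A,A',X,Y,\tau_A,\tau_{A'})$ with context algebra $C$ and a product partial action $\theta=\{\theta_t:\bar D_{t^{-1}}\to\bar D_t\}$ of $G$ on $C$ such that (i) $YD_tX=D'_t$ for all $t$; (ii) $\theta|_A=\alpha$ and $\theta|_{A'}=\alpha'$ (identifying $A$, $A'$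 with the diagonal corners of $C$; i.e. $A\cap\bar D_t=D_t$, $\theta_t=\alpha_t$ on $D_{t^{-1}}$, and similarly for $A'$). A global action $\beta$ is a Morita enveloping action of a product partial action $\alpha$ if $\beta$ is a minimal globalization of some product partial action $\alpha'$ that is Morita equivalent to $\alpha$. Two idempotent $G$-graded algebras $A=\bigoplus_t A_t$, $B=\bigoplus_t B_t$ are graded-equivalent if there is a Morita context $(A,B,X,Y,\tau_A,\tau_B)$ with $X=\bigoplus_tX_t$, $Y=\bigoplus_tY_t$ unital $G$-graded bimodules, $\tau_A(X_r\otimes_B Y_s)\subseteq A_{rs}$, $\tau_B(Y_r\otimes_A X_s)\subseteq B_{rs}$ for all $r,s\in G$, and $\tau_A,\tau_B$ surjective. *)

(* Defs.v *)
From HB Require Import structures.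
From mathcomp Require Import all_boot all_algebra.
From mathcomp Require Import finmap.
From mathcomp Require Import boolp classical_sets functions cardinality fsbigop.

Set Implicit Arguments.
Unset Strict Implicit.
Unset Printing Implicit Defensive.

Import GRing.Theory.
Local Open Scope classical_set_scope.
Local Open Scope ring_scope.

Definition bilinear_op (k : pzRingType) (U V W : lmodType k)
    (f : U -> V -> W) : Prop :=
  (forall u, linear (f u)) /\ (forall v, linear (f^~ v)).

Definition is_submod (k : pzRingType) (M : lmodType k) (S : set M) : Prop :=
  submod_closed [in S].

Definition lspan (k : pzRingType) (M : lmodType k) (S : set M) : set M :=
  [set x | exists (n : nat) (c : 'I_n -> k) (v : 'I_n -> M),
     (forall i, S (v i)) /\ x = \sum_i c i *: v i].

Definition setprod (k : pzRingType) (U V W : lmodType k) (f : U -> V -> W)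
    (P : set U) (Q : set V) : set W :=
  lspan [set f x y | x in P & y in Q].

HB.mixin Record Lmodule_isNUAlgebra (k : comPzRingType) A
    of GRing.Lmodule k A := {
  amul : A -> A -> A;
  amulA : associative amul;
  amul_bilinear : bilinear_op amul
}.

#[short(type="nuAlgType")]
HB.structure Definition NUAlgebra (k : comPzRingType) :=
  {A of Lmodule_isNUAlgebra k A & GRing.Lmodule k A}.

Notation "x ** y" := (amul x y) (at level 40, left associativity) : ring_scope.
Notation "P ** Q" := (setprod amul P Q) : classical_set_scope.

Definition idempotent_alg (k : comPzRingType) (A : nuAlgType k) : Prop :=
  ([set: A] ** [set: A])%classic = [set: A].

Definition is_ideal (k : comPzRingType) (A : nuAlgType k) (I : set A) : Prop :=
  is_submod I /\ (forall a x, I x -> I (a ** x) /\ I (x ** a)).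

(* [f] restricts to an algebra isomorphism from [D] onto [E]; its values
   outside [D] are irrelevant. *)
Definition alg_isom (k : comPzRingType) (A B : nuAlgType k)
    (D : set A) (E : set B) (f : A -> B) : Prop :=
  [/\ set_bij D E f,
      {in D &, forall x y, forall c, f (c *: x + y) = c *: f x + f y}
    & {in D &, forall x y, f (x ** y) = f x ** f y}].

(* [act t] stands for a map [dom t^-1 -> dom t]: it is a total function, but
   only its restriction to [dom t^-1] is meaningful. *)
Record ppaction (k : comPzRingType) (G : groupType) (A : nuAlgType k) :=
  PPAction {
  dom : G -> set A;
  act : G -> A -> A;
  dom_ideal : forall t, is_ideal (dom t);
  act_isom : forall t, alg_isom (dom t^-1%g) (dom t) (act t);
  dom1 : dom 1%g = [set: A];
  act1 : forall x, act 1%g x = x;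
  dom_idem : forall t, (dom t ** dom t)%classic = dom t;
  dom_comm : forall s t, (dom s ** dom t)%classic = (dom t ** dom s)%classic;
  act_dom : forall s t,
    act s @` (dom s^-1%g ** dom t)%classic = (dom s ** dom (s * t)%g)%classic;
  actM : forall s t x, (dom t^-1%g ** dom (s * t)^-1%g)%classic x ->
    act s (act t x) = act (s * t)%g x
}.

Record gaction (k : comPzRingType) (G : groupType) (B : nuAlgType k) :=
  GAction {
  gact : G -> B -> B;
  gact_isom : forall t, alg_isom [set: B] [set: B] (gact t);
  gact1 : forall x, gact 1%g x = x;
  gactM : forall s t x, gact s (gact t x) = gact (s * t)%g x
}.

(* The algebra [A] is identified with an ideal of [B] through an injective
   algebra homomorphism [iota]; this accounts for the closure of the notion of
   globalization under isomorphism of global actions. *)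
Definition globalization_along (k : comPzRingType) (G : groupType)
    (A B : nuAlgType k) (alpha : ppaction G A) (beta : gaction G B)
    (iota : A -> B) : Prop :=
  let I := range iota in
  [/\ alg_isom [set: A] I iota,
      is_ideal I,
      forall t, (I ** (gact beta t @` I))%classic
                = ((gact beta t @` I) ** I)%classic,
      forall t, iota @` dom alpha t = (I ** (gact beta t @` I))%classic
    & forall t x, dom alpha t^-1%g x ->
        iota (act alpha t x) = gact beta t (iota x)].

Definition minimal_globalization (k : comPzRingType) (G : groupType)
    (A B : nuAlgType k) (alpha : ppaction G A) (beta : gaction G B) : Prop :=
  exists iota : A -> B, globalization_along alpha beta iota /\
    lspan (\bigcup_t (gact beta t @` range iota)) = [set: B].

Record bimodule (k : comPzRingType) (A B : nuAlgType k) := Bimodule {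
  bimod_sort :> lmodType k;
  lact : A -> bimod_sort -> bimod_sort;
  ract : bimod_sort -> B -> bimod_sort;
  lact_bilinear : bilinear_op lact;
  ract_bilinear : bilinear_op ract;
  lactA : forall a a' x, lact (a ** a') x = lact a (lact a' x);
  ractA : forall x b b', ract x (b ** b') = ract (ract x b) b';
  lractA : forall a x b, ract (lact a x) b = lact a (ract x b)
}.

Definition unital_bimodule (k : comPzRingType) (A B : nuAlgType k)
    (X : bimodule A B) : Prop :=
  setprod (@lact k A B X) [set: A] [set: X] = [set: X] /\
  setprod (@ract k A B X) [set: X] [set: B] = [set: X].

(* By the universal property of the tensor product, an A-bimodule map
   [X (x)_B Y -> A] is given as a k-bilinear, B-balanced map [X -> Y -> A]
   that is A-linear on both sides; likewise for [Y (x)_A X -> B]. *)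
Record mcontext (k : comPzRingType) (A B : nuAlgType k) := MContext {
  mX : bimodule A B;
  mY : bimodule B A;
  tauA : mX -> mY -> A;
  tauB : mY -> mX -> B;
  tauA_bilinear : bilinear_op tauA;
  tauA_balanced : forall x b y, tauA (ract x b) y = tauA x (lact b y);
  tauA_lact : forall a x y, tauA (lact a x) y = a ** tauA x y;
  tauA_ract : forall x y a, tauA x (ract y a) = tauA x y ** a;
  tauB_bilinear : bilinear_op tauB;
  tauB_balanced : forall y a x, tauB (ract y a) x = tauB y (lact a x);
  tauB_lact : forall b y x, tauB (lact b y) x = b ** tauB y x;
  tauB_ract : forall y x b, tauB y (ract x b) = tauB y x ** b;
  tauAB : forall x y x', lact (tauA x y) x' = ract x (tauB y x');
  tauBA : forall y x y', lact (tauB y x) y' = ract y (tauA x y')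
}.

(* The image of a map out of a tensor product is the span of its values on
   pure tensors. *)
Definition tau_surjective (k : comPzRingType) (A B : nuAlgType k)
    (M : mcontext A B) : Prop :=
  setprod (@tauA k A B M) [set: mX M] [set: mY M] = [set: A] /\
  setprod (@tauB k A B M) [set: mY M] [set: mX M] = [set: B].

Definition morita_equivalence (k : comPzRingType) (A B : nuAlgType k)
    (M : mcontext A B) : Prop :=
  [/\ idempotent_alg A, idempotent_alg B,
      unital_bimodule (mX M), unital_bimodule (mY M) & tau_surjective M].

Section Bilinear.
Variables (k : comPzRingType) (U V W : lmodType k) (f : U -> V -> W).
Hypothesis fB : bilinear_op f.

Lemma bilDr u v w : f u (v + w) = f u v + f u w.
Proof. by have := fB.1 u 1 v w; rewrite !scale1r. Qed.

Lemma bilDl u v w : f (u + v) w = f u w + f v w.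
Proof. by have := fB.2 w 1 u v; rewrite !scale1r. Qed.

Lemma bil0r u : f u 0 = 0.
Proof. by apply: (addIr (f u 0)); rewrite -bilDr !add0r. Qed.

Lemma bil0l v : f 0 v = 0.
Proof. by apply: (addIr (f 0 v)); rewrite -bilDl !add0r. Qed.

Lemma bilZr c u v : f u (c *: v) = c *: f u v.
Proof. by have := fB.1 u c v 0; rewrite bil0r !addr0. Qed.

Lemma bilZl c u v : f (c *: u) v = c *: f u v.
Proof. by have := fB.2 v c u 0; rewrite bil0l !addr0. Qed.

Lemma bil_sumr (I : Type) (r : seq I) (F : I -> V) u :
  f u (\sum_(i <- r) F i) = \sum_(i <- r) f u (F i).
Proof. exact: (big_morph (f u) (bilDr u) (bil0r u)). Qed.

Lemma bil_suml (I : Type) (r : seq I) (F : I -> U) v :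
  f (\sum_(i <- r) F i) v = \sum_(i <- r) f (F i) v.
Proof.
exact: (big_morph (f^~ v) (fun x y => bilDl x y v) (bil0l v)).
Qed.

End Bilinear.

Section ContextAlgebra.
Variables (k : comPzRingType) (A B : nuAlgType k) (M : mcontext A B).

(* [((a, x), (y, b))] is the matrix with rows [a x] and [y b]. *)
Definition ctx : Type := ((A * mX M) * (mY M * B))%type.
HB.instance Definition _ := GRing.Lmodule.on ctx.

Definition ctx_mul (m n : ctx) : ctx :=
  ((m.1.1 ** n.1.1 + tauA m.1.2 n.2.1, lact m.1.1 n.1.2 + ract m.1.2 n.2.2),
   (ract m.2.1 n.1.1 + lact m.2.2 n.2.1, tauB m.2.1 n.1.2 + m.2.2 ** n.2.2)).

Let mulA := @amul_bilinear k A.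
Let mulB := @amul_bilinear k B.
Let tA := @tauA_bilinear _ _ _ M.
Let tB := @tauB_bilinear _ _ _ M.
Let lX := @lact_bilinear _ _ _ (mX M).
Let rX := @ract_bilinear _ _ _ (mX M).
Let lY := @lact_bilinear _ _ _ (mY M).
Let rY := @ract_bilinear _ _ _ (mY M).

Lemma ctx_mulA : associative ctx_mul.
Proof.
case=> [[a x] [y b]] [[a' x'] [y' b']] [[a'' x''] [y'' b'']].
rewrite /ctx_mul /=; congr ((_, _), (_, _)).
- rewrite (bilDr mulA) (bilDr tA) (bilDl mulA) (bilDl tA).
  by rewrite amulA tauA_lact tauA_ract tauA_balanced addrACA.
- rewrite (bilDr lX) (bilDr rX) (bilDl lX) (bilDl rX).
  by rewrite lactA lractA ractA tauAB addrACA.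
- rewrite (bilDr rY) (bilDr lY) (bilDl rY) (bilDl lY).
  by rewrite ractA lractA lactA tauBA addrACA.
- rewrite (bilDr tB) (bilDr mulB) (bilDl tB) (bilDl mulB).
  by rewrite tauB_balanced tauB_ract tauB_lact amulA addrACA.
Qed.

Lemma ctx_mul_bilinear : bilinear_op ctx_mul.
Proof.
by split=> [] [[a x] [y b]] c [[a' x'] [y' b']] [[a'' x''] [y'' b'']];
   rewrite /ctx_mul /=; congr ((_, _), (_, _)) => /=;
   rewrite ?(bilDr mulA) ?(bilDr tA) ?(bilDl mulA) ?(bilDl tA)
     ?(bilDr lX) ?(bilDr rX) ?(bilDl lX) ?(bilDl rX)
     ?(bilDr rY) ?(bilDr lY) ?(bilDl rY) ?(bilDl lY)
     ?(bilDr tB) ?(bilDr mulB) ?(bilDl tB) ?(bilDl mulB)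
     ?(bilZr mulA) ?(bilZr tA) ?(bilZl mulA) ?(bilZl tA)
     ?(bilZr lX) ?(bilZr rX) ?(bilZl lX) ?(bilZl rX)
     ?(bilZr rY) ?(bilZr lY) ?(bilZl rY) ?(bilZl lY)
     ?(bilZr tB) ?(bilZr mulB) ?(bilZl tB) ?(bilZl mulB);
   rewrite addrACA scalerDr.
Qed.

HB.instance Definition _ :=
  Lmodule_isNUAlgebra.Build k ctx ctx_mulA ctx_mul_bilinear.

Definition cornerA (a : A) : ctx := ((a, 0), (0, 0)).
Definition cornerB (b : B) : ctx := ((0, 0), (0, b)).

End ContextAlgebra.

Definition restricts_to (k : comPzRingType) (G : groupType)
    (C A : nuAlgType k) (theta : ppaction G C) (alpha : ppaction G A)
    (iota : A -> C) : Prop :=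
  forall t, iota @^-1` dom theta t = dom alpha t /\
    (forall x, dom alpha t^-1%g x ->
       act theta t (iota x) = iota (act alpha t x)).

Definition morita_equiv (k : comPzRingType) (G : groupType)
    (A A' : nuAlgType k) (alpha : ppaction G A) (alpha' : ppaction G A') :
    Prop :=
  exists M : mcontext A A', morita_equivalence M /\
  exists theta : ppaction G (ctx M),
  [/\ forall t,
        setprod (@tauB k A A' M)
          (setprod (@ract k A' A (mY M)) [set: mY M] (dom alpha t)) [set: mX M]
        = dom alpha' t,
      restricts_to theta alpha (@cornerA k A A' M)
    & restricts_to theta alpha' (@cornerB k A A' M)].

Definition morita_enveloping (k : comPzRingType) (G : groupType)
    (A B : nuAlgType k) (alpha : ppaction G A) (beta : gaction G B) : Prop :=
  exists (A' : nuAlgType k) (alpha' : ppaction G A'),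
    morita_equiv alpha alpha' /\ minimal_globalization alpha' beta.

Record direct_sum (k : comPzRingType) (I : choiceType) (M : lmodType k)
    (Mi : I -> set M) : Prop := DirectSum {
  direct_sum_submod : forall i, is_submod (Mi i);
  direct_sum_decomp : forall x, exists! f : I -> M,
    [/\ forall i, Mi i (f i), finite_set (f @^-1` [set~ 0])
      & x = \sum_(i \in [set: I]) f i]
}.

Record gradedAlg (k : comPzRingType) (G : groupType) := GradedAlg {
  galg_sort :> nuAlgType k;
  hcomp : G -> set galg_sort;
  hcomp_sum : direct_sum hcomp;
  hcomp_mul : forall r s a b, hcomp r a -> hcomp s b ->
    hcomp (r * s)%g (a ** b)
}.

Record graded_bimodule (k : comPzRingType) (G : groupType)
    (A B : gradedAlg k G) (X : bimodule A B) (Xg : G -> set X) : Prop :=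
  GradedBimodule {
  gbimod_sum : direct_sum Xg;
  gbimod_lact : forall r s a x, hcomp (g:=A) r a -> Xg s x ->
    Xg (r * s)%g (lact a x);
  gbimod_ract : forall r s x b, Xg r x -> hcomp (g:=B) s b ->
    Xg (r * s)%g (ract x b)
}.

Definition graded_equiv (k : comPzRingType) (G : groupType)
    (A B : gradedAlg k G) : Prop :=
  [/\ idempotent_alg A, idempotent_alg B
    & exists (M : mcontext A B) (Xg : G -> set (mX M)) (Yg : G -> set (mY M)),
      [/\ unital_bimodule (mX M) /\ unital_bimodule (mY M),
          graded_bimodule Xg /\ graded_bimodule Yg,
          forall r s x y, Xg r x -> Yg s y -> hcomp (g:=A) (r * s)%g (tauA x y),
          forall r s y x, Yg r y -> Xg s x -> hcomp (g:=B) (r * s)%g (tauB y x)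
        & tau_surjective M]].

Section SpanTheory.
Variables (k : comPzRingType) (M : lmodType k).
Implicit Type S : set M.

Lemma is_submodP S :
  is_submod S <-> S 0 /\ (forall c u v, S u -> S v -> S (c *: u + v)).
Proof.
split=> [[S0 SD]|[S0 SD]].
  split=> [|c u v Su Sv]; first by have := S0; rewrite inE.
  by have := SD c u v; rewrite !inE; apply.
by split=> [|c u v]; rewrite !inE //; apply: SD.
Qed.

Lemma submod0 S : is_submod S -> S 0.
Proof. by case/is_submodP. Qed.

Lemma submodD S u v : is_submod S -> S u -> S v -> S (u + v).
Proof.
by case/is_submodP=> _ /(_ 1 u v); rewrite scale1r => h Su Sv; apply: h.
Qed.

Lemma submodZ S c u : is_submod S -> S u -> S (c *: u).
Proof.
by case/is_submodP=> S0 /(_ c u 0); rewrite addr0 => h Su; apply: h.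
Qed.

Lemma submod_sum S (I : Type) (r : seq I) (F : I -> M) :
  is_submod S -> (forall i, S (F i)) -> S (\sum_(i <- r) F i).
Proof.
move=> Ss SF; elim/big_ind: _ => //; first exact: submod0.
by move=> u v; exact: submodD.
Qed.

Lemma lspan_submod S : is_submod (lspan S).
Proof.
apply/is_submodP; split.
  exists 0%N, (fun _ => 0), (fun _ => 0); rewrite big_ord0.
  by split=> // -[].
move=> d _ _ [n [c [v [Sv ->]]]] [m [e [w [Sw ->]]]].
exists (n + m)%N,
  (fun i => match fintype.split i with inl j => d * c j | inr j => e j end),
  (fun i => match fintype.split i with inl j => v j | inr j => w j end).
split=> [i|]; first by case: fintype.split.
rewrite big_split_ord scaler_sumr /=; congr (_ + _); apply: eq_bigr => i _.
  case: fintype.splitP => j /= h; last by have := ltn_ord i; rewrite h ltnNge leq_addr.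
  by rewrite (_ : j = i) ?scalerA //; apply: val_inj.
case: fintype.splitP => j /= h; first by have := ltn_ord j; rewrite -h ltnNge leq_addr.
by rewrite (_ : j = i) //; apply/val_inj/(@addnI n).
Qed.

Lemma lspan_sub S T : is_submod T -> S `<=` T -> lspan S `<=` T.
Proof.
move=> Ts ST _ [n [c [v [Sv ->]]]].
by apply: submod_sum => // i; apply: submodZ => //; apply: ST.
Qed.

Lemma sub_lspan S : S `<=` lspan S.
Proof.
move=> x Sx; exists 1%N, (fun _ => 1), (fun _ => x).
by rewrite big_ord1 scale1r.
Qed.

End SpanTheory.

Lemma in_setprod (k : comPzRingType) (U V W : lmodType k) (f : U -> V -> W)
    (P : set U) (Q : set V) u v : P u -> Q v -> setprod f P Q (f u v).
Proof. by move=> Pu Qv; apply: sub_lspan; exists u => //; exists v. Qed.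

Lemma setprod_sub (k : comPzRingType) (U V W : lmodType k) (f : U -> V -> W)
    (P : set U) (Q : set V) (T : set W) : is_submod T ->
  (forall u v, P u -> Q v -> T (f u v)) -> setprod f P Q `<=` T.
Proof.
by move=> Ts PQT; apply: lspan_sub => // _ [u Pu [v Qv <-]]; apply: PQT.
Qed.

Section ActionTheory.
Variables (k : comPzRingType) (G : groupType) (A : nuAlgType k).
Variable alpha : ppaction G A.
Local Notation D := (dom alpha).
Local Notation "''a_' t" := (act alpha t) (at level 8, t at level 2).

Let mulA := @amul_bilinear k A.

Lemma dom_submod t : is_submod (D t).
Proof. by have [] := dom_ideal alpha t. Qed.

Lemma dom_lmul t a x : D t x -> D t (a ** x).
Proof. by case: (dom_ideal alpha t) => _ h /(h a)[]. Qed.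

Lemma dom_rmul t a x : D t x -> D t (x ** a).
Proof. by case: (dom_ideal alpha t) => _ h /(h a)[]. Qed.

Lemma dom_dec t x : D t x -> (D t ** D t)%classic x.
Proof. by rewrite dom_idem. Qed.

Lemma act_in t x : D t^-1%g x -> D t ('a_t x).
Proof. by case: (act_isom alpha t) => -[+ _ _] _ _ => /[apply]. Qed.

Lemma act_inV t x : D t x -> D t^-1%g ('a_(t^-1%g) x).
Proof. by move=> Dx; apply: act_in; rewrite invgK. Qed.

Lemma act_lin t c x y : D t^-1%g x -> D t^-1%g y ->
  'a_t (c *: x + y) = c *: 'a_t x + 'a_t y.
Proof.
case: (act_isom alpha t) => _ h _ Dx Dy.
by apply: h; rewrite inE.
Qed.

Lemma act_mul t x y : D t^-1%g x -> D t^-1%g y ->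
  'a_t (x ** y) = 'a_t x ** 'a_t y.
Proof.
case: (act_isom alpha t) => _ _ h Dx Dy.
by apply: h; rewrite inE.
Qed.

Lemma actD t x y : D t^-1%g x -> D t^-1%g y -> 'a_t (x + y) = 'a_t x + 'a_t y.
Proof. by move=> Dx Dy; have := act_lin 1 Dx Dy; rewrite !scale1r. Qed.

Lemma act0 t : 'a_t 0 = 0.
Proof.
apply: (addIr ('a_t 0)); rewrite add0r -actD ?addr0 //;
  exact: submod0 (dom_submod _).
Qed.

Lemma actZ t c x : D t^-1%g x -> 'a_t (c *: x) = c *: 'a_t x.
Proof.
move=> Dx; rewrite -[c *: x]addr0 act_lin ?act0 ?addr0 //.
exact: submod0 (dom_submod _).
Qed.

Lemma act_sum t (I : Type) (r : seq I) (F : I -> A) :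
  (forall i, D t^-1%g (F i)) ->
  'a_t (\sum_(i <- r) F i) = \sum_(i <- r) 'a_t (F i).
Proof.
move=> DF; elim: r => [|i r IHr]; first by rewrite !big_nil act0.
by rewrite !big_cons actD ?IHr //; apply: submod_sum => //; apply: dom_submod.
Qed.

Lemma dom_prod_l s t x : (D s ** D t)%classic x -> D s x.
Proof.
by move: x; apply: setprod_sub => [|u v Du _]; [apply: dom_submod|apply: dom_rmul].
Qed.

Lemma dom_prod_r s t x : (D s ** D t)%classic x -> D t x.
Proof.
by move: x; apply: setprod_sub => [|u v _ Dv]; [apply: dom_submod|apply: dom_lmul].
Qed.

Lemma act_prod s t x : (D s^-1%g ** D t)%classic x -> D (s * t)%g ('a_s x).
Proof.
move=> Dx; have : (D s ** D (s * t)%g)%classic ('a_s x).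
  by rewrite -act_dom; exists x.
exact: dom_prod_r.
Qed.

Lemma actVK t x : D t x -> 'a_t ('a_(t^-1%g) x) = x.
Proof.
move=> Dx; rewrite actM mulgV ?act1 // invgK invg1 dom1.
apply: setprod_sub (dom_dec Dx); first exact: lspan_submod.
by move=> u v Du _; exact: in_setprod.
Qed.

Lemma actK t x : D t^-1%g x -> 'a_(t^-1%g) ('a_t x) = x.
Proof. by move=> Dx; rewrite -{2}(actVK Dx) invgK. Qed.

End ActionTheory.

Section SkewGroupAlgebra.
Variables (k : comPzRingType) (G : groupType) (A : nuAlgType k).
Variable alpha : ppaction G A.
Local Notation D := (dom alpha).
Local Notation "''a_' t" := (act alpha t) (at level 8, t at level 2).

Let mulA := @amul_bilinear k A.

Definition skew_fun : {pred G -> A} :=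
  fun f => `[< (forall t, D t (f t)) /\ finite_set (f @^-1` [set~ 0]) >].

(* [f] stands for the finite sum of the [f t delta_t]. *)
Record skew := Skew { skew_val :> G -> A; _ : skew_val \in skew_fun }.

Lemma skew_fun_submod : submod_closed skew_fun.
Proof.
split=> [|c f g /asboolP[Df ff] /asboolP[Dg fg]]; apply/asboolP; split.
- by move=> t; apply: submod0 (dom_submod _ _).
- by rewrite (_ : _ @^-1` _ = set0) // -subset0 => t; apply.
- move=> t; apply: submodD; first exact: dom_submod.
    by apply: submodZ; [exact: dom_submod|].
  exact: Dg.
- apply: (@sub_finite_set _ _ (f @^-1` [set~ 0] `|` g @^-1` [set~ 0])).
    move=> t /= h; apply/not_andP => -[f0 g0]; apply: h.
    by rewrite /GRing.add /= /GRing.scale /= f0 g0 scaler0 addr0.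
  by rewrite finite_setU.
Qed.

HB.instance Definition _ :=
  GRing.isSubmodClosed.Build k (G -> A) skew_fun
    (GRing.submod_closed_semi skew_fun_submod).

HB.instance Definition _ := [isSub for skew_val].
HB.instance Definition _ := [Choice of skew by <:].
HB.instance Definition _ := [SubChoice_isSubLmodule of skew by <:].

Lemma skewP (f g : skew) : (forall t, f t = g t) -> f = g.
Proof. by move=> fg; apply: val_inj; apply: funext. Qed.

Lemma skew_dom (f : skew) t : D t (f t).
Proof. by case: f => f /= /asboolP[]. Qed.

Lemma skew_finite (f : skew) : finite_set (f @^-1` [set~ 0]).
Proof. by case: f => f /= /asboolP[]. Qed.

(* The coefficient of [delta_(r * s)] in [(a delta_r) (b delta_s)]; the inverse
   of the isomorphism [act r] is [act r^-1], by [actK] and [actVK]. *)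
Definition skew_coef (r : G) (a b : A) : A := 'a_r ('a_(r^-1%g) a ** b).

Definition skew_mul_fun (f g : G -> A) : G -> A := fun u =>
  \sum_(r \in [set: G]) skew_coef r (f r) (g (r^-1 * u)%g).

Lemma coef0l r b : skew_coef r 0 b = 0.
Proof. by rewrite /skew_coef act0 (bil0l mulA) act0. Qed.

Lemma coef0r r a : skew_coef r a 0 = 0.
Proof. by rewrite /skew_coef (bil0r mulA) act0. Qed.

Lemma coef_arg_dom r a b : D r a -> D r^-1%g ('a_(r^-1%g) a ** b).
Proof. by move=> Da; apply/dom_rmul/act_inV. Qed.

Lemma coef_linr r c a b b' : D r a ->
  skew_coef r a (c *: b + b') = c *: skew_coef r a b + skew_coef r a b'.
Proof.
by move=> Da; rewrite /skew_coef mulA.1 act_lin //; apply: coef_arg_dom.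
Qed.

Lemma coef_linl r c a a' b : D r a -> D r a' ->
  skew_coef r (c *: a + a') b = c *: skew_coef r a b + skew_coef r a' b.
Proof.
move=> Da Da'; rewrite /skew_coef act_lin ?invgK // mulA.2 act_lin //;
  exact: coef_arg_dom.
Qed.

Lemma coef_sumr r a (I : Type) (s : seq I) (F : I -> A) : D r a ->
  skew_coef r a (\sum_(i <- s) F i) = \sum_(i <- s) skew_coef r a (F i).
Proof.
move=> Da; elim: s => [|i s IHs]; first by rewrite !big_nil coef0r.
by rewrite !big_cons -IHs -[F i]scale1r coef_linr // !scale1r.
Qed.

Lemma coef_suml r b (I : Type) (s : seq I) (F : I -> A) :
  (forall i, D r (F i)) ->
  skew_coef r (\sum_(i <- s) F i) b = \sum_(i <- s) skew_coef r (F i) b.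
Proof.
move=> DF; elim: s => [|i s IHs]; first by rewrite !big_nil coef0l.
rewrite !big_cons -IHs -[F i]scale1r coef_linl // ?scale1r //.
by apply: submod_sum => //; apply: dom_submod.
Qed.

Lemma coef_prod r s a b : D r a -> D s b ->
  (D r^-1%g ** D s)%classic ('a_(r^-1%g) a ** b).
Proof. by move=> Da Db; apply: in_setprod => //; apply: act_inV. Qed.

Lemma coef_dom r s a b : D r a -> D s b -> D (r * s)%g (skew_coef r a b).
Proof. by move=> Da Db; apply/act_prod/coef_prod. Qed.

Lemma coef_mulA s a b c : D s b -> a ** skew_coef s b c = skew_coef s (a ** b) c.
Proof.
move=> Db; have : b \in [set b | a ** skew_coef s b c = skew_coef s (a ** b) c /\ D s b].
  rewrite inE; move: (dom_dec Db); apply: setprod_sub => [|b1 b2 D1 D2] /=.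
    apply/is_submodP; split=> /= [|e u v [hu Du] [hv Dv]].
      by rewrite coef0l !(bil0r mulA) coef0l; split=> //; apply: submod0 (dom_submod _ _).
    rewrite coef_linl // !(mulA.1 a) coef_linl ?hu ?hv; try exact: dom_lmul.
    by split=> //; case/is_submodP: (dom_submod alpha s) => _; apply.
  have D12 a' : D s (a' ** b1) by exact: dom_lmul.
  split; last exact: dom_lmul.
  have aux x y : D s x -> D s y -> skew_coef s (x ** y) c = x ** skew_coef s y c.
    move=> Dx Dy; rewrite /skew_coef (@act_mul _ _ _ alpha s^-1%g) ?invgK // -amulA act_mul ?actVK //.
      exact: act_inV.
    exact: coef_arg_dom.
  by rewrite amulA !aux // amulA.
by rewrite inE => -[].
Qed.

Lemma coefA r s a b c : D r a -> D s b ->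
  skew_coef (r * s)%g (skew_coef r a b) c = skew_coef r a (skew_coef s b c).
Proof.
move=> Da Db; have Dab := coef_prod Da Db.
have DabV : (D s^-1%g ** D (r * s)^-1%g)%classic
    ('a_(s^-1%g) ('a_(r^-1%g) a ** b) ** c).
  have : (D s^-1%g ** D (s^-1 * r^-1)%g)%classic ('a_(s^-1%g) ('a_(r^-1%g) a ** b)).
    by rewrite -act_dom invgK dom_comm; exists ('a_(r^-1%g) a ** b).
  rewrite invgM.
  move: ('a_(s^-1%g) _); apply: (@lspan_sub _ _ _ (fun x => _ (x ** c))).
    apply/is_submodP; split=> [|e u v hu hv].
      by rewrite (bil0l mulA); apply: submod0 (lspan_submod _).
    rewrite mulA.2; apply: submodD; first exact: lspan_submod.
      by apply: submodZ => //; apply: lspan_submod.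
    exact: hv.
  by move=> _ [u Du [v Dv <-]]; rewrite -amulA; apply: in_setprod => //; apply: dom_rmul.
have Ers : ((r * s)^-1 * r = s^-1)%g by rewrite invgM mulgVK.
rewrite {1}/skew_coef {1}/skew_coef actM ?Ers ?invgK //.
rewrite -actM // -/(skew_coef s _ c) -coef_mulA //.
Qed.

Lemma skew_mul_supp (f g : skew) : finite_set (skew_mul_fun f g @^-1` [set~ 0]).
Proof.
apply: (@sub_finite_set _ _
  [set (r * s)%g | r in f @^-1` [set~ 0] & s in g @^-1` [set~ 0]]).
  move=> u /= h; apply: contrapT => hu; apply: h; apply: fsbig1 => r _.
  have [fr|fr] := pselect (f r = 0); first by rewrite fr coef0l.
  have [gs|gs] := pselect (g (r^-1 * u)%g = 0); first by rewrite gs coef0r.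
  by case: hu; exists r => //; exists (r^-1 * u)%g => //; rewrite mulVKg.
exact: finite_image2 (skew_finite f) (skew_finite g).
Qed.

Lemma skew_mul_closed (f g : skew) : skew_mul_fun f g \in skew_fun.
Proof.
apply/asboolP; split; last exact: skew_mul_supp.
move=> u; apply: submod_sum => [|r]; first exact: dom_submod.
by rewrite -{1}(mulVKg r u); apply: coef_dom; apply: skew_dom.
Qed.

Definition skew_mul (f g : skew) : skew := Skew (skew_mul_closed f g).

Definition skew_supp (f : skew) : {fset G} := fset_set (f @^-1` [set~ 0]).

Lemma skew_suppPn (f : skew) t : t \notin skew_supp f -> f t = 0.
Proof.
rewrite in_fset_set; last exact: skew_finite.
by move=> /negP h; apply: contrapT => ft; apply: h; rewrite inE.
Qed.

Lemma skew_mulE (f g : skew) (S : {fset G}) u : {subset skew_supp f <= S} ->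
  skew_mul f g u = \sum_(r <- S) skew_coef r (f r) (g (r^-1 * u)%g).
Proof.
move=> fS; apply: fsbigTE => r rS; rewrite skew_suppPn ?coef0l //.
by apply: contra rS => /fS.
Qed.

Lemma skew_mulA : associative skew_mul.
Proof.
move=> f g h; apply: skewP => u.
set fg := skew_mul f g; set gh := skew_mul g h.
pose R := skew_supp f; pose S := skew_supp g.
pose Q : {fset G} := [fset (r * s)%g | r in R, s in S]%fset.
have g0 r q : r \in R -> q \notin Q -> g (r^-1 * q)%g = 0.
  move=> rR qQ; apply: skew_suppPn; apply: contra qQ => sS.
  by apply/imfset2P; exists r => //; exists (r^-1 * q)%g => //; rewrite mulVKg.
have fgQ : {subset skew_supp fg <= Q}.
  move=> q; apply: contraTT => qQ.
  rewrite in_fset_set; last exact: skew_finite.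
  rewrite notin_setE /=; rewrite -[skew_mul_fun f g q]/(skew_mul f g q) (@skew_mulE f g R) //.
  apply; rewrite big_seq big1 // => r rR.
  by rewrite g0 // coef0r.
rewrite [RHS](@skew_mulE fg h Q) // [LHS](@skew_mulE f gh R) //.
have E q : skew_coef q (fg q) (h (q^-1 * u)%g)
  = \sum_(r <- R) skew_coef r (f r)
      (skew_coef (r^-1 * q)%g (g (r^-1 * q)%g) (h (q^-1 * u)%g)).
  rewrite /fg (@skew_mulE f g R) // coef_suml.
    apply: eq_bigr => r _; rewrite -coefA ?mulVKg //; exact: skew_dom.
  by move=> r; rewrite -{1}(mulVKg r q); apply: coef_dom; apply: skew_dom.
under [RHS]eq_bigr do rewrite E.
rewrite exchange_big /= !big_seq; apply: eq_bigr => r rR.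
rewrite -coef_sumr; last exact: skew_dom.
congr skew_coef; rewrite /gh /= /skew_mul_fun.
rewrite (@reindex_fsbigT _ _ _ _ _ (fun q => r^-1 * q)%g); last first.
  by exists (fun q => r * q)%g => q; rewrite ?mulVKg ?mulKg.
rewrite (@fsbigTE _ _ _ _ Q) => [|q qQ]; last by rewrite g0 // coef0l.
by apply: eq_bigr => q _; rewrite invgM invgK -mulgA mulVKg.
Qed.

Lemma skew_mul_bilinear : bilinear_op skew_mul.
Proof.
split=> [f c g h|h c f g]; apply: skewP => u.
  rewrite [RHS](_ : _ = c *: skew_mul f g u + skew_mul f h u) //.
  rewrite !(@skew_mulE _ _ (skew_supp f)) // scaler_sumr -big_split /=.
  by apply: eq_bigr => r _; rewrite -coef_linr //; apply: skew_dom.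
rewrite [RHS](_ : _ = c *: skew_mul f h u + skew_mul g h u) //.
set fg : skew := c *: f + g.
pose S := (skew_supp f `|` skew_supp g `|` skew_supp fg)%fset.
rewrite !(@skew_mulE _ _ S) ?scaler_sumr -?big_split /=;
  try by move=> r rS; rewrite !in_fsetU rS ?orbT.
by apply: eq_bigr => r _; rewrite -coef_linl //; apply: skew_dom.
Qed.

HB.instance Definition _ :=
  Lmodule_isNUAlgebra.Build k skew skew_mulA skew_mul_bilinear.

(* The component [D t delta_t]: the coefficient at [t] lies in [D t] by
   [skew_dom]. *)
Definition skew_comp (t : G) : set skew :=
  [set f | forall s, s <> t -> f s = 0].

Lemma skew_sumE (I : Type) (s : seq I) (F : I -> skew) t :
  (\sum_(i <- s) F i) t = \sum_(i <- s) F i t.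
Proof. by elim/big_rec2: _ => // i x y _ <-. Qed.

Lemma skew_delta_subproof (f : skew) t :
  (fun s => if s == t then f s else 0) \in skew_fun.
Proof.
apply/asboolP; split=> [s|].
  by case: eqP => _; [apply: skew_dom|apply: submod0 (dom_submod _ _)].
apply: (@sub_finite_set _ _ [set t]); last exact: finite_set1.
by move=> s /=; case: eqP.
Qed.

Definition skew_delta (f : skew) t : skew := Skew (skew_delta_subproof f t).

Lemma skew_comp_sum : direct_sum skew_comp.
Proof.
split=> [t|f].
  apply/is_submodP; split=> // c f g f0 g0 s st.
  have -> : (c *: f + g) s = c *: f s + g s by [].
  by rewrite f0 // g0 // scaler0 addr0.
have key (F : G -> skew) t : (forall t, skew_comp t (F t)) ->
    finite_set (F @^-1` [set~ 0]) -> (\sum_(s \in [set: G]) F s) t = F t t.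
  move=> CF fF; pose S := fset_set (F @^-1` [set~ 0]).
  have F0 s : s \notin S -> F s = 0.
    by rewrite in_fset_set // notin_setE /= => h; apply: contrapT.
  rewrite (@fsbigTE _ _ _ _ S) // skew_sumE.
  case: (boolP (t \in S)) => tS.
    rewrite (big_fsetD1 t) //= big_seq big1 ?addr0 // => s.
    by rewrite in_fsetD1 => /andP[/eqP st _]; apply: CF => /esym.
  rewrite F0 // big_seq big1 // => s sS; apply: CF => ts.
  by move: tS; rewrite ts sS.
exists (skew_delta f); split.
  have Cd t : skew_comp t (skew_delta f t) by move=> s /= /eqP/negPf ->.
  have fd : finite_set (skew_delta f @^-1` [set~ 0]).
    apply: (@sub_finite_set _ _ (f @^-1` [set~ 0])); last exact: skew_finite.
    move=> t /= h ft; apply: h; apply: skewP => s /=.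
    by case: eqP => // ->.
  split=> //; apply: skewP => t; rewrite key //= eqxx //.
move=> F [CF fF fE]; apply: funext => t; apply: skewP => s /=.
case: eqP => [->|st]; last by rewrite CF.
by rewrite fE key.
Qed.

Lemma skew_comp_mul r s f g : skew_comp r f -> skew_comp s g ->
  skew_comp (r * s)%g (f ** g).
Proof.
move=> fr gs u urs; apply: fsbig1 => t _.
have [->|tr] := pselect (t = r); last by rewrite fr // coef0l.
rewrite gs ?coef0r // => us; apply: urs; by rewrite -us mulVKg.
Qed.

Definition skew_galg : gradedAlg k G :=
  GradedAlg skew_comp_sum skew_comp_mul.

End SkewGroupAlgebra.

Section GlobalAction.
Variables (k : comPzRingType) (G : groupType) (B : nuAlgType k).
Hypothesis BB : idempotent_alg B.
Variable beta : gaction G B.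

Let domT := fun _ : G => [set: B].

Lemma gpa_ideal t : is_ideal (domT t).
Proof. by split=> //; apply/is_submodP. Qed.

Lemma gpa_act_dom s (t : G) :
  gact beta s @` (domT s^-1%g ** domT t)%classic
  = (domT s ** domT (s * t)%g)%classic.
Proof.
rewrite /domT BB; case: (gact_isom beta s) => -[_ _ h] _ _.
by apply/seteqP; split=> // x _; apply: h.
Qed.

Definition ppaction_of_global : ppaction G B :=
  @PPAction k G B domT (gact beta) gpa_ideal (gact_isom beta) erefl
    (gact1 beta) (fun=> BB) (fun _ _ => erefl) gpa_act_dom
    (fun s t x _ => gactM beta s t x).

End GlobalAction.

Lemma minimal_idempotent (k : comPzRingType) (G : groupType)
    (A B : nuAlgType k) (alpha : ppaction G A) (beta : gaction G B) :
  minimal_globalization alpha beta -> idempotent_alg B.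
Proof.
case=> iota [[isoI idI _ _ _] minB]; apply/seteqP; split=> // b _.
have : lspan (\bigcup_t (gact beta t @` range iota)) b by rewrite minB.
apply: lspan_sub; first exact: lspan_submod.
move=> _ [t _ [_ [a _ <-] <-]].
have : (dom alpha 1%g ** dom alpha 1%g)%classic a by rewrite dom_idem dom1.
case: isoI => _ linI mulI; case: (gact_isom beta t) => _ ling mulg.
pose P a := ([set: B] ** [set: B])%classic (gact beta t (iota a)).
have P0 : gact beta t (iota 0) = 0.
  have i0 : iota 0 = 0.
    have := linI 0 0 (in_setT _) (in_setT _) 1.
    by rewrite !scale1r addr0 -{1}[iota 0]addr0 => /addrI.
  have := ling 0 0 (in_setT _) (in_setT _) 1.
  by rewrite i0 !scale1r addr0 -{1}[gact beta t 0]addr0 => /addrI.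
rewrite -[X in _ -> X]/(P a); move: a; apply: setprod_sub.
  apply/is_submodP; split; first by rewrite /P P0; apply: submod0 (lspan_submod _).
  move=> c u v Pu Pv; rewrite /P linI ?in_setT // ling ?in_setT //.
  by case/is_submodP: (lspan_submod [set x ** y | x in [set: B] & y in [set: B]]) => _; apply.
by move=> u v _ _; rewrite /P mulI ?in_setT // mulg ?in_setT //; apply: in_setprod.
Qed.

Lemma enveloping_idempotent (k : comPzRingType) (G : groupType)
    (A B : nuAlgType k) (alpha : ppaction G A) (beta : gaction G B) :
  morita_enveloping alpha beta -> idempotent_alg B.
Proof. by case=> A' [alpha' [_ /minimal_idempotent]]. Qed.

(* Main.v *)
From HB Require Import structures.
From mathcomp Require Import all_boot all_algebra.
From mathcomp Require Import finmap.
From mathcomp Require Import boolp classical_sets functions cardinality fsbigop.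
Require Import Defs.

(** Two facts about skew group algebras relate them by graded equivalences, which
    compose ([graded_equiv_trans]).

    Let [alpha] and [alpha'] be Morita equivalent through a partial action [theta]
    of the context algebra. The domains of [theta] are idempotent ideals, so they
    split into Peirce blocks, and [theta] respects these blocks. Hence the skew
    group algebra of [theta] is a two by two matrix algebra, whose corners are the
    skew group algebras of [alpha] and [alpha'] ([morita_equiv_graded_equiv]). Let
    next [beta], acting on [B], be a minimal globalization of [alpha'], acting on
    the ideal [A']. The skew group algebra of [alpha'] is then a corner of the one
    of [beta], with off-diagonal blocks the sums of the [A' delta_t] and of the
    [beta_t(A') delta_t], and minimality says that this corner is full
    ([minimal_globalization_graded_equiv]). Composing the two equivalences relates
    [alpha] to each of its Morita enveloping actions.

    Uniqueness follows. Two Morita enveloping actions have graded-equivalent skew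
    group algebras. The skew group algebra of a global action is strongly graded,
    so the components of degree one of the bimodules form a Morita equivalence
    between the two algebras, on which [t] should act by [x |-> delta_t x delta_t^-1].
    As [delta_t] is only a multiplier, it does not act on a bimodule; one replaces
    [x] by the functions [g |-> delta_g (a x b) delta_g^-1], which the group
    translates ([orbit_morita_equiv]). Passing to functions in the same way stands
    in for the tensor product when Morita contexts are composed ([comp_context]).

    For existence, consider the finitely supported matrices over the skew group
    algebra whose entry at [(p, q)] is homogeneous of degree [p^-1 * q], with the
    translation action of the group. Those with entries in the product of the
    components of degrees [p^-1] and [q] form an ideal whose translates span.
    Conjugating the entries identifies this ideal with the matrices over [A] with
    entries in [D p ** D q] ([regular_minimal_globalization]). Adding to the index
    set a fixed point, with domain [A], gives larger matrices: their corner at that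
    point is [A], their other corner is the ideal, and the same formula defines a
    partial action on all of them ([regular_morita_equiv]). *)

Set Implicit Arguments.
Unset Strict Implicit.
Unset Printing Implicit Defensive.

Import GRing.Theory.
Local Open Scope classical_set_scope.
Local Open Scope ring_scope.

(** * Spans, direct sums and algebra homomorphisms *)

Section Spans.
Variable k : comPzRingType.
Implicit Types U V W M : lmodType k.

Lemma image2_in (X Y Z : Type) (f : X -> Y -> Z) u v :
  [set f x y | x in [set: X] & y in [set: Y]] (f u v).
Proof. by exists u => //; exists v. Qed.

Lemma lin0 U V (f : U -> V) : linear f -> f 0 = 0.
Proof.
move=> fl; have := fl 1 0 0.
by rewrite !scale1r addr0 -{1}[f 0]addr0 => /addrI.
Qed.

Lemma linD U V (f : U -> V) : linear f -> {morph f : x y / x + y}.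
Proof. by move=> fl x y; have := fl 1 x y; rewrite !scale1r. Qed.

Lemma lin_sum U V (f : U -> V) (I : Type) (r : seq I) (F : I -> U) : linear f ->
  f (\sum_(i <- r) F i) = \sum_(i <- r) f (F i).
Proof. by move=> fl; exact: (big_morph f (linD fl) (lin0 fl)). Qed.

Lemma submodT M : is_submod [set: M].
Proof. exact/is_submodP. Qed.

Lemma submod_preim U V (f : U -> V) (S : set V) :
  linear f -> is_submod S -> is_submod (f @^-1` S).
Proof.
move=> fl /is_submodP[S0 SD]; apply/is_submodP; split=> [|c u v Su Sv].
  by rewrite /preimage /= lin0.
by rewrite /preimage /= fl; apply: SD.
Qed.

Lemma submod_image U V (f : U -> V) (S : set U) :
  linear f -> is_submod S -> is_submod (f @` S).
Proof.
move=> fl /is_submodP[S0 SD]; apply/is_submodP; split=> [|c _ _ [u Su <-] [v Sv <-]].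
  by exists 0; rewrite ?lin0.
by exists (c *: u + v); rewrite ?fl //; apply: SD.
Qed.

Lemma submodI M (S T : set M) : is_submod S -> is_submod T -> is_submod (S `&` T).
Proof.
move=> /is_submodP[S0 SD] /is_submodP[T0 TD]; apply/is_submodP; split=> //.
by move=> c u v [Su Tu] [Sv Tv]; split; [apply: SD|apply: TD].
Qed.

Lemma submod_eq U V (f g : U -> V) : linear f -> linear g ->
  is_submod [set x | f x = g x].
Proof.
move=> fl gl; apply/is_submodP; split=> /= [|c u v hu hv].
  by rewrite !lin0.
by rewrite fl gl hu hv.
Qed.

Lemma submod_linear U V M (g : M -> U -> V) : (forall u, linear (g^~ u)) ->
  is_submod [set m | linear (g m)].
Proof.
move=> gl; apply/is_submodP; split=> [c u v|e m n hm hn c u v] /=.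
  by rewrite !(lin0 (gl _)) scaler0 addr0.
by rewrite !gl hm hn !scalerDr !scalerA mulrC addrACA.
Qed.

Lemma lspan_id M (S : set M) : is_submod S -> lspan S = S.
Proof.
move=> Ss; apply/seteqP; split; last exact: sub_lspan.
exact: lspan_sub.
Qed.

Lemma setprod_submod U V W (f : U -> V -> W) P Q : is_submod (setprod f P Q).
Proof. exact: lspan_submod. Qed.

Lemma setprod_mono U V W (f : U -> V -> W) P Q P' Q' :
  P `<=` P' -> Q `<=` Q' -> setprod f P Q `<=` setprod f P' Q'.
Proof.
move=> PP' QQ'; apply: setprod_sub; first exact: lspan_submod.
by move=> u v /PP' Pu /QQ' Qv; apply: in_setprod.
Qed.

Lemma bil_span U V W (f : U -> V -> W) (S : set U) (S' : set V) (T : set W) :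
  bilinear_op f -> is_submod T ->
  (forall u v, S u -> S' v -> T (f u v)) ->
  forall u v, lspan S u -> lspan S' v -> T (f u v).
Proof.
move=> [fr fl] Ts h u v Su; move: v; apply: lspan_sub.
  exact: (submod_preim (fr u) Ts).
move=> v S'v; move: u Su; apply: lspan_sub.
  exact: (submod_preim (fl v) Ts).
by move=> u Su; apply: h.
Qed.

Definition span_pred M (S : set M) : {pred M} := fun x => `[< lspan S x >].

Lemma span_pred_closed M (S : set M) : submod_closed (span_pred S).
Proof.
have /is_submodP[S0 SD] := lspan_submod S.
by split=> [|c x y /asboolP Sx /asboolP Sy]; apply/asboolP => //; apply: SD.
Qed.

HB.instance Definition _ M (S : set M) :=
  GRing.isSubmodClosed.Build k M (span_pred S)
    (GRing.submod_closed_semi (@span_pred_closed M S)).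

(** Carried by the span of [S], so that every set [S] yields a module, with no
    closure condition to supply. *)
Record spanT M (S : set M) := SpanT {span_val :> M; _ : span_val \in span_pred S}.

HB.instance Definition _ M (S : set M) := [isSub for @span_val M S].
HB.instance Definition _ M (S : set M) := [Choice of spanT S by <:].
HB.instance Definition _ M (S : set M) := [SubChoice_isSubLmodule of spanT S by <:].

Section SpanType.
Variables (M : lmodType k) (S : set M).

Lemma spanP (x y : spanT S) : x = y :> M -> x = y.
Proof. exact: val_inj. Qed.

Lemma span_in (x : spanT S) : lspan S x.
Proof. by case: x => x /= /asboolP. Qed.

Definition mkspan x (Sx : lspan S x) : spanT S := SpanT (introT (asboolP _) Sx).

Lemma span_lin : linear (@span_val M S).
Proof. by []. Qed.

Lemma span_ind (P : set (spanT S)) : is_submod P ->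
  (forall x : spanT S, S x -> P x) -> forall x, P x.
Proof.
move=> Ps h x; have [n [c [v [Sv xE]]]] := span_in x.
pose w i := mkspan (sub_lspan (Sv i)).
have -> : x = \sum_i c i *: w i.
  by apply: spanP; rewrite (lin_sum _ _ span_lin) xE.
by apply: submod_sum => // i; apply: submodZ => //; apply/h/Sv.
Qed.

Lemma span_indl (S' : set M) (P : set (spanT S)) : is_submod P ->
  S' `<=` S ->
  (forall x : spanT S, S' x -> P x) -> forall x : spanT S, lspan S' x -> P x.
Proof.
move=> Ps S'S h x [n [c [v [Sv xE]]]].
pose w i := mkspan (sub_lspan (S'S _ (Sv i))).
have -> : x = \sum_i c i *: w i.
  by apply: spanP; rewrite (lin_sum _ _ span_lin) xE.
by apply: submod_sum => // i; apply: submodZ => //; apply/h/Sv.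
Qed.

End SpanType.

End Spans.

Section DirectSums.
Variables (k : comPzRingType) (I : choiceType) (M : lmodType k).
Variable Mi : I -> set M.

Lemma ds_span : direct_sum Mi -> forall x, lspan (\bigcup_i Mi i) x.
Proof.
case=> _ h x; have [f [[Mf _ ->] _]] := h x.
apply: submod_sum; first exact: lspan_submod.
by move=> i; apply: sub_lspan; exists i.
Qed.

Let restr (S : {fset I}) (f : I -> M) i := if i \in S then f i else 0.

Let restr_in S f : (forall i, is_submod (Mi i)) -> (forall i, Mi i (f i)) ->
  forall i, Mi i (restr S f i).
Proof. by move=> Ms Mf i; rewrite /restr; case: ifP => // _; apply: submod0. Qed.

Let restr_fin S f : finite_set (restr S f @^-1` [set~ 0]).
Proof.
apply: (@sub_finite_set _ _ [set` S]); last exact: finite_fset.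
by move=> i /=; rewrite /restr; case: ifP.
Qed.

Let restr_sum S f : \sum_(i \in [set: I]) restr S f i = \sum_(i <- S) f i.
Proof.
rewrite (@fsbigTE _ _ _ _ S) => [|i /negPf iS]; last by rewrite /restr iS.
by rewrite !big_seq; apply: eq_bigr => i iS; rewrite /restr iS.
Qed.

Lemma ds_indep : direct_sum Mi -> forall (S : {fset I}) f,
  (forall i, Mi i (f i)) -> \sum_(i <- S) f i = 0 -> forall i, i \in S -> f i = 0.
Proof.
case=> Ms h S f Mf f0 i iS.
have [g [_ gU]] := h 0.
have g0 : g = fun=> 0.
  apply: gU; split=> [j||]; first exact: submod0.
    by rewrite (_ : _ @^-1` _ = set0) // -subset0 => t; apply.
  by rewrite fsbig1.
have /(congr1 (@^~ i)) : g = restr S f.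
  by apply: gU; split; [exact: restr_in|exact: restr_fin|rewrite restr_sum].
by rewrite g0 /restr iS.
Qed.

(** The form in which directness is checked below. Uniqueness of a decomposition
    is independence, applied to the difference of two of them. *)
Lemma ds_intro : (forall i, is_submod (Mi i)) ->
  (forall x, lspan (\bigcup_i Mi i) x) ->
  (forall (S : {fset I}) f, (forall i, Mi i (f i)) -> \sum_(i <- S) f i = 0 ->
    forall i, i \in S -> f i = 0) -> direct_sum Mi.
Proof.
move=> Ms sp ind; split=> // x.
have supp f : finite_set (f @^-1` [set~ 0]) ->
    exists S : {fset I}, forall i, i \notin S -> f i = 0 :> M.
  move=> ff; exists (fset_set (f @^-1` [set~ 0])) => i.
  by rewrite in_fset_set // notin_setE /= => h; apply: contrapT.
have [f [Mf ff xE]] : exists f : I -> M, [/\ forall i, Mi i (f i),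
    finite_set (f @^-1` [set~ 0]) & x = \sum_(i \in [set: I]) f i].
  move: x (sp x); apply: lspan_sub => [|x [i _ Mx]].
    apply/is_submodP; split=> [|c u v [f [Mf ff ->]] [g [Mg gf ->]]].
      exists (fun=> 0); split=> [i||]; first exact: submod0.
        by rewrite (_ : _ @^-1` _ = set0) // -subset0 => t; apply.
      by rewrite fsbig1.
    have [S fS] := supp f ff; have [T gT] := supp g gf.
    exists (fun i => c *: f i + g i); split=> [i||].
    - by case/is_submodP: (Ms i) => _; apply.
    - apply: (@sub_finite_set _ _ [set` (S `|` T)%fset]); last exact: finite_fset.
      move=> i /=; rewrite in_fsetU; case: (boolP (i \in S)) => //= /fS ->.
      by case: (boolP (i \in T)) => //= /gT ->; rewrite scaler0 addr0.
    - rewrite !(@fsbigTE _ _ _ _ (S `|` T)%fset).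
      + by rewrite scaler_sumr -big_split.
      + by move=> i; rewrite in_fsetU negb_or => /andP[/fS -> /gT ->]; rewrite scaler0 addr0.
      + by move=> i; rewrite in_fsetU negb_or => /andP[_ /gT ->].
      + by move=> i; rewrite in_fsetU negb_or => /andP[/fS -> _].
  exists (restr [fset i]%fset (fun=> x)); split; last by rewrite restr_sum big_seq_fset1.
    by move=> j; rewrite /restr in_fset1; case: eqP => [->|_] //; apply: submod0.
  exact: restr_fin.
exists f; split=> // g [Mg gf xE'].
have [S fS] := supp f ff; have [T gT] := supp g gf.
apply: funext => i; pose R := (S `|` T)%fset.
case: (boolP (i \in R)); last by rewrite in_fsetU negb_or => /andP[/fS -> /gT ->].
move=> iR; apply/eqP; rewrite -subr_eq0; apply/eqP.
apply: (ind R (fun i => f i - g i)) => // [j|].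
  by rewrite -[- g j]scaleN1r addrC; case/is_submodP: (Ms j) => _; apply.
have fR : x = \sum_(i <- R) f i.
  by rewrite xE (@fsbigTE _ _ _ _ R) // => j; rewrite in_fsetU negb_or => /andP[/fS -> _].
have gR : x = \sum_(i <- R) g i.
  by rewrite xE' (@fsbigTE _ _ _ _ R) // => j; rewrite in_fsetU negb_or => /andP[_ /gT ->].
by rewrite sumrB -fR -gR subrr.
Qed.

(** Pairing with an element of degree [u] multiplies all degrees of a relation
    between homogeneous elements by [u]. *)
Lemma ds_indep_shift (h g : I -> I) : cancel h g -> cancel g h ->
  direct_sum Mi -> forall (S : {fset I}) f,
  (forall i, Mi (h i) (f i)) -> \sum_(i <- S) f i = 0 -> forall i, i \in S -> f i = 0.
Proof.
move=> hK gK ds S f Mf f0 i iS.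
have := @ds_indep ds [fset h i | i in S]%fset (fun j => f (g j)).
rewrite -[i]hK; apply.
- by move=> j; rewrite -{1}[j]gK.
- rewrite big_imfset /=; last by move=> x y _ _; apply: can_inj hK _ _.
  by rewrite -[RHS]f0; apply: eq_bigr => j _; rewrite hK.
- exact: in_imfset.
Qed.

End DirectSums.

Section Algebras.
Variable k : comPzRingType.
Implicit Types A B C N : nuAlgType k.

Lemma mulB A : bilinear_op (@amul k A).
Proof. exact: amul_bilinear. Qed.

Definition amul0l A (x : A) : 0 ** x = 0 := bil0l (mulB A) x.
Definition amul0r A (x : A) : x ** 0 = 0 := bil0r (mulB A) x.
Definition amulDl A (x y z : A) : (x + y) ** z = x ** z + y ** z := bilDl (mulB A) x y z.
Definition amulDr A (x y z : A) : z ** (x + y) = z ** x + z ** y := bilDr (mulB A) z x y.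

Lemma setprodA A (P Q R : set A) : ((P ** Q) ** R = P ** (Q ** R))%classic.
Proof.
apply/seteqP; split; apply: setprod_sub; try exact: lspan_submod.
  move=> x r Px Rr; move: x Px; apply: setprod_sub.
    by apply: (submod_preim (f := amul^~ r)); [exact: (mulB A).2|exact: lspan_submod].
  move=> p q Pp Qq; rewrite /preimage /= -amulA.
  by apply: in_setprod => //; apply: in_setprod.
move=> p x Pp; move: x; apply: setprod_sub.
  by apply: (submod_preim (f := amul p)); [exact: (mulB A).1|exact: lspan_submod].
move=> q r Qq Rr; rewrite /preimage /= amulA.
by apply: in_setprod => //; apply: in_setprod.
Qed.

Lemma ideal_mull A (D : set A) a x : is_ideal D -> D x -> D (a ** x).
Proof. by case=> _ h /(h a)[]. Qed.

Lemma ideal_mulr A (D : set A) a x : is_ideal D -> D x -> D (x ** a).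
Proof. by case=> _ h /(h a)[]. Qed.

Lemma idealT A : is_ideal [set: A].
Proof. by split=> //; exact: submodT. Qed.

Lemma ideal_prod A (D E : set A) : is_ideal D -> is_ideal E -> is_ideal (D ** E)%classic.
Proof.
move=> Di Ei; split; first exact: lspan_submod.
move=> a x Dx; split; move: x Dx; apply: setprod_sub.
- by apply: (submod_preim (f := amul a)); [exact: (mulB A).1|exact: lspan_submod].
- by move=> u v Du Ev; rewrite /preimage /= amulA; apply: in_setprod => //; apply: ideal_mull.
- by apply: (submod_preim (f := amul^~ a)); [exact: (mulB A).2|exact: lspan_submod].
- by move=> u v Du Ev; rewrite /preimage /= -amulA; apply: in_setprod => //; apply: ideal_mulr.
Qed.

Definition alg_hom A B (f : A -> B) : Prop :=
  linear f /\ {morph f : x y / x ** y}.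

Lemma alg_hom_isom A B (f : A -> B) : alg_hom f -> injective f ->
  alg_isom [set: A] (range f) f.
Proof.
move=> [fl fm] fi; split.
- split=> [x _|x y _ _|y [x _ <-]]; [by exists x|exact: fi|by exists x].
- by move=> x y _ _ c; rewrite fl.
- by move=> x y _ _; rewrite fm.
Qed.

Lemma alg_isom_hom A B E (f : A -> B) : alg_isom [set: A] E f ->
  alg_hom f /\ injective f.
Proof.
case=> -[_ fi _] fl fm; split; first split=> [c x y|x y].
- by apply: fl; rewrite in_setT.
- by apply: fm; rewrite in_setT.
- by move=> x y; apply: fi; rewrite in_setT.
Qed.

Lemma idem_dec A : idempotent_alg A -> forall x, ([set: A] ** [set: A])%classic x.
Proof. by move=> ->. Qed.

End Algebras.

(** * Morita contexts inside an algebra *)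

Section EmbeddedBimodule.
Variables (k : comPzRingType) (A B N : nuAlgType k) (i : A -> N) (j : B -> N).
Variable U : set N.
Hypotheses (ih : alg_hom i) (jh : alg_hom j) (Us : is_submod U).
Hypotheses (iU : forall a u, U u -> U (i a ** u)).
Hypotheses (Uj : forall u b, U u -> U (u ** j b)).

Lemma span_submod_in (u : spanT U) : U (span_val u).
Proof. by have := span_in u; rewrite lspan_id. Qed.

Definition emb_lact a (u : spanT U) : spanT U :=
  mkspan (sub_lspan (iU a (span_submod_in u))).
Definition emb_ract (u : spanT U) b : spanT U :=
  mkspan (sub_lspan (Uj b (span_submod_in u))).

Lemma emb_lact_bilinear : bilinear_op emb_lact.
Proof.
split=> [a|u] c x y; apply: spanP => /=; first exact: (mulB N).1.
by rewrite ih.1 (mulB N).2.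
Qed.

Lemma emb_ract_bilinear : bilinear_op emb_ract.
Proof.
split=> [u|b] c x y; apply: spanP => /=; last exact: (mulB N).2.
by rewrite jh.1 (mulB N).1.
Qed.

Lemma emb_lactA a a' x : emb_lact (a ** a') x = emb_lact a (emb_lact a' x).
Proof. by apply: spanP; rewrite /= ih.2 amulA. Qed.

Lemma emb_ractA x b b' : emb_ract x (b ** b') = emb_ract (emb_ract x b) b'.
Proof. by apply: spanP; rewrite /= jh.2 amulA. Qed.

Lemma emb_lractA a x b : emb_ract (emb_lact a x) b = emb_lact a (emb_ract x b).
Proof. by apply: spanP; rewrite /= amulA. Qed.

Definition emb_bimodule : bimodule A B :=
  Bimodule emb_lact_bilinear emb_ract_bilinear emb_lactA emb_ractA emb_lractA.

End EmbeddedBimodule.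

Section EmbeddedContext.
Variable k : comPzRingType.

(** [A] and [B] sit as the diagonal corners, [U] and [V] as the off-diagonal
    ones, in a family of elements of [N] that need not fill [N]. *)
Record embedded (A B N : nuAlgType k) (i : A -> N) (j : B -> N)
    (U V : set N) : Prop := Embedded {
  emb_i : alg_hom i;
  emb_iI : injective i;
  emb_j : alg_hom j;
  emb_jI : injective j;
  emb_U : is_submod U;
  emb_V : is_submod V;
  emb_iU : forall a u, U u -> U (i a ** u);
  emb_Uj : forall u b, U u -> U (u ** j b);
  emb_jV : forall b v, V v -> V (j b ** v);
  emb_Vi : forall v a, V v -> V (v ** i a);
  emb_UV : forall u v, U u -> V v -> range i (u ** v);
  emb_VU : forall v u, V v -> U u -> range j (v ** u)
}.

(** Given by explicit fields, so that the bimodules of the flipped context are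
    convertible to those of the original one. *)
Definition embedded_flip (A B N : nuAlgType k) (i : A -> N) (j : B -> N) U V
    (E : embedded i j U V) : embedded j i V U :=
  Embedded (emb_j E) (emb_jI E) (emb_i E) (emb_iI E) (emb_V E) (emb_U E)
    (emb_jV E) (emb_Vi E) (emb_iU E) (emb_Uj E) (emb_VU E) (emb_UV E).

Definition preimg (A N : nuAlgType k) (i : A -> N) (x : N) : A :=
  xget 0 [set a | i a = x].

Lemma preimgK (A N : nuAlgType k) (i : A -> N) x : range i x -> i (preimg i x) = x.
Proof. by case=> a _ <-; rewrite /preimg; case: xgetP => //= /(_ a). Qed.

Section EmbeddedPairing.
Variables (A B N : nuAlgType k) (i : A -> N) (j : B -> N) (U V : set N).
Hypothesis E : embedded i j U V.

Definition emb_tau (u : spanT U) (v : spanT V) : A := preimg i (span_val u ** span_val v).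

Lemma emb_tauK u v : i (emb_tau u v) = span_val u ** span_val v.
Proof.
apply/preimgK/(emb_UV E); first exact: (span_submod_in (emb_U E)).
exact: (span_submod_in (emb_V E)).
Qed.

Lemma emb_tau_bilinear : bilinear_op emb_tau.
Proof.
split=> [u|v] c x y; apply: (emb_iI E); rewrite (emb_i E).1 !emb_tauK.
  exact: (mulB N).1.
exact: (mulB N).2.
Qed.

End EmbeddedPairing.

Section EmbeddedMContext.
Variables (A B N : nuAlgType k) (i : A -> N) (j : B -> N) (U V : set N).
Hypothesis E : embedded i j U V.

Definition emb_X : bimodule A B :=
  emb_bimodule (emb_i E) (emb_j E) (emb_U E) (emb_iU E) (emb_Uj E).
Definition emb_Y : bimodule B A :=
  emb_bimodule (emb_j E) (emb_i E) (emb_V E) (emb_jV E) (emb_Vi E).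

Let E' := embedded_flip E.

Let tA_bal (x : emb_X) b (y : emb_Y) : emb_tau i (ract x b) y = emb_tau i x (lact b y).
Proof. by apply: (emb_iI E); rewrite !(emb_tauK E) /= amulA. Qed.
Let tA_l a (x : emb_X) (y : emb_Y) : emb_tau i (lact a x) y = a ** emb_tau i x y.
Proof. by apply: (emb_iI E); rewrite (emb_i E).2 !(emb_tauK E) /= amulA. Qed.
Let tA_r (x : emb_X) (y : emb_Y) a : emb_tau i x (ract y a) = emb_tau i x y ** a.
Proof. by apply: (emb_iI E); rewrite (emb_i E).2 !(emb_tauK E) /= amulA. Qed.
Let tB_bal (y : emb_Y) a (x : emb_X) : emb_tau j (ract y a) x = emb_tau j y (lact a x).
Proof. by apply: (emb_jI E); rewrite !(emb_tauK E') /= amulA. Qed.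
Let tB_l b (y : emb_Y) (x : emb_X) : emb_tau j (lact b y) x = b ** emb_tau j y x.
Proof. by apply: (emb_jI E); rewrite (emb_j E).2 !(emb_tauK E') /= amulA. Qed.
Let tB_r (y : emb_Y) (x : emb_X) b : emb_tau j y (ract x b) = emb_tau j y x ** b.
Proof. by apply: (emb_jI E); rewrite (emb_j E).2 !(emb_tauK E') /= amulA. Qed.
Let tAB (x : emb_X) (y : emb_Y) (x' : emb_X) :
  lact (emb_tau i x y) x' = ract x (emb_tau j y x').
Proof. by apply: spanP; rewrite /= (emb_tauK E) (emb_tauK E') amulA. Qed.
Let tBA (y : emb_Y) (x : emb_X) (y' : emb_Y) :
  lact (emb_tau j y x) y' = ract y (emb_tau i x y').
Proof. by apply: spanP; rewrite /= (emb_tauK E) (emb_tauK E') amulA. Qed.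

Definition emb_context : mcontext A B :=
  MContext (mX := emb_X) (mY := emb_Y) (emb_tau_bilinear E) tA_bal tA_l tA_r
    (emb_tau_bilinear E') tB_bal tB_l tB_r tAB tBA.

End EmbeddedMContext.

Section EmbeddedUnital.
Variables (A B N : nuAlgType k) (i : A -> N) (j : B -> N) (U V : set N).
Hypothesis E : embedded i j U V.

Lemma emb_setprodl : (U `<=` range i ** U)%classic ->
  setprod (@lact k A B (emb_X E)) [set: A] [set: emb_X E] = [set: emb_X E].
Proof.
move=> h; apply/seteqP; split=> // x _; set Z := setprod _ _ _.
have : (@span_val _ _ U @` Z) (span_val (x : spanT U)).
  move: (h _ (span_submod_in (emb_U E) x)); apply: setprod_sub => [|_ u [a _ <-] Uu].
    exact: submod_image (@span_lin _ _ _) (lspan_submod _).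
  exists (lact a (mkspan (sub_lspan Uu) : emb_X E)) => //; exact: in_setprod.
by case=> y Zy /spanP <-.
Qed.

Lemma emb_setprodr : (U `<=` U ** range j)%classic ->
  setprod (@ract k A B (emb_X E)) [set: emb_X E] [set: B] = [set: emb_X E].
Proof.
move=> h; apply/seteqP; split=> // x _; set Z := setprod _ _ _.
have : (@span_val _ _ U @` Z) (span_val (x : spanT U)).
  move: (h _ (span_submod_in (emb_U E) x)); apply: setprod_sub => [|u _ Uu [b _ <-]].
    exact: submod_image (@span_lin _ _ _) (lspan_submod _).
  exists (ract (mkspan (sub_lspan Uu) : emb_X E) b) => //; exact: in_setprod.
by case=> y Zy /spanP <-.
Qed.

Lemma emb_setprod_tau : (range i `<=` U ** V)%classic ->
  setprod (@tauA k A B (emb_context E)) [set: emb_X E] [set: emb_Y E] = [set: A].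
Proof.
move=> h; apply/seteqP; split=> // a _.
pose P := setprod (@tauA k A B (emb_context E)) [set: emb_X E] [set: emb_Y E].
have Ps : is_submod P by exact: lspan_submod.
have : (i @` P) (i a).
  have : range i (i a) by exists a.
  move/h; apply: setprod_sub => [|u v Uu Vv].
    exact: submod_image (emb_i E).1 Ps.
  exists (tauA (m := emb_context E) (mkspan (sub_lspan Uu) : emb_X E) (mkspan (sub_lspan Vv) : emb_Y E)).
    exact: in_setprod.
  exact: (emb_tauK E).
by case=> b Pb /(emb_iI E) <-.
Qed.

End EmbeddedUnital.

Lemma embedded_morita (A B N : nuAlgType k) (i : A -> N) (j : B -> N) (U V : set N)
    (E : embedded i j U V) :
  idempotent_alg A -> idempotent_alg B ->
  (U `<=` range i ** U)%classic -> (U `<=` U ** range j)%classic ->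
  (V `<=` range j ** V)%classic -> (V `<=` V ** range i)%classic ->
  (range i `<=` U ** V)%classic -> (range j `<=` V ** U)%classic ->
  morita_equivalence (emb_context E).
Proof.
move=> AA BB h1 h2 h3 h4 h5 h6; split=> //.
- by split; [exact: emb_setprodl|exact: emb_setprodr].
- by split; [exact: (emb_setprodl (embedded_flip E))|exact: (emb_setprodr (embedded_flip E))].
- by split; [exact: emb_setprod_tau|exact: (emb_setprod_tau (embedded_flip E))].
Qed.

End EmbeddedContext.

(** * Homogeneous elements of skew group algebras *)

Section SkewSingle.
Variables (k : comPzRingType) (G : groupType) (A : nuAlgType k).
Variable alpha : ppaction G A.
Local Notation D := (dom alpha).
Implicit Types (f g : skew alpha) (a b : A) (s t : G).

Definition single_fun t a : G -> A :=
  fun s => if (s == t) && `[< D t a >] then a else 0.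

Lemma single_closed t a : single_fun t a \in skew_fun alpha.
Proof.
apply/asboolP; split=> [s|].
  rewrite /single_fun; case: eqP => [->|_] /=; last exact: submod0 (dom_submod _ _).
  by case: asboolP => // _; apply: submod0 (dom_submod _ _).
apply: (@sub_finite_set _ _ [set t]); last exact: finite_set1.
by move=> s /=; rewrite /single_fun; case: eqP.
Qed.

(** The element [a delta_t]; the value [0] for [a] outside [D t] makes the map
    total. *)
Definition single t a : skew alpha := Skew (single_closed t a).

Lemma singleE t a s : D t a -> single t a s = if s == t then a else 0.
Proof. by move=> Da /=; rewrite /single_fun asboolT // andbT. Qed.

Lemma single_at t a : D t a -> single t a t = a.
Proof. by move=> Da; rewrite singleE // eqxx. Qed.

Lemma single_comp t a : skew_comp t (single t a).
Proof. by move=> s /= /eqP/negPf st; rewrite /single_fun st. Qed.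

Lemma skew_compE t f : skew_comp t f -> f = single t (f t).
Proof.
move=> ft; apply: skewP => s; rewrite singleE; last exact: skew_dom.
by case: eqP => [->|/ft].
Qed.

Lemma single_lin t c a b : D t a -> D t b ->
  single t (c *: a + b) = c *: single t a + single t b.
Proof.
move=> Da Db; have Dab : D t (c *: a + b).
  by case/is_submodP: (dom_submod alpha t) => _; apply.
apply: skewP => s; rewrite [RHS](_ : _ = c *: single t a s + single t b s) //.
by rewrite !singleE //; case: eqP; rewrite ?scaler0 ?addr0.
Qed.

Lemma single0 t : single t 0 = 0.
Proof.
apply: skewP => s; rewrite singleE; last exact: submod0 (dom_submod _ _).
by case: eqP.
Qed.

Lemma single_sum (I : Type) t (r : seq I) (F : I -> A) : (forall i, D t (F i)) ->
  single t (\sum_(i <- r) F i) = \sum_(i <- r) single t (F i).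
Proof.
move=> DF; elim: r => [|i r IHr]; first by rewrite !big_nil single0.
rewrite !big_cons -IHr -[F i]scale1r single_lin ?scale1r //.
by apply: submod_sum => //; apply: dom_submod.
Qed.

Lemma skew_decomp f : f = \sum_(t <- skew_supp f) single t (f t).
Proof.
apply: skewP => s; rewrite skew_sumE.
case: (boolP (s \in skew_supp f)) => sf.
  rewrite (big_fsetD1 s) // single_at; last exact: skew_dom.
  rewrite big_seq big1 => [|t]; first exact/esym/addr0.
  by rewrite in_fsetD1 => /andP[ts _]; apply: single_comp => /esym/eqP; apply/negP.
rewrite (skew_suppPn sf) big_seq big1 // => t tf; apply: single_comp => st.
by rewrite st tf in sf.
Qed.

Lemma skew_mul_single (r s : G) a b : D r a -> D s b ->
  single r a ** single s b = single (r * s)%g (skew_coef alpha r a b).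
Proof.
move=> Da Db; apply: skewP => u.
have -> : (single r a ** single s b) u
    = skew_mul (single r a) (single s b) u by [].
rewrite (@skew_mulE _ _ _ _ _ _ [fset r]%fset) => [|t]; last first.
  rewrite in_fset_set; last exact: skew_finite.
  by rewrite inE /= in_fset1; apply: contra_notT => /eqP; apply: single_comp.
rewrite big_seq_fset1 single_at // [RHS]singleE; last exact: coef_dom.
have -> : (u == r * s)%g = (r^-1 * u == s)%g.
  by apply/eqP/eqP => [->|<-]; rewrite ?mulVKg ?mulKg.
by rewrite singleE //; case: eqP => // _; rewrite coef0r.
Qed.

Lemma skew_coef1 a b : skew_coef alpha 1%g a b = a ** b.
Proof. by rewrite /skew_coef invg1 !act1. Qed.

Lemma skew_mulT f g u : (f ** g) u =
  \sum_(r <- skew_supp f) skew_coef alpha r (f r) (g (r^-1 * u)%g).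
Proof. exact: (@skew_mulE _ _ _ _ f g (skew_supp f)). Qed.

Lemma skew_eval_lin t : linear (fun f : skew alpha => f t).
Proof. by []. Qed.

Lemma single_span t (S : set A) (P : set (skew alpha)) : is_submod P ->
  S `<=` D t -> (forall a, S a -> P (single t a)) ->
  forall a, lspan S a -> P (single t a).
Proof.
move=> Ps SD h; pose Q := [set a | D t a /\ P (single t a)].
have Qs : is_submod Q.
  apply/is_submodP; split; first by rewrite /Q /= single0; split; apply: submod0 => //; apply: dom_submod.
  move=> c u v [Du Pu] [Dv Pv]; split.
    by case/is_submodP: (dom_submod alpha t) => _; apply.
  by rewrite single_lin //; case/is_submodP: Ps => _; apply.
have SQ : S `<=` Q by move=> a Sa; split; [apply: SD|apply: h].
by move=> a /(lspan_sub Qs SQ)[].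
Qed.

Lemma skew_idempotent : idempotent_alg (skew alpha).
Proof.
apply/seteqP; split=> // f _; rewrite (skew_decomp f).
apply: submod_sum => [|t]; first exact: lspan_submod.
have Df : D t (f t) by exact: skew_dom.
apply: (single_span (lspan_submod _) _ _ (dom_dec Df)).
  by move=> _ [a Da [b Db <-]]; apply: dom_lmul.
move=> _ [a Da [b Db <-]]; have D1a : D 1%g a by rewrite dom1.
have := skew_mul_single D1a Db; rewrite mul1g skew_coef1 => <-.
exact: in_setprod.
Qed.

End SkewSingle.

Section SkewLift.
Variables (k : comPzRingType) (G : groupType) (A N : nuAlgType k).
Variables (alpha : ppaction G A) (theta : ppaction G N) (i : A -> N).
Hypotheses (ih : alg_hom i) (iI : injective i).
Hypothesis iD : forall t a, dom alpha t a -> dom theta t (i a).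
Hypothesis ia : forall t a, dom alpha t^-1%g a -> act theta t (i a) = i (act alpha t a).

Lemma lift_closed (f : skew alpha) : (fun t => i (f t)) \in skew_fun theta.
Proof.
apply/asboolP; split=> [t|]; first exact/iD/skew_dom.
apply: sub_finite_set (skew_finite f) => t /=; apply: contra_not => ->.
exact: lin0 ih.1.
Qed.

Definition skew_lift (f : skew alpha) : skew theta := Skew (lift_closed f).

Lemma lift_coef r a b : dom alpha r a ->
  skew_coef theta r (i a) (i b) = i (skew_coef alpha r a b).
Proof.
move=> Da; rewrite /skew_coef ia ?invgK // -ih.2 ia //.
exact: coef_arg_dom.
Qed.

Lemma skew_lift_hom : alg_hom skew_lift.
Proof.
split=> [c f g|f g]; apply: skewP => t; first exact: ih.1.
rewrite [LHS](_ : _ = i (skew_mul f g t)) //.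
rewrite [RHS](_ : _ = skew_mul (skew_lift f) (skew_lift g) t) //.
rewrite !(@skew_mulE _ _ _ _ _ _ (skew_supp f)) //; last first.
  move=> s; apply: contraTT => /skew_suppPn fs.
  rewrite in_fset_set; last exact: skew_finite.
  by rewrite notin_setE /= fs => h; apply: h; apply: lin0 ih.1.
rewrite (lin_sum _ _ ih.1); apply: eq_bigr => r _ /=.
by rewrite lift_coef //; apply: skew_dom.
Qed.

Lemma skew_lift_inj : injective skew_lift.
Proof.
move=> f g e; apply: skewP => t; apply: iI.
by have := congr1 (fun h : skew theta => h t) e.
Qed.

Lemma skew_lift_range : range skew_lift =
  [set f : skew theta | forall t, (i @` dom alpha t) (f t)].
Proof.
apply/seteqP; split=> [_ [f _ <-] t|f hf] /=.
  by exists (f t) => //; apply: skew_dom.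
have /boolp.choice[g gf] : forall t, exists a, dom alpha t a /\ i a = f t.
  by move=> t; have [a Da e] := hf t; exists a.
have gP : g \in skew_fun alpha.
  apply/asboolP; split=> [t|]; first by case: (gf t).
  apply: sub_finite_set (skew_finite f) => t /=; apply: contra_not => ft.
  by apply: iI; rewrite (gf t).2 ft (lin0 ih.1).
by exists (Skew gP) => //; apply: skewP => t /=; case: (gf t).
Qed.

End SkewLift.

(** * Graded Morita contexts inside a skew group algebra *)

Section CornerFamily.
Variables (k : comPzRingType) (G : groupType) (A B N : nuAlgType k).
Variables (alpha : ppaction G A) (beta : ppaction G B) (theta : ppaction G N).

(** A graded Morita context inside the skew group algebra of [theta]: [pc b c t]
    collects the coefficients of degree [t] in row [b] and column [c] of a two by
    two matrix decomposition with corners [alpha] and [beta]. With rows and columns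
    indexed by booleans, all the inclusions required of the bimodules and pairings
    are instances of [cf_mul], and all the surjectivity conditions of [cf_span]. *)
Record corner_family (i : A -> N) (j : B -> N)
    (pc : bool -> bool -> G -> set N) : Prop := CornerFamily {
  cf_i : alg_hom i;
  cf_iI : injective i;
  cf_j : alg_hom j;
  cf_jI : injective j;
  cf_ia : forall t a, dom alpha t^-1%g a -> act theta t (i a) = i (act alpha t a);
  cf_ja : forall t b, dom beta t^-1%g b -> act theta t (j b) = j (act beta t b);
  cf_iD : forall t, i @` dom alpha t = pc false false t;
  cf_jD : forall t, j @` dom beta t = pc true true t;
  cf_sub : forall b c t, is_submod (pc b c t);
  cf_dom : forall b c t, pc b c t `<=` dom theta t;
  cf_mul : forall b c d r s x y, pc b c r x -> pc c d s y ->
    pc b d (r * s)%g (skew_coef theta r x y);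
  cf_span : forall b c d t, pc b d t `<=` lspan [set z | exists r x y,
    [/\ pc b c r x, pc c d (r^-1 * t)%g y & z = skew_coef theta r x y]]
}.

Variables (i : A -> N) (j : B -> N) (pc : bool -> bool -> G -> set N).
Hypothesis F : corner_family i j pc.

Definition corner_block b c : set (skew theta) := [set f | forall t, pc b c t (f t)].

Lemma corner_block_submod b c : is_submod (corner_block b c).
Proof.
apply/is_submodP; split=> [t|e f g hf hg t]; first exact: submod0 (cf_sub F b c t).
by case/is_submodP: (cf_sub F b c t) => _ h; apply: h; [apply: hf|apply: hg].
Qed.

Lemma corner_block_mul b c d f g : corner_block b c f -> corner_block c d g ->
  corner_block b d (f ** g).
Proof.
move=> hf hg t; rewrite skew_mulT; apply: submod_sum; first exact: cf_sub F _ _ _.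
by move=> r; rewrite -{1}(mulVKg r t); apply: (cf_mul F (c := c)).
Qed.

Lemma corner_single b c t x : pc b c t x -> corner_block b c (single theta t x).
Proof.
move=> hx s; rewrite singleE; last exact: (cf_dom F hx).
by case: eqP => [->|_] //; apply: submod0 (cf_sub F _ _ _).
Qed.

Lemma corner_block_span b c d :
  (corner_block b d `<=` corner_block b c ** corner_block c d)%classic.
Proof.
move=> f hf; rewrite (skew_decomp f).
apply: submod_sum => [|t]; first exact: lspan_submod.
apply: (single_span (lspan_submod _) _ _ (@cf_span _ _ _ F b c d t _ (hf t))).
  move=> _ [r [x [y [hx hy ->]]]].
  by rewrite -(mulVKg r t); apply: coef_dom; [apply: cf_dom F _ _ _ _ hx|apply: cf_dom F _ _ _ _ hy].
move=> _ [r [x [y [hx hy ->]]]].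
rewrite -{1}(mulVKg r t) -skew_mul_single; [|exact: (cf_dom F hx)|exact: (cf_dom F hy)].
by apply: in_setprod; apply: corner_single.
Qed.

Let iD t a : dom alpha t a -> dom theta t (i a).
Proof.
move=> Da; apply: (@cf_dom _ _ _ F false false); rewrite -(cf_iD F).
by exists a.
Qed.

Let jD t b : dom beta t b -> dom theta t (j b).
Proof.
move=> Db; apply: (@cf_dom _ _ _ F true true); rewrite -(cf_jD F).
by exists b.
Qed.

Let I := skew_lift (cf_i F) iD.
Let J := skew_lift (cf_j F) jD.

Let Irange : range I = corner_block false false.
Proof.
rewrite (skew_lift_range _ (cf_iI F)).
by apply/seteqP; split=> f hf t; have := hf t; rewrite -(cf_iD F).
Qed.

Let Jrange : range J = corner_block true true.
Proof.
rewrite (skew_lift_range _ (cf_jI F)).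
by apply/seteqP; split=> f hf t; have := hf t; rewrite -(cf_jD F).
Qed.

Let Iin f : corner_block false false (I f).
Proof. by rewrite -Irange; exists f. Qed.

Let Jin f : corner_block true true (J f).
Proof. by rewrite -Jrange; exists f. Qed.

Lemma corner_embedded :
  embedded I J (corner_block false true) (corner_block true false).
Proof.
split.
- exact: skew_lift_hom (cf_i F) iD (cf_ia F).
- exact: skew_lift_inj (cf_i F) (cf_iI F) iD.
- exact: skew_lift_hom (cf_j F) jD (cf_ja F).
- exact: skew_lift_inj (cf_j F) (cf_jI F) jD.
- exact: corner_block_submod.
- exact: corner_block_submod.
- by move=> a u hu; apply: corner_block_mul hu.
- by move=> u b hu; apply: corner_block_mul hu _.
- by move=> a u hu; apply: corner_block_mul hu.
- by move=> u b hu; apply: corner_block_mul hu _.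
- by move=> u v hu hv; rewrite Irange; apply: corner_block_mul hu hv.
- by move=> u v hu hv; rewrite Jrange; apply: corner_block_mul hu hv.
Qed.

Lemma corner_direct_sum b c :
  direct_sum (fun t => [set x : spanT (corner_block b c) | skew_comp t (span_val x)]).
Proof.
have in_block (x : spanT (corner_block b c)) : corner_block b c (span_val x).
  exact: span_submod_in (corner_block_submod b c) x.
apply: ds_intro => [t|x|S f hf f0 t tS].
- apply: (submod_preim (f := @span_val _ _ (corner_block b c))) => //.
  exact: direct_sum_submod (skew_comp_sum theta) t.
- pose v t := mkspan (sub_lspan (corner_single (in_block x t))).
  have -> : x = \sum_(t <- skew_supp (span_val x)) v t.
    apply: spanP; rewrite (lin_sum _ _ (@span_lin _ _ _)).
    exact: skew_decomp.
  apply: submod_sum => [|t]; first exact: lspan_submod.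
  by apply: sub_lspan; exists t => //; apply: single_comp.
- apply: spanP; apply: (@ds_indep _ _ _ _ (skew_comp_sum theta) S (fun t => span_val (f t))) => //.
  by rewrite -(lin_sum _ _ (@span_lin _ _ _)) f0.
Qed.

Let lift_comp_i t (f : skew alpha) : skew_comp t f -> skew_comp t (I f).
Proof. by move=> h s /h /= ->; apply: lin0 (cf_i F).1. Qed.

Let lift_comp_j t (f : skew beta) : skew_comp t f -> skew_comp t (J f).
Proof. by move=> h s /h /= ->; apply: lin0 (cf_j F).1. Qed.

Lemma corner_graded_equiv : graded_equiv (skew_galg alpha) (skew_galg beta).
Proof.
have E := corner_embedded.
have UI b c d := @corner_block_span b c d.
have [] : morita_equivalence (emb_context E).
  by apply: embedded_morita; rewrite ?Irange ?Jrange //; apply: skew_idempotent.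
move=> iA iB uX uY ts; split=> //.
pose gr b c t := [set x : spanT (corner_block b c) | skew_comp t (span_val x)].
exists (emb_context E), (gr false true), (gr true false); split=> //.
- split; split.
  + exact: corner_direct_sum.
  + by move=> r s a x /lift_comp_i ha hx; apply: (skew_comp_mul ha hx).
  + by move=> r s x b hx /lift_comp_j hb; apply: (skew_comp_mul hx hb).
  + exact: corner_direct_sum.
  + by move=> r s a x /lift_comp_j ha hx; apply: (skew_comp_mul ha hx).
  + by move=> r s x b hx /lift_comp_i hb; apply: (skew_comp_mul hx hb).
- move=> r s x y hx hy; suff h : skew_comp (r * s)%g (tauA x y) by [].
  move=> u ru; apply: (cf_iI F).
  rewrite -[LHS]/((I (tauA x y)) u) (emb_tauK E) (lin0 (cf_i F).1).
  exact: (skew_comp_mul hx hy).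
- move=> r s y x hy hx; suff h : skew_comp (r * s)%g (tauB y x) by [].
  move=> u ru; apply: (cf_jI F).
  rewrite -[LHS]/((J (tauB y x)) u) (emb_tauK (embedded_flip E)) (lin0 (cf_j F).1).
  exact: (skew_comp_mul hy hx).
Qed.

End CornerFamily.

(** * Skew group algebras of minimal globalizations *)

Section GlobalActionTheory.
Variables (k : comPzRingType) (G : groupType) (B : nuAlgType k).
Variable beta : gaction G B.
Local Notation g := (gact beta).

Lemma gact_hom t : alg_hom (g t).
Proof. by case: (alg_isom_hom (gact_isom beta t)). Qed.

Lemma gactVK t x : g t (g t^-1%g x) = x.
Proof. by rewrite gactM mulgV gact1. Qed.

Lemma gact_image s t (P : set B) : g s @` (g t @` P) = g (s * t)%g @` P.
Proof.
rewrite image_comp; congr image; apply: funext => x; exact: gactM.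
Qed.

Lemma gact_ideal t (P : set B) : is_ideal P -> is_ideal (g t @` P).
Proof.
move=> [Ps Pi]; split; first exact: submod_image (gact_hom t).1 Ps.
move=> a _ [x Px <-]; rewrite -(gactVK t a) -!(gact_hom t).2.
case: (Pi (g t^-1%g a) x Px) => h1 h2.
by split; [exists (g t^-1%g a ** x)|exists (x ** g t^-1%g a)].
Qed.

Lemma image_setprod (A : nuAlgType k) (f : A -> B) (P Q : set A) : alg_hom f ->
  (f @` (P ** Q) = (f @` P) ** (f @` Q))%classic.
Proof.
move=> [fl fm]; apply/seteqP; split.
  move=> _ [x Px <-]; move: x Px; apply: setprod_sub.
    by apply: (submod_preim fl); exact: lspan_submod.
  by move=> u v Pu Qv; rewrite /preimage /= fm; apply: in_setprod; [exists u|exists v].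
apply: setprod_sub; first by apply: (submod_image fl); exact: lspan_submod.
move=> _ _ [u Pu <-] [v Qv <-]; exists (u ** v); last exact: fm.
exact: in_setprod.
Qed.

Variable BB : idempotent_alg B.

Lemma global_coef r x y :
  skew_coef (ppaction_of_global BB beta) r x y = x ** g r y.
Proof. by rewrite /skew_coef /= (gact_hom r).2 gactVK. Qed.

End GlobalActionTheory.

Section GlobalizationSkew.
Variables (k : comPzRingType) (G : groupType) (A B : nuAlgType k).
Variables (alpha : ppaction G A) (beta : gaction G B) (iota : A -> B).
Hypothesis gl : globalization_along alpha beta iota.
Hypothesis mn : lspan (\bigcup_t (gact beta t @` range iota)) = [set: B].
Hypothesis BB : idempotent_alg B.
Local Notation g := (gact beta).
Local Notation theta := (ppaction_of_global BB beta).
Local Notation I := (range iota).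

Let ih : alg_hom iota.
Proof. by case: gl => h _ _ _ _; case: (alg_isom_hom h). Qed.

Let iI : injective iota.
Proof. by case: gl => h _ _ _ _; case: (alg_isom_hom h). Qed.

Let Iid : is_ideal I.
Proof. by case: gl. Qed.

Let gIid t : is_ideal (g t @` I).
Proof. exact: gact_ideal. Qed.

Let iD t : iota @` dom alpha t = (I ** (g t @` I))%classic.
Proof. by case: gl => _ _ _ ->. Qed.

Let II : (I ** I)%classic = I.
Proof.
have := dom_idem alpha 1%g; rewrite dom1 => h.
by rewrite -{3}h image_setprod.
Qed.

Let gII t : ((g t @` I) ** (g t @` I))%classic = g t @` I.
Proof. by rewrite -image_setprod ?II //; apply: gact_hom. Qed.

(** If [e] were a unit of the ideal [I], these would be the coefficients of degree
    [t] in [e T e], [e T], [T e] and [T], where [T] is the skew group algebra of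
    [beta]. *)
Definition globalization_block (b c : bool) (t : G) : set B :=
  match b, c with
  | false, false => iota @` dom alpha t
  | false, true => I
  | true, false => g t @` I
  | true, true => [set: B]
  end.
Local Notation pc := globalization_block.

Let iD_sub t : iota @` dom alpha t `<=` I.
Proof. by move=> _ [a _ <-]; exists a. Qed.

Let iD_subg t : iota @` dom alpha t `<=` g t @` I.
Proof.
rewrite iD; apply: setprod_sub; first by case: (gIid t).
by move=> x y _ Iy; apply: ideal_mull.
Qed.

Let g_in r s x : (g s @` I) x -> (g (r * s)%g @` I) (g r x).
Proof. by move=> h; rewrite -gact_image; exists x. Qed.

Lemma globalization_corner_family : corner_family alpha theta theta iota id pc.
Proof.
split=> //.
- by case: gl => _ _ _ _ h t a /h ->.
- by move=> t; rewrite image_id.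
- move=> [] [] t //=; first exact: submodT.
  + by case: (gIid t).
  + by case: Iid.
  + exact: submod_image ih.1 (dom_submod _ _).
- move=> b c d r s x y; rewrite global_coef.
  case: b c d => [] [] [] //= hx hy.
  + exact: ideal_mull (gIid _) (g_in r hy).
  + exact: ideal_mull (gIid _) (g_in r (iD_subg hy)).
  + exact: ideal_mulr Iid hx.
  + suff: (iota @` dom alpha (r * s)%g) (x ** g r y) by [].
    by rewrite iD; apply: in_setprod => //; apply: g_in.
  + exact: ideal_mulr Iid (iD_sub hx).
  + case: hx hy => a Da <- [b Db <-]; exists (skew_coef alpha r a b).
      exact: coef_dom.
    rewrite -(global_coef beta BB) (lift_coef (alpha := alpha) ih) //.
    by case: gl => _ _ _ _ h t' a' /h ->.
- move=> b c d t.
  have key1 P Q : P `<=` pc b c 1%g -> Q `<=` pc c d t -> (P ** Q)%classic `<=`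
      lspan [set z | exists r x y,
    [/\ pc b c r x, pc c d (r^-1 * t)%g y & z = skew_coef theta r x y]].
    move=> PP QQ; apply: setprod_sub; first exact: lspan_submod.
    move=> x y /PP hx /QQ hy; apply: sub_lspan; exists 1%g, x, y.
    by rewrite invg1 mul1g skew_coef1.
  have D1 : I `<=` iota @` dom alpha 1%g by rewrite dom1.
  case: b c d key1 => [] [] [] key1 //=.
  + by rewrite -{1}BB; apply: key1.
  + by rewrite -{1}gII; apply: key1.
  (* This corner is full exactly because the translates of [I] span [B]. *)
  + rewrite -{1}mn; apply: lspan_sub; first exact: lspan_submod.
    move=> x [r _]; rewrite -gII; move: x; apply: setprod_sub; first exact: lspan_submod.
    move=> x _ hx [y Iy <-]; apply: sub_lspan; exists r, x, y; split=> //.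
    exact/esym/(global_coef beta BB).
  + rewrite -{1}gII; apply: setprod_sub; first exact: lspan_submod.
    move=> x _ hx [y Iy <-]; apply: sub_lspan; exists t, x, y; split=> //.
      by rewrite mulVg; apply: D1.
    exact/esym/(global_coef beta BB).
  + by rewrite -{1}II; apply: key1.
  + by rewrite iD; apply: key1.
  + by rewrite -{1}II; apply: key1.
  + rewrite -{1}(dom_idem alpha t) image_setprod //; apply: key1 => //.
    exact: subset_trans (@iD_sub t) D1.
Qed.

End GlobalizationSkew.

Lemma minimal_globalization_graded_equiv (k : comPzRingType) (G : groupType)
    (A B : nuAlgType k) (alpha : ppaction G A) (beta : gaction G B)
    (BB : idempotent_alg B) : minimal_globalization alpha beta ->
  graded_equiv (skew_galg alpha) (skew_galg (ppaction_of_global BB beta)).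
Proof.
case=> iota [gl mn].
exact: corner_graded_equiv (globalization_corner_family gl mn BB).
Qed.

(** * Peirce decompositions *)

Section Peirce.
Variable k : comPzRingType.

(** A two by two Peirce decomposition, given by its idempotent multipliers:
    [pL b] keeps the row [b], [pR c] keeps the column [c]. *)
Record peirce (N : nuAlgType k) := Peirce {
  pL : bool -> N -> N;
  pR : bool -> N -> N;
  pL_lin : forall b, linear (pL b);
  pR_lin : forall b, linear (pR b);
  pL_mul : forall b x y, pL b (x ** y) = pL b x ** y;
  pR_mul : forall b x y, pR b (x ** y) = x ** pR b y;
  pLR_mid : forall b x y, pR b x ** y = x ** pL b y;
  pL_sum : forall b x, pL b x + pL (~~ b) x = x;
  pR_sum : forall b x, pR b x + pR (~~ b) x = x;
  pLL : forall b x, pL b (pL b x) = pL b x;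
  pRR : forall b x, pR b (pR b x) = pR b x;
  pLN : forall b x, pL b (pL (~~ b) x) = 0;
  pRN : forall b x, pR b (pR (~~ b) x) = 0;
  pLR : forall b c x, pL b (pR c x) = pR c (pL b x)
}.

Variables (N : nuAlgType k) (P : peirce N).
Local Notation L := (pL P).
Local Notation R := (pR P).

Definition block b c : set N := [set x | L b x = x /\ R c x = x].

Lemma block_submod b c : is_submod (block b c).
Proof.
apply: (submodI (S := [set x | L b x = x])).
  exact: (submod_eq (pL_lin P b) (g := id)).
exact: (submod_eq (pR_lin P c) (g := id)).
Qed.

Lemma block_mul b c d e x y : block b c x -> block d e y -> block b e (x ** y).
Proof. by move=> [Lx _] [_ Ry]; split; rewrite ?pL_mul ?pR_mul ?Lx ?Ry. Qed.

Lemma block_mid b c x y : block b c x -> x ** y = x ** L c y.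
Proof. by case=> _ Rx; rewrite -pLR_mid Rx. Qed.

Lemma block_mid_r c d x y : block c d y -> x ** y = R c x ** y.
Proof. by case=> Ly _; rewrite pLR_mid Ly. Qed.

Lemma block_mul0 b c d e x y : c != d -> block b c x -> block d e y -> x ** y = 0.
Proof.
move=> cd bx [Ly _]; rewrite (block_mid _ bx) -Ly.
have -> : d = ~~ c by move: cd; clear; case: c d => [] [].
by rewrite pLN amul0r.
Qed.

Lemma pLR_block b c x : block b c (L b (R c x)).
Proof. by split; [exact: pLL|rewrite -pLR pRR]. Qed.

Lemma pRL_block b c x : block b c (R c (L b x)).
Proof. by rewrite -pLR; apply: pLR_block. Qed.

Variables (G : groupType) (theta : ppaction G N).
Local Notation D := (dom theta).

Definition dom_block b c t : set N := D t `&` block b c.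
Local Notation pc := dom_block.

(** The multipliers preserve any idempotent ideal: apply them to one factor
    of a product of two elements. *)
Lemma dom_pL b t x : D t x -> D t (L b x).
Proof.
move=> /dom_dec; move: x; apply: setprod_sub.
  exact: (submod_preim (pL_lin P b)) (dom_submod theta t).
by move=> u v Du Dv; rewrite /preimage /= pL_mul; apply: dom_lmul.
Qed.

Lemma dom_pR b t x : D t x -> D t (R b x).
Proof.
move=> /dom_dec; move: x; apply: setprod_sub.
  exact: (submod_preim (pR_lin P b)) (dom_submod theta t).
by move=> u v Du Dv; rewrite /preimage /= pR_mul; apply: dom_rmul.
Qed.

Lemma pc_submod b c t : is_submod (pc b c t).
Proof. by apply: submodI; [exact: dom_submod|exact: block_submod]. Qed.

Lemma pc_pLR b c t x : D t x -> pc b c t (R c (L b x)).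
Proof. by move=> Dx; split; [exact/dom_pR/dom_pL|exact: pRL_block]. Qed.

Lemma block_pc1 b c : block b c `<=` pc b c 1%g.
Proof. by move=> x hx; split=> //; rewrite dom1. Qed.

Lemma pc_mulr b c d t x y : block b c x -> pc c d t y -> pc b d t (x ** y).
Proof. by move=> hx [Dy hy]; split; [exact: dom_lmul|exact: block_mul hx hy]. Qed.

Lemma pc_mull b c d t x y : pc b c t x -> block c d y -> pc b d t (x ** y).
Proof. by move=> [Dx hx] hy; split; [exact: dom_rmul|exact: block_mul hx hy]. Qed.

Lemma dom3 t x : D t x -> (D t ** (D t ** D t))%classic x.
Proof. by rewrite !dom_idem. Qed.

Hypothesis diag_act : forall t b x, pc b b t^-1%g x -> block b b (act theta t x).
Hypothesis diag_span : forall b t,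
  (pc b b t `<=` (block b (~~ b) ** pc (~~ b) (~~ b) t) ** block (~~ b) b)%classic.

(** Row [b] of the ideal [D t] lies in [D_b D t], where [D_b] is the diagonal
    block [b] of [D t]: write an element as a product of three factors; an
    off-diagonal entry of the first factor meets either an off-diagonal entry
    of the second, or a diagonal entry which [diag_span] rewrites through
    [D_b]. *)
Lemma row_span b t u : D t u -> (pc b b t ** D t)%classic (L b u).
Proof.
move=> /dom3; move: u; apply: setprod_sub => [|u1 w Du1].
  exact: (submod_preim (pL_lin P b) (lspan_submod _)).
move: w; apply: setprod_sub => [|u2 u3 Du2 Du3].
  apply: (submod_preim (f := fun w => L b (u1 ** w))) (lspan_submod _) => c x y.
  by rewrite (mulB N).1 pL_lin.
rewrite /preimage /= pL_mul -(pR_sum P b (L b u1)) amulDl.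
apply: submodD; first exact: lspan_submod.
  by apply: in_setprod; [exact: pc_pLR|exact: dom_lmul].
have := pc_pLR b (~~ b) Du1; set x := R _ _ => -[Dx hx].
rewrite (block_mid _ hx) pL_mul -(pR_sum P b (L _ u2)) amulDl amulDr.
apply: submodD; first exact: lspan_submod.
  rewrite amulA; apply: in_setprod => //; apply: pc_mulr hx _; exact: pc_pLR.
have := diag_span (pc_pLR (~~ b) (~~ b) Du2); rewrite negbK.
move: (R _ _); apply: setprod_sub => [|z n' + hn'].
  apply: (submod_preim (f := fun z => x ** (z ** u3))) (lspan_submod _) => c y z.
  by rewrite (mulB N).2 (mulB N).1.
move: z; apply: setprod_sub => [|n d hn hd].
  apply: (submod_preim (f := fun z => x ** ((z ** n') ** u3))) (lspan_submod _) => c y z.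
  by rewrite !(mulB N).2 (mulB N).1.
rewrite /preimage /= -!amulA amulA [(x ** n) ** _]amulA.
apply: in_setprod; last exact: dom_lmul.
by apply: pc_mulr hd; apply: block_mul hx hn.
Qed.

Lemma col_span b t u : D t u -> (D t ** pc b b t)%classic (R b u).
Proof.
move=> /dom3; rewrite -setprodA; move: u; apply: setprod_sub => [|w u1 + Du1].
  exact: (submod_preim (pR_lin P b) (lspan_submod _)).
move: w; apply: setprod_sub => [|u3 u2 Du3 Du2].
  apply: (submod_preim (f := fun w => R b (w ** u1))) (lspan_submod _) => c x y.
  by rewrite (mulB N).2 pR_lin.
rewrite /preimage /= pR_mul -(pL_sum P b (R b u1)) amulDr.
apply: submodD; first exact: lspan_submod.
  by apply: in_setprod; [exact: dom_lmul|rewrite pLR; exact: pc_pLR].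
rewrite pLR; have := pc_pLR (~~ b) b Du1; set x := R _ _ => -[Dx hx].
rewrite (block_mid_r _ hx) pR_mul -(pL_sum P b (R _ u2)) amulDr amulDl !pLR.
apply: submodD; first exact: lspan_submod.
  rewrite -amulA; apply: in_setprod => //; apply: pc_mull (pc_pLR _ _ Du2) hx.
have := diag_span (pc_pLR (~~ b) (~~ b) Du2); rewrite negbK.
move: (R _ _); apply: setprod_sub => [|z n' + hn'].
  apply: (submod_preim (f := fun z => u3 ** z ** x)) (lspan_submod _) => c y z.
  by rewrite (mulB N).1 (mulB N).2.
move: z; apply: setprod_sub => [|n d hn hd].
  apply: (submod_preim (f := fun z => u3 ** (z ** n') ** x)) (lspan_submod _) => c y z.
  by rewrite (mulB N).2 (mulB N).1 (mulB N).2.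
rewrite /preimage /= !amulA -!amulA [u3 ** (n ** _)]amulA.
apply: in_setprod; first exact: dom_rmul.
by apply: pc_mull hd _; apply: block_mul hn' hx.
Qed.

(** By [row_span], a row of an element of the domain is a sum of products whose
    first factors lie in a diagonal block, and the action preserves that block. *)
Lemma act_pL t b u : D t^-1%g u -> act theta t (L b u) = L b (act theta t u).
Proof.
have row c v : D t^-1%g v -> L c (act theta t (L c v)) = act theta t (L c v).
  move=> /(row_span c) h.
  suff [] : [set w | D t^-1%g w /\ L c (act theta t w) = act theta t w] (L c v) by [].
  move: h; apply: setprod_sub => [|d w [Dd hd] Dw].
    apply/is_submodP; split=> [|e x y [Dx hx] [Dy hy]] /=.
      by rewrite !act0 (lin0 (pL_lin P c)); split=> //; apply: submod0 (dom_submod _ _).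
    rewrite act_lin // pL_lin hx hy; split=> //.
    by case/is_submodP: (dom_submod theta t^-1%g) => _; apply.
  split; first exact: dom_lmul.
  rewrite act_mul // pL_mul; congr (_ ** _).
  by have [] : block c c (act theta t d) by exact: diag_act.
move=> Du; rewrite -[in RHS](pL_sum P b u) actD; try exact: dom_pL.
rewrite (linD (pL_lin P b)) row // -[in X in _ + X](row (~~ b)) //.
by rewrite pLN addr0.
Qed.

Lemma act_pR t b u : D t^-1%g u -> act theta t (R b u) = R b (act theta t u).
Proof.
have row c v : D t^-1%g v -> R c (act theta t (R c v)) = act theta t (R c v).
  move=> /(col_span c) h.
  suff [] : [set w | D t^-1%g w /\ R c (act theta t w) = act theta t w] (R c v) by [].
  move: h; apply: setprod_sub => [|w d Dw [Dd hd]].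
    apply/is_submodP; split=> [|e x y [Dx hx] [Dy hy]] /=.
      by rewrite !act0 (lin0 (pR_lin P c)); split=> //; apply: submod0 (dom_submod _ _).
    rewrite act_lin // pR_lin hx hy; split=> //.
    by case/is_submodP: (dom_submod theta t^-1%g) => _; apply.
  split; first exact: dom_lmul.
  rewrite act_mul // pR_mul; congr (_ ** _).
  by have [] : block c c (act theta t d) by exact: diag_act.
move=> Du; rewrite -[in RHS](pR_sum P b u) actD; try exact: dom_pR.
rewrite (linD (pR_lin P b)) row // -[in X in _ + X](row (~~ b)) //.
by rewrite pRN addr0.
Qed.

Lemma dom_block_mul b c d r s x y : pc b c r x -> pc c d s y ->
  pc b d (r * s)%g (skew_coef theta r x y).
Proof.
move=> [Dx [Lx _]] [Dy [_ Ry]]; split; first exact: coef_dom.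
split; rewrite /skew_coef.
  rewrite -act_pL; last exact: coef_arg_dom.
  by rewrite pL_mul -act_pL ?invgK // Lx.
rewrite -act_pR; last exact: coef_arg_dom.
by rewrite pR_mul Ry.
Qed.

(** After [row_span], the factor in the diagonal block [b] can itself be moved
    through the other diagonal block by [diag_span]. *)
Lemma dom_block_span b c d t : (pc b d t `<=` block b c ** pc c d t)%classic.
Proof.
move=> u [Du [Lu Ru]]; rewrite -Ru -Lu.
have := row_span b Du; move: (L b u); apply: setprod_sub => [|e w he Dw].
  exact: (submod_preim (pR_lin P d) (lspan_submod _)).
rewrite /preimage /= pR_mul (block_mid _ he.2) pLR.
have := pc_pLR b d Dw; set q := R _ _ => hq.
have [->|cb] := eqVneq c b; first exact: in_setprod he.2 hq.
have {cb} -> : c = ~~ b by move: cb; clear; case: c b => [] [].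
move: e {he} (diag_span he); apply: setprod_sub => [|z n' + hn'].
  exact: (submod_preim ((mulB N).2 q) (lspan_submod _)).
move: z; apply: setprod_sub => [|n d' hn hd].
  apply: (submod_preim (f := fun z => (z ** n') ** q)) (lspan_submod _) => e y z.
  by rewrite !(mulB N).2.
rewrite /preimage /= -!amulA; apply: in_setprod => //.
by apply: pc_mull hd _; apply: block_mul hn' hq.2.
Qed.

End Peirce.

Section ContextPeirce.
Variables (k : comPzRingType) (A B : nuAlgType k) (M : mcontext A B).

Definition ctx_pL (b : bool) (m : ctx M) : ctx M :=
  if b then ((0, 0), m.2) else (m.1, (0, 0)).

Definition ctx_pR (b : bool) (m : ctx M) : ctx M :=
  if b then ((0, m.1.2), (0, m.2.2)) else ((m.1.1, 0), (m.2.1, 0)).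

Let mA := @amul_bilinear k A.
Let mB := @amul_bilinear k B.
Let tA := @tauA_bilinear _ _ _ M.
Let tB := @tauB_bilinear _ _ _ M.
Let lX := @lact_bilinear _ _ _ (mX M).
Let rX := @ract_bilinear _ _ _ (mX M).
Let lY := @lact_bilinear _ _ _ (mY M).
Let rY := @ract_bilinear _ _ _ (mY M).

Lemma ctxP (m n : ctx M) : m.1.1 = n.1.1 -> m.1.2 = n.1.2 -> m.2.1 = n.2.1 ->
  m.2.2 = n.2.2 -> m = n.
Proof. by case: m n => [[a x] [y b]] [[a' x'] [y' b']] /= -> -> -> ->. Qed.

Lemma ctx_mulE (m n : ctx M) : m ** n =
  ((m.1.1 ** n.1.1 + tauA m.1.2 n.2.1, lact m.1.1 n.1.2 + ract m.1.2 n.2.2),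
   (ract m.2.1 n.1.1 + lact m.2.2 n.2.1, tauB m.2.1 n.1.2 + m.2.2 ** n.2.2)).
Proof. by []. Qed.

Definition ctx0 := ((bil0l mA, bil0r mA, bil0l mB, bil0r mB, bil0l tA, bil0r tA),
  (bil0l tB, bil0r tB, bil0l lX, bil0r lX, bil0l rX, bil0r rX),
  (bil0l lY, bil0r lY, bil0l rY, bil0r rY)).

Lemma ctx_pL_lin b : linear (ctx_pL b).
Proof.
case: b => c [[a x] [y b]] [[a' x'] [y' b']]; apply: ctxP => //=;
  by rewrite scaler0 addr0.
Qed.

Lemma ctx_pR_lin b : linear (ctx_pR b).
Proof.
case: b => c [[a x] [y b]] [[a' x'] [y' b']]; apply: ctxP => //=;
  by rewrite scaler0 addr0.
Qed.

Lemma ctx_pL_mul b x y : ctx_pL b (x ** y) = ctx_pL b x ** y.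
Proof.
case: b; case: x y => [[a x] [y b]] [[a' x'] [y' b']];
  by apply: ctxP => //=; rewrite !ctx0 addr0.
Qed.

Lemma ctx_pR_mul b x y : ctx_pR b (x ** y) = x ** ctx_pR b y.
Proof.
case: b; case: x y => [[a x] [y b]] [[a' x'] [y' b']];
  by apply: ctxP => //=; rewrite !ctx0 addr0.
Qed.

Lemma ctx_pLR_mid b x y : ctx_pR b x ** y = x ** ctx_pL b y.
Proof.
case: b; case: x y => [[a x] [y b]] [[a' x'] [y' b']];
  by apply: ctxP => //=; rewrite !ctx0.
Qed.

Lemma ctx_pL_sum b x : ctx_pL b x + ctx_pL (~~ b) x = x.
Proof.
by case: b; case: x => [[a x] [y b]]; apply: ctxP; rewrite /= ?addr0 ?add0r.
Qed.

Lemma ctx_pR_sum b x : ctx_pR b x + ctx_pR (~~ b) x = x.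
Proof.
by case: b; case: x => [[a x] [y b]]; apply: ctxP; rewrite /= ?addr0 ?add0r.
Qed.

Definition ctx_peirce : peirce (ctx M).
Proof.
by apply: (Peirce ctx_pL_lin ctx_pR_lin ctx_pL_mul ctx_pR_mul ctx_pLR_mid
  ctx_pL_sum ctx_pR_sum) => -[] // [].
Defined.

Lemma cornerA_hom : alg_hom (@cornerA k A B M).
Proof.
split=> [c a a'|a a']; apply: ctxP => //=; by rewrite ?scaler0 ?ctx0 ?addr0.
Qed.

Lemma cornerB_hom : alg_hom (@cornerB k A B M).
Proof.
split=> [c a a'|a a']; apply: ctxP => //=; by rewrite ?scaler0 ?ctx0 ?addr0 ?add0r.
Qed.

Lemma cornerA_inj : injective (@cornerA k A B M).
Proof. by move=> a a' []. Qed.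

Lemma cornerB_inj : injective (@cornerB k A B M).
Proof. by move=> a a' []. Qed.

Definition cornerX (x : mX M) : ctx M := ((0, x), (0, 0)).
Definition cornerY (y : mY M) : ctx M := ((0, 0), (y, 0)).

Lemma cornerX_lin : linear cornerX.
Proof. by move=> c x y; apply: ctxP => //=; rewrite scaler0 addr0. Qed.

Lemma cornerY_lin : linear cornerY.
Proof. by move=> c x y; apply: ctxP => //=; rewrite scaler0 addr0. Qed.

Lemma blockA (m : ctx M) : block ctx_peirce false false m <-> m = cornerA M m.1.1.
Proof.
case: m => [[a x] [y b]]; split=> /= [[[<- <-] [<-]] //|[-> -> ->]]; by split.
Qed.

Lemma blockB (m : ctx M) : block ctx_peirce true true m <-> m = cornerB M m.2.2.
Proof.
case: m => [[a x] [y b]]; split=> /= [[[<- <-] [<-]] //|[-> -> ->]]; by split.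
Qed.

Lemma cornerXY x y : cornerX x ** cornerY y = cornerA M (tauA x y).
Proof. by apply: ctxP; rewrite /= !ctx0 ?addr0 ?add0r. Qed.

Lemma cornerYX y x : cornerY y ** cornerX x = cornerB M (tauB y x).
Proof. by apply: ctxP; rewrite /= !ctx0 ?addr0 ?add0r. Qed.

Lemma cornerYA y a : cornerY y ** cornerA M a = cornerY (ract y a).
Proof. by apply: ctxP; rewrite /= !ctx0 ?addr0 ?add0r. Qed.

Lemma cornerAX a x : cornerA M a ** cornerX x = cornerX (lact a x).
Proof. by apply: ctxP; rewrite /= !ctx0 ?addr0 ?add0r. Qed.

Lemma cornerXB x b : cornerX x ** cornerB M b = cornerX (ract x b).
Proof. by apply: ctxP; rewrite /= !ctx0 ?addr0 ?add0r. Qed.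

Lemma cornerBY b y : cornerB M b ** cornerY y = cornerY (lact b y).
Proof. by apply: ctxP; rewrite /= !ctx0 ?addr0 ?add0r. Qed.

Lemma ctx_decomp (m : ctx M) :
  m = cornerA M m.1.1 + cornerX m.1.2 + cornerY m.2.1 + cornerB M m.2.2.
Proof. by apply: ctxP; rewrite /= ?addr0 ?add0r. Qed.

End ContextPeirce.

(** * Skew group algebras of Morita equivalent partial actions *)

Section MoritaGraded.
Variables (k : comPzRingType) (G : groupType) (A B : nuAlgType k).
Variables (alpha : ppaction G A) (beta : ppaction G B) (M : mcontext A B).
Variable theta : ppaction G (ctx M).
Hypothesis ME : morita_equivalence M.
Hypothesis domE : forall t,
  setprod (@tauB k A B M)
    (setprod (@ract k B A (mY M)) [set: mY M] (dom alpha t)) [set: mX M]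
  = dom beta t.
Hypothesis resA : restricts_to theta alpha (@cornerA k A B M).
Hypothesis resB : restricts_to theta beta (@cornerB k A B M).

Local Notation P := (ctx_peirce M).
Local Notation cA := (@cornerA k A B M).
Local Notation cB := (@cornerB k A B M).

Let domA t a : dom theta t (cA a) <-> dom alpha t a.
Proof. by have [<- _] := resA t. Qed.

Let domB t b : dom theta t (cB b) <-> dom beta t b.
Proof. by have [<- _] := resB t. Qed.

Lemma morita_diag_act t b x : dom_block P theta b b t^-1%g x ->
  block P b b (act theta t x).
Proof.
case: b => -[Dx hx].
  have e := hx; move/blockB: e Dx => -> /domB Dx.
  by have [_ ->] := resB t => //; apply/blockB.
have e := hx; move/blockA: e Dx => -> /domA Dx.
by have [_ ->] := resA t => //; apply/blockA.
Qed.

(** In the corner [B] this is the condition [Y (dom alpha t) X = dom beta t]; in the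
    corner [A], write the two outer factors of a product of three elements of
    [dom alpha t] as sums of pairings of [X] and [Y]. *)
Lemma morita_diag_span b t :
  (dom_block P theta b b t `<=`
     (block P b (~~ b) ** dom_block P theta (~~ b) (~~ b) t) ** block P (~~ b) b)%classic.
Proof.
move=> u [Du hu]; case: b hu => hu.
  have e := hu; move/blockB: e Du => -> /domB; rewrite -domE.
  move: u.2.2 => c; move: c; apply: setprod_sub => [|y x + _].
    exact: (submod_preim (@cornerB_hom _ _ _ M).1 (lspan_submod _)).
  move: y; apply: setprod_sub => [|y d _ Dd].
    apply: (submod_preim (f := fun y => cB (tauB y x))) (lspan_submod _) => c y y'.
    by rewrite (tauB_bilinear M).2 (cornerB_hom M).1.
  rewrite /preimage /= -cornerYX -cornerYA.
  apply: in_setprod => //; apply: in_setprod => //.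
  by split; [exact/domA|exact/blockA].
have e := hu; move/blockA: e Du => -> /domA /dom3.
have [_ _ _ _ [XY _]] := ME.
move: (u.1.1) => c; move: c; apply: setprod_sub => [|a1 w _].
  exact: (submod_preim (@cornerA_hom _ _ _ M).1 (lspan_submod _)).
move: w; apply: setprod_sub => [|d a2 Dd _].
  apply: (submod_preim (f := fun w => cA (a1 ** w))) (lspan_submod _) => c x y.
  by rewrite (mulB A).1 (cornerA_hom M).1.
rewrite /preimage /=.
have : [set: A] a1 by []; rewrite -XY; move: a1.
apply: setprod_sub => [|x y _ _].
  apply: (submod_preim (f := fun a1 => cA (a1 ** (d ** a2)))) (lspan_submod _) => c a a'.
  by rewrite (mulB A).2 (cornerA_hom M).1.
have : [set: A] a2 by []; rewrite -XY; move: a2.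
apply: setprod_sub => [|x' y' _ _].
  apply: (submod_preim (f := fun a2 => cA (tauA x y ** (d ** a2)))) (lspan_submod _) => c a a'.
  by rewrite !(mulB A).1 (cornerA_hom M).1.
rewrite /preimage /= !(cornerA_hom M).2 -!cornerXY !amulA.
apply: in_setprod => //; rewrite -!amulA; apply: in_setprod => //.
rewrite amulA cornerYA cornerYX; split; last exact/blockB.
by apply/domB; rewrite -domE; apply: in_setprod => //; apply: in_setprod.
Qed.

Lemma morita_corner_family : corner_family alpha beta theta cA cB (dom_block P theta).
Proof.
have da := morita_diag_act; have ds := morita_diag_span.
split.
- exact: cornerA_hom.
- exact: cornerA_inj.
- exact: cornerB_hom.
- exact: cornerB_inj.
- by move=> t a Da; case: (resA t) => _ ->.
- by move=> t b Db; case: (resB t) => _ ->.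
- move=> t; apply/seteqP; split=> [_ [a Da <-]|x [Dx hx]].
    by split; [exact/domA|exact/blockA].
  by move/blockA: hx Dx => -> /domA Da; exists x.1.1.
- move=> t; apply/seteqP; split=> [_ [a Da <-]|x [Dx hx]].
    by split; [exact/domB|exact/blockB].
  by move/blockB: hx Dx => -> /domB Da; exists x.2.2.
- exact: pc_submod.
- by move=> b c t x [].
- by move=> b c d r s x y; apply: dom_block_mul.
- move=> b c d t x /(dom_block_span ds c).
  move: x; apply: setprod_sub; first exact: lspan_submod.
  move=> x y hx hy; apply: sub_lspan; exists 1%g, x, y.
  by rewrite invg1 mul1g skew_coef1; split=> //; apply: block_pc1.
Qed.

End MoritaGraded.

Lemma morita_equiv_graded_equiv (k : comPzRingType) (G : groupType)
    (A B : nuAlgType k) (alpha : ppaction G A) (beta : ppaction G B) :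
  morita_equiv alpha beta -> graded_equiv (skew_galg alpha) (skew_galg beta).
Proof.
case=> M [ME [theta [domE resA resB]]].
exact: corner_graded_equiv (morita_corner_family ME domE resA resB).
Qed.

(** * Symmetry and transitivity of graded equivalence *)

Section Flip.
Variables (k : comPzRingType) (A B : nuAlgType k) (M : mcontext A B).

Definition mflip : mcontext B A :=
  MContext (tauB_bilinear M) (@tauB_balanced _ _ _ M) (@tauB_lact _ _ _ M)
    (@tauB_ract _ _ _ M) (tauA_bilinear M) (@tauA_balanced _ _ _ M)
    (@tauA_lact _ _ _ M) (@tauA_ract _ _ _ M) (@tauBA _ _ _ M) (@tauAB _ _ _ M).

End Flip.

Lemma graded_equiv_sym (k : comPzRingType) (G : groupType) (A B : gradedAlg k G) :
  graded_equiv A B -> graded_equiv B A.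
Proof.
case=> AA BB [M [Xg [Yg [[uX uY] [gX gY] tA tB [sA sB]]]]]; split=> //.
by exists (mflip M), Yg, Xg.
Qed.

Section Composition.
Variables (k : comPzRingType) (R S T : nuAlgType k).
Variables (M1 : mcontext R S) (M2 : mcontext S T).
Local Notation X := (mX M1).
Local Notation Y := (mY M1).
Local Notation P := (mX M2).
Local Notation Q := (mY M2).

(** The image of the tensor [x (x) p] among the pairs of maps [Q -> X] and
    [Y -> P]. Working with this image of the tensor product avoids forming
    the quotient, and it remembers enough to evaluate all the pairings. *)
Definition ctensor (x : X) (p : P) : (Q -> X) * (Y -> P) :=
  (fun q => ract x (tauA p q), fun y => lact (tauB y x) p).

Definition compX := spanT [set ctensor x p | x in [set: X] & p in [set: P]].

Implicit Types (F : compX) (r : R) (t : T).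



Definition mkX x p : compX := mkspan (sub_lspan (image2_in ctensor x p)).

Lemma compX_ind (Z : set compX) : is_submod Z -> (forall x p, Z (mkX x p)) ->
  forall F, Z F.
Proof.
move=> Zs h; apply: span_ind => // F [x _ [p _ e]].
by have -> : F = mkX x p by apply: spanP.
Qed.

Definition evalQ F : Q -> X := (span_val F).1.
Definition evalY F : Y -> P := (span_val F).2.

Lemma evalQ_linF q : linear (evalQ^~ q). Proof. by []. Qed.
Lemma evalY_linF y : linear (evalY^~ y). Proof. by []. Qed.

Lemma evalQ_lin F : linear (evalQ F).
Proof.
move: F; apply: compX_ind => [|x p]; first exact: submod_linear evalQ_linF.
by move=> c q q'; rewrite /evalQ /= (tauA_bilinear M2).1 (ract_bilinear X).1.
Qed.

Lemma evalY_lin F : linear (evalY F).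
Proof.
move: F; apply: compX_ind => [|x p]; first exact: submod_linear evalY_linF.
by move=> c y y'; rewrite /evalY /= (tauB_bilinear M1).2 (lact_bilinear P).2.
Qed.

Lemma compXP F F' : evalQ F = evalQ F' -> evalY F = evalY F' -> F = F'.
Proof.
rewrite /evalQ /evalY => e1 e2; apply: spanP; case: (span_val F) (span_val F') e1 e2.
by move=> a b [c d] /= -> ->.
Qed.

Definition compX_lact_fun r (F : (Q -> X) * (Y -> P)) : (Q -> X) * (Y -> P) :=
  (fun q => lact r (F.1 q), fun y => F.2 (ract y r)).
Definition compX_ract_fun t (F : (Q -> X) * (Y -> P)) : (Q -> X) * (Y -> P) :=
  (fun q => F.1 (lact t q), fun y => ract (F.2 y) t).

Lemma compX_lact_fun_lin r : linear (compX_lact_fun r).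
Proof.
by move=> c F F'; congr (_, _); apply: funext => z //=; rewrite (lact_bilinear X).1.
Qed.

Lemma compX_ract_fun_lin t : linear (compX_ract_fun t).
Proof.
by move=> c F F'; congr (_, _); apply: funext => z //=; rewrite (ract_bilinear P).2.
Qed.

Lemma compX_lact_fun_gen r x p : compX_lact_fun r (ctensor x p) = ctensor (lact r x) p.
Proof.
by congr (_, _); apply: funext => z /=; rewrite ?lractA ?tauB_balanced.
Qed.

Lemma compX_ract_fun_gen t x p : compX_ract_fun t (ctensor x p) = ctensor x (ract p t).
Proof.
by congr (_, _); apply: funext => z /=; rewrite ?lractA ?tauA_balanced.
Qed.

Lemma compX_lact_closed r F : lspan [set ctensor x p | x in [set: X] & p in [set: P]]
  (compX_lact_fun r (span_val F)).
Proof.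
move: F; apply: compX_ind => [|x p]; last by rewrite compX_lact_fun_gen; apply/sub_lspan/image2_in.
apply: submod_preim (lspan_submod _) => c z z'; exact: compX_lact_fun_lin.
Qed.

Lemma compX_ract_closed t F : lspan [set ctensor x p | x in [set: X] & p in [set: P]]
  (compX_ract_fun t (span_val F)).
Proof.
move: F; apply: compX_ind => [|x p]; last by rewrite compX_ract_fun_gen; apply/sub_lspan/image2_in.
apply: submod_preim (lspan_submod _) => c z z'; exact: compX_ract_fun_lin.
Qed.

Definition compX_lact r F : compX := mkspan (compX_lact_closed r F).
Definition compX_ract F t : compX := mkspan (compX_ract_closed t F).

Lemma compX_lact_gen r x p : compX_lact r (mkX x p) = mkX (lact r x) p.
Proof. exact/spanP/compX_lact_fun_gen. Qed.

Lemma compX_ract_gen t x p : compX_ract (mkX x p) t = mkX x (ract p t).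
Proof. exact/spanP/compX_ract_fun_gen. Qed.

Lemma compX_lact_bilinear : bilinear_op compX_lact.
Proof.
split=> [r|F] c r1 r2; first exact/spanP/compX_lact_fun_lin.
apply: compXP; apply: funext => z; rewrite /evalQ /evalY /=; first exact: (lact_bilinear X).2.
by rewrite (ract_bilinear Y).1 -[LHS]/(evalY F _) evalY_lin.
Qed.

Lemma compX_ract_bilinear : bilinear_op compX_ract.
Proof.
split=> [F|t] c r1 r2; last exact/spanP/compX_ract_fun_lin.
apply: compXP; apply: funext => z; rewrite /evalQ /evalY /=; last exact: (ract_bilinear P).1.
by rewrite (lact_bilinear Q).2 -[LHS]/(evalQ F _) evalQ_lin.
Qed.

Lemma compX_lactA r r' F : compX_lact (r ** r') F = compX_lact r (compX_lact r' F).
Proof. by apply: compXP; apply: funext => z; rewrite /evalQ /evalY /= ?lactA ?ractA. Qed.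

Lemma compX_ractA F t t' : compX_ract F (t ** t') = compX_ract (compX_ract F t) t'.
Proof. by apply: compXP; apply: funext => z; rewrite /evalQ /evalY /= ?lactA ?ractA. Qed.

Lemma compX_lractA r F t : compX_ract (compX_lact r F) t = compX_lact r (compX_ract F t).
Proof. by apply: compXP; apply: funext => z. Qed.

Definition comp_bimodX : bimodule R T := Bimodule compX_lact_bilinear compX_ract_bilinear compX_lactA compX_ractA compX_lractA.

(** The tensor [q (x) y] as a functional on [compX], with values in both algebras
    at once: the two pairings of the composite context are then evaluations, and
    are well defined without choosing representatives. *)
Definition dtensor (q : Q) (y : Y) : compX -> R * T :=
  fun F => (tauA (evalQ F q) y, tauB q (evalY F y)).

Definition compY := spanT [set dtensor q y | q in [set: Q] & y in [set: Y]].

Implicit Types H : compY.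

Definition mkY q y : compY := mkspan (sub_lspan (image2_in dtensor q y)).

Lemma compY_ind (Z : set compY) : is_submod Z -> (forall q y, Z (mkY q y)) ->
  forall H, Z H.
Proof.
move=> Zs h; apply: span_ind => // H [q _ [y _ e]].
by have -> : H = mkY q y by apply: spanP.
Qed.

Lemma span_val_linF F : linear (fun H => span_val H F). Proof. by []. Qed.

Lemma compY_lin H : linear (span_val H).
Proof.
move: H; apply: compY_ind => [|q y]; first exact: submod_linear span_val_linF.
move=> c F F'; rewrite /= /dtensor evalQ_linF evalY_linF.
by rewrite (tauA_bilinear M1).2 (tauB_bilinear M2).1.
Qed.

Definition pairR F H : R := (span_val H F).1.
Definition pairT H F : T := (span_val H F).2.

Lemma pairR_linH F : linear (pairR F). Proof. by []. Qed.
Lemma pairT_linH F : linear (pairT^~ F). Proof. by []. Qed.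
Lemma pairR_linF H : linear (pairR^~ H).
Proof. by move=> c F F'; rewrite /pairR compY_lin. Qed.
Lemma pairT_linF H : linear (pairT H).
Proof. by move=> c F F'; rewrite /pairT compY_lin. Qed.

Lemma compYP H H' : (forall F, pairR F H = pairR F H') ->
  (forall F, pairT H F = pairT H' F) -> H = H'.
Proof.
move=> e1 e2; apply/spanP/funext => F; move: (e1 F) (e2 F); rewrite /pairR /pairT.
by case: (span_val H F) (span_val H' F) => a b [c d] /= -> ->.
Qed.

Lemma pairR_gen x p q y : pairR (mkX x p) (mkY q y) = tauA (ract x (tauA p q)) y.
Proof. by []. Qed.

Lemma pairT_gen x p q y : pairT (mkY q y) (mkX x p) = tauB q (lact (tauB y x) p).
Proof. by []. Qed.

Definition compY_lact_fun t (H : compX -> R * T) : compX -> R * T :=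
  fun F => ((H (compX_ract F t)).1, t ** (H F).2).
Definition compY_ract_fun r (H : compX -> R * T) : compX -> R * T :=
  fun F => ((H F).1 ** r, (H (compX_lact r F)).2).

Lemma compY_lact_fun_lin t : linear (compY_lact_fun t).
Proof.
by move=> c H H'; apply: funext => F; congr (_, _) => //=; rewrite (mulB T).1.
Qed.

Lemma compY_ract_fun_lin r : linear (compY_ract_fun r).
Proof.
by move=> c H H'; apply: funext => F; congr (_, _) => //=; rewrite (mulB R).2.
Qed.

Lemma compY_lact_fun_gen t q y : compY_lact_fun t (dtensor q y) = dtensor (lact t q) y.
Proof. by apply: funext => F; congr (_, _); rewrite /= tauB_lact. Qed.

Lemma compY_ract_fun_gen r q y : compY_ract_fun r (dtensor q y) = dtensor q (ract y r).
Proof. by apply: funext => F; congr (_, _); rewrite /= tauA_ract. Qed.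

Lemma compY_lact_closed t H : lspan [set dtensor q y | q in [set: Q] & y in [set: Y]]
  (compY_lact_fun t (span_val H)).
Proof.
move: H; apply: compY_ind => [|q y]; last by rewrite compY_lact_fun_gen; apply/sub_lspan/image2_in.
apply: submod_preim (lspan_submod _) => c z z'; exact: compY_lact_fun_lin.
Qed.

Lemma compY_ract_closed r H : lspan [set dtensor q y | q in [set: Q] & y in [set: Y]]
  (compY_ract_fun r (span_val H)).
Proof.
move: H; apply: compY_ind => [|q y]; last by rewrite compY_ract_fun_gen; apply/sub_lspan/image2_in.
apply: submod_preim (lspan_submod _) => c z z'; exact: compY_ract_fun_lin.
Qed.

Definition compY_lact t H : compY := mkspan (compY_lact_closed t H).
Definition compY_ract H r : compY := mkspan (compY_ract_closed r H).

Lemma compY_lact_gen t q y : compY_lact t (mkY q y) = mkY (lact t q) y.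
Proof. exact/spanP/compY_lact_fun_gen. Qed.

Lemma compY_ract_gen r q y : compY_ract (mkY q y) r = mkY q (ract y r).
Proof. exact/spanP/compY_ract_fun_gen. Qed.

Lemma pairR_bal F t H : pairR (compX_ract F t) H = pairR F (compY_lact t H). Proof. by []. Qed.
Lemma pairT_bal H r F : pairT (compY_ract H r) F = pairT H (compX_lact r F). Proof. by []. Qed.
Lemma pairR_r F H r : pairR F (compY_ract H r) = pairR F H ** r. Proof. by []. Qed.
Lemma pairT_l t H F : pairT (compY_lact t H) F = t ** pairT H F. Proof. by []. Qed.

Lemma pairR_l r F H : pairR (compX_lact r F) H = r ** pairR F H.
Proof.
move: H; apply: compY_ind => [|q y].
  apply: (submod_eq (f := pairR (compX_lact r F)) (g := fun H => r ** pairR F H)) => //.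
  by move=> c H H'; rewrite pairR_linH (mulB R).1.
by rewrite /pairR /= /evalQ /= tauA_lact.
Qed.

Lemma pairT_r H F t : pairT H (compX_ract F t) = pairT H F ** t.
Proof.
move: H; apply: compY_ind => [|q y].
  apply: (submod_eq (f := fun H => pairT H (compX_ract F t)) (g := fun H => pairT H F ** t)) => //.
  by move=> c H H'; rewrite pairT_linH (mulB T).2.
by rewrite /pairT /= /evalY /= tauB_ract.
Qed.

Lemma compY_lact_bilinear : bilinear_op compY_lact.
Proof.
split=> [r|H] c r1 r2; first exact/spanP/compY_lact_fun_lin.
apply: compYP => F; last exact: (mulB T).2.
by rewrite pairR_linH -!pairR_bal compX_ract_bilinear.1 pairR_linF.
Qed.

Lemma compY_ract_bilinear : bilinear_op compY_ract.
Proof.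
split=> [H|r] c r1 r2; last exact/spanP/compY_ract_fun_lin.
apply: compYP => F; first exact: (mulB R).1.
by rewrite pairT_linH !pairT_bal compX_lact_bilinear.2 pairT_linF.
Qed.

Lemma compY_lactA t t' H : compY_lact (t ** t') H = compY_lact t (compY_lact t' H).
Proof.
apply: compYP => F; last by rewrite !pairT_l amulA.
by rewrite -!pairR_bal compX_ractA.
Qed.

Lemma compY_ractA H r r' : compY_ract H (r ** r') = compY_ract (compY_ract H r) r'.
Proof.
apply: compYP => F; first by rewrite !pairR_r amulA.
by rewrite !pairT_bal compX_lactA.
Qed.

Lemma compY_lractA t H r : compY_ract (compY_lact t H) r = compY_lact t (compY_ract H r).
Proof. by apply: compYP => F. Qed.

Definition comp_bimodY : bimodule T R := Bimodule compY_lact_bilinear compY_ract_bilinear compY_lactA compY_ractA compY_lractA.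

Lemma pairR_bilinear : bilinear_op pairR.
Proof. by split=> [F|H]; [exact: pairR_linH|exact: pairR_linF]. Qed.

Lemma pairT_bilinear : bilinear_op pairT.
Proof. by split=> [F|H]; [exact: pairT_linF|exact: pairT_linH]. Qed.

Lemma pairRT F H F' : compX_lact (pairR F H) F' = compX_ract F (pairT H F').
Proof.
move: F; apply: compX_ind => [|x p].
  apply: (submod_eq (f := fun F => compX_lact (pairR F H) F')
    (g := fun F => compX_ract F (pairT H F'))); last exact: compX_ract_bilinear.2.
  by move=> c F1 F2; rewrite pairR_linF compX_lact_bilinear.2.
move: H; apply: compY_ind => [|q y].
  apply: (submod_eq (f := fun H => compX_lact (pairR (mkX x p) H) F')
    (g := fun H => compX_ract (mkX x p) (pairT H F'))).
    by move=> c H1 H2; rewrite pairR_linH compX_lact_bilinear.2.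
  by move=> c H1 H2; rewrite pairT_linH compX_ract_bilinear.1.
move: F'; apply: compX_ind => [|x' p'].
  apply: (submod_eq (f := compX_lact (pairR (mkX x p) (mkY q y)))
    (g := fun F' => compX_ract (mkX x p) (pairT (mkY q y) F'))).
    exact: compX_lact_bilinear.1.
  by move=> c F1 F2; rewrite pairT_linF compX_ract_bilinear.1.
rewrite compX_lact_gen compX_ract_gen pairR_gen pairT_gen -(tauAB p) tauAB.
by apply: compXP; apply: funext => z; rewrite /evalQ /evalY /=
  ?tauA_lact ?tauB_ract ?ractA ?lactA.
Qed.

Lemma pairTR H F H' : compY_lact (pairT H F) H' = compY_ract H (pairR F H').
Proof.
apply: compYP => F'.
  by rewrite pairR_r -pairR_bal -pairRT pairR_l.
by rewrite pairT_bal pairT_l pairRT pairT_r.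
Qed.

Definition comp_context : mcontext R T :=
  @MContext k R T comp_bimodX comp_bimodY pairR pairT pairR_bilinear pairR_bal
    pairR_l pairR_r pairT_bilinear pairT_bal pairT_l pairT_r pairRT pairTR.

Lemma mkX_bilinear : bilinear_op mkX.
Proof.
split=> [x|p] c z z'; apply: compXP; apply: funext => w; rewrite /evalQ /evalY /=.
- by rewrite (tauA_bilinear M2).2 (ract_bilinear X).1.
- exact: (lact_bilinear P).1.
- exact: (ract_bilinear X).2.
- by rewrite (tauB_bilinear M1).1 (lact_bilinear P).2.
Qed.

Lemma mkY_bilinear : bilinear_op mkY.
Proof.
split=> [x|p] c z z'; apply: compYP => F; rewrite /pairR /pairT /=.
- exact: (tauA_bilinear M1).1.
- by rewrite evalY_lin (tauB_bilinear M2).1.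
- by rewrite evalQ_lin (tauA_bilinear M1).2.
- exact: (tauB_bilinear M2).2.
Qed.

Hypotheses (uX : unital_bimodule X) (uY : unital_bimodule Y).
Hypotheses (uP : unital_bimodule P) (uQ : unital_bimodule Q).
Hypotheses (t1 : tau_surjective M1) (t2 : tau_surjective M2).

Lemma comp_unitalX : unital_bimodule comp_bimodX.
Proof.
split; apply/seteqP; split=> // F _; move: F; apply: compX_ind; try exact: lspan_submod.
  move=> x p; have : [set: X] x by []; rewrite -uX.1; move: x.
  apply: setprod_sub => [|r x _ _].
    exact: (submod_preim (mkX_bilinear.2 p) (lspan_submod _)).
  by rewrite /preimage /= -compX_lact_gen; apply: in_setprod.
move=> x p; have : [set: P] p by []; rewrite -uP.2; move: p.
apply: setprod_sub => [|p t _ _].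
  exact: (submod_preim (mkX_bilinear.1 x) (lspan_submod _)).
by rewrite /preimage /= -compX_ract_gen; apply: in_setprod.
Qed.

Lemma comp_unitalY : unital_bimodule comp_bimodY.
Proof.
split; apply/seteqP; split=> // H _; move: H; apply: compY_ind; try exact: lspan_submod.
  move=> q y; have : [set: Q] q by []; rewrite -uQ.1; move: q.
  apply: setprod_sub => [|t q _ _].
    exact: (submod_preim (mkY_bilinear.2 y) (lspan_submod _)).
  by rewrite /preimage /= -compY_lact_gen; apply: in_setprod.
move=> q y; have : [set: Y] y by []; rewrite -uY.2; move: y.
apply: setprod_sub => [|y r _ _].
  exact: (submod_preim (mkY_bilinear.1 q) (lspan_submod _)).
by rewrite /preimage /= -compY_ract_gen; apply: in_setprod.
Qed.

Lemma comp_surjective : tau_surjective comp_context.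
Proof.
split; apply/seteqP; split=> //.
  rewrite -{1}t1.1; apply: setprod_sub => [|x y _ _]; first exact: lspan_submod.
  have : [set: X] x by []; rewrite -uX.2; move: x.
  apply: setprod_sub => [|x s _ _].
    exact: (submod_preim ((tauA_bilinear M1).2 y) (lspan_submod _)).
  have : [set: S] s by []; rewrite -t2.1; move: s.
  apply: setprod_sub => [|p q _ _].
    apply: (submod_preim (f := fun s => tauA (ract x s) y)) (lspan_submod _) => c s s'.
    by rewrite (ract_bilinear X).1 (tauA_bilinear M1).2.
  by rewrite /preimage /= -pairR_gen; apply: (in_setprod pairR).
rewrite -{1}t2.2; apply: setprod_sub => [|q p _ _]; first exact: lspan_submod.
have : [set: P] p by []; rewrite -uP.1; move: p.
apply: setprod_sub => [|s p _ _].
  exact: (submod_preim ((tauB_bilinear M2).1 q) (lspan_submod _)).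
have : [set: S] s by []; rewrite -t1.2; move: s.
apply: setprod_sub => [|y x _ _].
  apply: (submod_preim (f := fun s => tauB q (lact s p))) (lspan_submod _) => c s s'.
  by rewrite (lact_bilinear P).2 (tauB_bilinear M2).1.
by rewrite /preimage /= -pairT_gen; apply: (in_setprod pairT).
Qed.

End Composition.

Section GradedComposition.
Variables (k : comPzRingType) (G : groupType) (R S T : gradedAlg k G).
Variables (M1 : mcontext R S) (M2 : mcontext S T).
Variables (Xg : G -> set (mX M1)) (Yg : G -> set (mY M1)).
Variables (Pg : G -> set (mX M2)) (Qg : G -> set (mY M2)).
Hypotheses (gX : graded_bimodule Xg) (gY : graded_bimodule Yg).
Hypotheses (gP : graded_bimodule Pg) (gQ : graded_bimodule Qg).
Hypothesis tR : forall r s x y, Xg r x -> Yg s y -> hcomp (g:=R) (r * s)%g (tauA x y).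
Hypothesis tS1 : forall r s y x, Yg r y -> Xg s x -> hcomp (g:=S) (r * s)%g (tauB y x).
Hypothesis tS2 : forall r s p q, Pg r p -> Qg s q -> hcomp (g:=S) (r * s)%g (tauA p q).
Hypothesis tT : forall r s q p, Qg r q -> Pg s p -> hcomp (g:=T) (r * s)%g (tauB q p).

Local Notation mkX := (@mkX k R S T M1 M2).
Local Notation mkY := (@mkY k R S T M1 M2).
Local Notation dtensor := (@dtensor k R S T M1 M2).
Local Notation cX := (comp_bimodX M1 M2).
Local Notation cY := (comp_bimodY M1 M2).

Definition genX t : set ((mY M2 -> mX M1) * (mY M1 -> mX M2)) :=
  [set F | exists r s x p, [/\ (r * s)%g = t, Xg r x, Pg s p & F = ctensor x p]].
Definition genY t : set (compX M1 M2 -> R * T) :=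
  [set H | exists r s q y, [/\ (r * s)%g = t, Qg r q, Yg s y & H = dtensor q y]].

Definition compXg t : set cX := [set F | lspan (genX t) (span_val (F : compX M1 M2))].
Definition compYg t : set cY := [set H | lspan (genY t) (span_val (H : compY M1 M2))].

Lemma genX_in t : genX t `<=` [set ctensor x p | x in [set: mX M1] & p in [set: mX M2]].
Proof. by move=> _ [r [s [x [p [_ _ _ ->]]]]]; apply: image2_in. Qed.

Lemma genY_in t : genY t `<=` [set dtensor q y | q in [set: mY M2] & y in [set: mY M1]].
Proof. by move=> _ [r [s [x [p [_ _ _ ->]]]]]; apply: image2_in. Qed.

Lemma compXg_submod t : is_submod (compXg t).
Proof. exact: submod_preim (@span_lin _ _ _) (lspan_submod (genX t)). Qed.

Lemma compYg_submod t : is_submod (compYg t).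
Proof. exact: submod_preim (@span_lin _ _ _) (lspan_submod (genY t)). Qed.

Lemma compXg_ind t (Z : set cX) : is_submod Z ->
  (forall r s x p, (r * s)%g = t -> Xg r x -> Pg s p -> Z (mkX x p)) ->
  forall F, compXg t F -> Z F.
Proof.
move=> Zs h; apply: (@span_indl _ _ _ (genX t)) => //; first exact: genX_in.
move=> F [r [s [x [p [rs Xx Pp e]]]]].
have -> : F = mkX x p by apply: spanP.
exact: h rs Xx Pp.
Qed.

Lemma compYg_ind t (Z : set cY) : is_submod Z ->
  (forall r s q y, (r * s)%g = t -> Qg r q -> Yg s y -> Z (mkY q y)) ->
  forall H, compYg t H -> Z H.
Proof.
move=> Zs h; apply: (@span_indl _ _ _ (genY t)) => //; first exact: genY_in.
move=> F [r [s [x [p [rs Xx Pp e]]]]].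
have -> : F = mkY x p by apply: spanP.
exact: h rs Xx Pp.
Qed.

Lemma mkX_graded r s x p : Xg r x -> Pg s p -> compXg (r * s)%g (mkX x p).
Proof. by move=> Xx Pp; apply: sub_lspan; exists r, s, x, p. Qed.

Lemma mkY_graded r s q y : Qg r q -> Yg s y -> compYg (r * s)%g (mkY q y).
Proof. by move=> Xx Pp; apply: sub_lspan; exists r, s, q, y. Qed.

Lemma evalQ_graded t u (F : cX) q : compXg t F -> Qg u q -> Xg (t * u)%g (evalQ F q).
Proof.
move=> + Qq; move: F; apply: compXg_ind => [|r s x p <- Xx Pp].
  exact: (submod_preim (evalQ_linF q)) (direct_sum_submod (gbimod_sum gX) _).
by rewrite -mulgA; apply: (gbimod_ract gX) => //; apply: tS2.
Qed.

Lemma evalY_graded t u (F : cX) y : compXg t F -> Yg u y -> Pg (u * t)%g (evalY F y).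
Proof.
move=> + Yy; move: F; apply: compXg_ind => [|r s x p <- Xx Pp].
  exact: (submod_preim (evalY_linF y)) (direct_sum_submod (gbimod_sum gP) _).
by rewrite mulgA; apply: (gbimod_lact gP) => //; apply: tS1.
Qed.

Lemma pairR_graded t u (F : cX) (H : cY) : compXg t F -> compYg u H ->
  hcomp (g:=R) (t * u)%g (pairR F H).
Proof.
move=> gF; move: H; apply: compYg_ind => [|r s q y <- Qq Yy].
  exact: (submod_preim (@pairR_linH _ _ _ _ _ _ F)) (direct_sum_submod (hcomp_sum R) _).
by rewrite mulgA; apply: tR => //; apply: evalQ_graded.
Qed.

Lemma pairT_graded t u (F : cX) (H : cY) : compYg t H -> compXg u F ->
  hcomp (g:=T) (t * u)%g (pairT H F).
Proof.
move=> + gF; move: H; apply: compYg_ind => [|r s q y <- Qq Yy].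
  exact: (submod_preim (@pairT_linH _ _ _ _ _ _ F)) (direct_sum_submod (hcomp_sum T) _).
by rewrite -mulgA; apply: tT => //; apply: evalY_graded.
Qed.

Lemma compX_homog_span (F : cX) : lspan (\bigcup_t compXg t) F.
Proof.
move: F; apply: compX_ind => [|x p]; first exact: lspan_submod.
apply: (bil_span (mkX_bilinear M1 M2) (lspan_submod _) _
  (ds_span (gbimod_sum gX) x) (ds_span (gbimod_sum gP) p)).
move=> {}x {}p [r _ Xx] [s _ Pp]; apply: sub_lspan; exists (r * s)%g => //.
exact: mkX_graded.
Qed.

Lemma compY_homog_span (H : cY) : lspan (\bigcup_t compYg t) H.
Proof.
move: H; apply: compY_ind => [|x p]; first exact: lspan_submod.
apply: (bil_span (mkY_bilinear M1 M2) (lspan_submod _) _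
  (ds_span (gbimod_sum gQ) x) (ds_span (gbimod_sum gY) p)).
move=> {}x {}p [r _ Xx] [s _ Pp]; apply: sub_lspan; exists (r * s)%g => //.
exact: mkY_graded.
Qed.

Lemma zero_homog (U V : lmodType k) (Ug : G -> set U) (f : U -> V) :
  direct_sum Ug -> linear f -> (forall t u, Ug t u -> f u = 0) -> forall u, f u = 0.
Proof.
move=> ds fl h u; move: (ds_span ds u); apply: (lspan_sub (T := [set u | f u = 0])).
  apply: (submod_eq fl (g := fun=> 0)) => c x y; by rewrite scaler0 addr0.
by move=> v [t _ Uv]; apply: h Uv.
Qed.

(** Evaluating a relation between homogeneous elements at homogeneous elements of
    [mY M2] and [mY M1] gives relations in [mX M1] and [mX M2]. *)
Lemma compX_direct_sum : direct_sum compXg.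
Proof.
apply: ds_intro => [t|F|W F gF F0 t tW]; first exact: compXg_submod.
  exact: compX_homog_span.
apply: compXP; apply: funext.
  apply: (zero_homog (gbimod_sum gQ) (evalQ_lin (F t))) => u q Qq.
  apply: (ds_indep_shift (mulgK u) (mulgVK u) (gbimod_sum gX) (S := W)
    (f := fun t => evalQ (F t) q)) => //; first by move=> s; apply: evalQ_graded.
  by rewrite -(lin_sum _ _ (evalQ_linF q)) F0.
apply: (zero_homog (gbimod_sum gY) (evalY_lin (F t))) => u y Yy.
apply: (ds_indep_shift (mulKg u) (mulVKg u) (gbimod_sum gP) (S := W)
  (f := fun t => evalY (F t) y)) => //; first by move=> s; apply: evalY_graded.
by rewrite -(lin_sum _ _ (evalY_linF y)) F0.
Qed.

Lemma compY_direct_sum : direct_sum compYg.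
Proof.
apply: ds_intro => [t|F|W H gH H0 t tW]; first exact: compYg_submod.
  exact: compY_homog_span.
apply: compYP => F; move: F.
  apply: (zero_homog compX_direct_sum (@pairR_linF _ _ _ _ _ _ (H t))) => u F gF.
  apply: (ds_indep_shift (mulKg u) (mulVKg u) (hcomp_sum R) (S := W)
    (f := fun t => pairR F (H t))) => //; first by move=> s; apply: pairR_graded.
  by rewrite -(lin_sum _ _ (@pairR_linH _ _ _ _ _ _ F)) H0.
apply: (zero_homog compX_direct_sum (@pairT_linF _ _ _ _ _ _ (H t))) => u F gF.
apply: (ds_indep_shift (mulgK u) (mulgVK u) (hcomp_sum T) (S := W)
  (f := fun t => pairT (H t) F)) => //; first by move=> s; apply: pairT_graded.
by rewrite -(lin_sum _ _ (@pairT_linH _ _ _ _ _ _ F)) H0.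
Qed.

Lemma compX_graded : graded_bimodule compXg.
Proof.
split; first exact: compX_direct_sum.
- move=> t u a F ha; move: F; apply: compXg_ind => [|r s x p <- Xx Pp].
    exact: (submod_preim ((compX_lact_bilinear M1 M2).1 a)) (compXg_submod _).
  rewrite /preimage /= compX_lact_gen mulgA; apply: mkX_graded => //.
  exact: (gbimod_lact gX).
- move=> t u F b + hb; move: F; apply: compXg_ind => [|r s x p <- Xx Pp].
    exact: (submod_preim ((compX_ract_bilinear M1 M2).2 b)) (compXg_submod _).
  rewrite /preimage /= compX_ract_gen -mulgA; apply: mkX_graded => //.
  exact: (gbimod_ract gP).
Qed.

Lemma compY_graded : graded_bimodule compYg.
Proof.
split; first exact: compY_direct_sum.
- move=> t u a F ha; move: F; apply: compYg_ind => [|r s x p <- Xx Pp].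
    exact: (submod_preim ((compY_lact_bilinear M1 M2).1 a)) (compYg_submod _).
  rewrite /preimage /= compY_lact_gen mulgA; apply: mkY_graded => //.
  exact: (gbimod_lact gQ).
- move=> t u F b + hb; move: F; apply: compYg_ind => [|r s x p <- Xx Pp].
    exact: (submod_preim ((compY_ract_bilinear M1 M2).2 b)) (compYg_submod _).
  rewrite /preimage /= compY_ract_gen -mulgA; apply: mkY_graded => //.
  exact: (gbimod_ract gY).
Qed.

End GradedComposition.

Lemma graded_equiv_trans (k : comPzRingType) (G : groupType) (R S T : gradedAlg k G) :
  graded_equiv R S -> graded_equiv S T -> graded_equiv R T.
Proof.
case=> RR _ [M1 [Xg [Yg [[uX uY] [gX gY] tR tS1 s1]]]].
case=> _ TT [M2 [Pg [Qg [[uP uQ] [gP gQ] tS2 tT s2]]]]; split=> //.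
exists (comp_context M1 M2), (compXg Xg Pg), (compYg Yg Qg); split.
- split; [exact: (comp_unitalX uX uP)|exact: (comp_unitalY uY uQ)].
- split; [exact: (compX_graded gX gY gP gQ tS1 tS2)|exact: (compY_graded gX gY gP gQ tR tS1 tS2 tT)].
- by move=> r s x y; apply: (pairR_graded gX tR tS2).
- by move=> r s y x; apply: (pairT_graded gP tS1 tT).
- exact: (comp_surjective uX uP s1 s2).
Qed.

(** * Group actions on Morita contexts *)

Lemma morita_ctx_idempotent (k : comPzRingType) (A B : nuAlgType k)
    (M : mcontext A B) : morita_equivalence M -> idempotent_alg (ctx M).
Proof.
move=> [AA BB [lX _] [lY _] _]; apply/seteqP; split=> // m _.
rewrite (ctx_decomp m); have Cs := setprod_submod (@amul k (ctx M)) [set: ctx M] [set: ctx M].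
apply: submodD => //; first apply: submodD => //; first apply: submodD => //.
- move: (idem_dec AA m.1.1); move: m.1.1; apply: setprod_sub.
    exact: submod_preim (cornerA_hom M).1 Cs.
  by move=> a a' _ _; rewrite /preimage /= (cornerA_hom M).2; apply: in_setprod.
- have : [set: mX M] m.1.2 by []; rewrite -lX; move: m.1.2; apply: setprod_sub.
    exact: submod_preim (@cornerX_lin _ _ _ M) Cs.
  by move=> a x _ _; rewrite /preimage /= -cornerAX; apply: in_setprod.
- have : [set: mY M] m.2.1 by []; rewrite -lY; move: m.2.1; apply: setprod_sub.
    exact: submod_preim (@cornerY_lin _ _ _ M) Cs.
  by move=> a x _ _; rewrite /preimage /= -cornerBY; apply: in_setprod.
- move: (idem_dec BB m.2.2); move: m.2.2; apply: setprod_sub.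
    exact: submod_preim (cornerB_hom M).1 Cs.
  by move=> a a' _ _; rewrite /preimage /= (cornerB_hom M).2; apply: in_setprod.
Qed.

Section EquivariantContext.
Variables (k : comPzRingType) (G : groupType) (A B N : nuAlgType k).
Variables (alpha : gaction G A) (beta : gaction G B).
Variables (i : A -> N) (j : B -> N) (U V : set N) (E : embedded i j U V).
Variable s : G -> N -> N.
Hypotheses (s_hom : forall t, alg_hom (s t)) (s1 : forall x, s 1%g x = x).
Hypothesis sM : forall t u x, s t (s u x) = s (t * u)%g x.
Hypotheses (sU : forall t x, U x -> U (s t x)) (sV : forall t x, V x -> V (s t x)).
Hypothesis si : forall t a, s t (i a) = i (gact alpha t a).
Hypothesis sj : forall t b, s t (j b) = j (gact beta t b).

Local Notation M := (emb_context E).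

Let inU (x : mX M) : U (span_val (x : spanT U)).
Proof. exact: span_submod_in (emb_U E) x. Qed.

Let inV (y : mY M) : V (span_val (y : spanT V)).
Proof. exact: span_submod_in (emb_V E) y. Qed.

Definition shiftX t (x : mX M) : mX M := mkspan (sub_lspan (sU t (inU x))).
Definition shiftY t (y : mY M) : mY M := mkspan (sub_lspan (sV t (inV y))).

Definition ctx_shift t (m : ctx M) : ctx M :=
  ((gact alpha t m.1.1, shiftX t m.1.2), (shiftY t m.2.1, gact beta t m.2.2)).

Lemma ctx_shift1 m : ctx_shift 1%g m = m.
Proof.
by apply: ctxP => /=; rewrite ?gact1 //; apply: spanP; apply: s1.
Qed.

Lemma ctx_shiftM t u m : ctx_shift t (ctx_shift u m) = ctx_shift (t * u)%g m.
Proof.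
by apply: ctxP => /=; rewrite ?gactM //; apply: spanP; apply: sM.
Qed.

Lemma ctx_shift_lin t : linear (ctx_shift t).
Proof.
move=> c m n; apply: ctxP => /=; rewrite ?(gact_hom _ _).1 //; apply: spanP;
  exact: (s_hom t).1.
Qed.

Lemma ctx_shift_mul t : {morph ctx_shift t : m n / m ** n}.
Proof.
have siD := linD (s_hom t).1; have sm := (s_hom t).2.
move=> m n; apply: ctxP => /=.
- apply: (emb_iI E); rewrite -si !(linD (emb_i E).1) siD !(emb_i E).2 !(emb_tauK E).
  by rewrite !sm !si.
- by apply: spanP; rewrite /= siD !sm si sj.
- by apply: spanP; rewrite /= siD !sm si sj.
- apply: (emb_jI E); rewrite -sj !(linD (emb_j E).1) siD !(emb_j E).2 !(emb_tauK (embedded_flip E)).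
  by rewrite !sm !sj.
Qed.

Lemma ctx_shift_isom t : alg_isom [set: ctx M] [set: ctx M] (ctx_shift t).
Proof.
have K u : cancel (ctx_shift u) (ctx_shift u^-1%g).
  by move=> m; rewrite ctx_shiftM mulVg ctx_shift1.
split.
- split=> // [x y _ _|m _]; first exact: (can_inj (K t)).
  by exists (ctx_shift t^-1%g m) => //; rewrite ctx_shiftM mulgV ctx_shift1.
- by move=> m n _ _ c; rewrite ctx_shift_lin.
- by move=> m n _ _; rewrite ctx_shift_mul.
Qed.

Definition ctx_gaction : gaction G (ctx M) :=
  GAction ctx_shift_isom ctx_shift1 ctx_shiftM.

Lemma equivariant_morita (AA : idempotent_alg A) (BB : idempotent_alg B) :
  morita_equivalence M ->
  morita_equiv (ppaction_of_global AA alpha) (ppaction_of_global BB beta).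
Proof.
move=> ME; exists M; split=> //.
exists (ppaction_of_global (morita_ctx_idempotent ME) ctx_gaction); split.
- by case: ME => _ _ _ [_ uY] [_ tB] t; rewrite /= uY tB.
- move=> t; split=> // a _; apply: ctxP => //=; first exact/spanP/(lin0 (s_hom t).1).
    exact/spanP/(lin0 (s_hom t).1).
  exact: lin0 (gact_hom beta t).1.
- move=> t; split=> // a _; apply: ctxP => //=; last exact/spanP/(lin0 (s_hom t).1).
    exact: lin0 (gact_hom alpha t).1.
  exact/spanP/(lin0 (s_hom t).1).
Qed.

End EquivariantContext.

Section FunctionAlgebra.
Variables (k : comPzRingType) (G : groupType) (N : nuAlgType k).

(** Host of the context between two global actions: translation of functions
    replaces the action that the group fails to have on a graded bimodule. *)
Definition falg : Type := G -> N.
HB.instance Definition _ := GRing.Lmodule.copy falg (G -> N).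

Definition fmul (f g : falg) : falg := fun t => f t ** g t.

Lemma fmulA : associative fmul.
Proof. by move=> f g h; apply: funext => t; apply: amulA. Qed.

Lemma fmul_bilinear : bilinear_op fmul.
Proof.
by split=> [f|g] c x y; apply: funext => t; [apply: (mulB N).1|apply: (mulB N).2].
Qed.

HB.instance Definition _ := Lmodule_isNUAlgebra.Build k falg fmulA fmul_bilinear.

Definition translate t (f : falg) : falg := fun g => f (g * t)%g.

Lemma translate_hom t : alg_hom (translate t).
Proof. by split=> [c f g|f g]. Qed.

Lemma translate1 f : translate 1%g f = f.
Proof. by apply: funext => g; rewrite /translate mulg1. Qed.

Lemma translateM t u f : translate t (translate u f) = translate (t * u)%g f.
Proof. by apply: funext => g; rewrite /translate mulgA. Qed.

End FunctionAlgebra.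

(** * Equivariant Morita contexts from graded ones *)

Section GlobalSkew.
Variables (k : comPzRingType) (G : groupType) (B : nuAlgType k).
Variables (beta : gaction G B) (BB : idempotent_alg B).
Local Notation theta := (ppaction_of_global BB beta).
Local Notation dl := (single theta).

Lemma dl_mul r s a b : dl r a ** dl s b = dl (r * s)%g (a ** gact beta r b).
Proof. by rewrite skew_mul_single // global_coef. Qed.

Lemma dl_lin t : linear (dl t).
Proof. by move=> c a b; apply: single_lin. Qed.

Lemma dl_at t a : dl t a t = a.
Proof. by rewrite single_at. Qed.

End GlobalSkew.

Section GradedToEquivariant.
Variables (k : comPzRingType) (G : groupType) (A B : nuAlgType k).
Variables (alpha : gaction G A) (beta : gaction G B).
Variables (AA : idempotent_alg A) (BB : idempotent_alg B).
Local Notation SA := (skew_galg (ppaction_of_global AA alpha)).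
Local Notation SB := (skew_galg (ppaction_of_global BB beta)).
Local Notation dA := (single (ppaction_of_global AA alpha)).
Local Notation dB := (single (ppaction_of_global BB beta)).

Section OrbitFunctions.
Variable M : mcontext SA SB.
Variable Xg : G -> set (mX M).
Hypothesis gX : graded_bimodule Xg.

(** The function [g |-> delta_g (a x b) delta_g^-1]. The group elements are
    only multipliers of the skew group algebras, hence do not act on [mX M];
    they act on these functions by translation. *)
Definition orbit_fun a (x : mX M) b (g : G) : mX M :=
  lact (dA g (gact alpha g a) : SA) (ract x (dB g^-1%g b : SB)).

Lemma orbit_fun_lact c a x b g :
  lact (dA 1%g (gact alpha g c) : SA) (orbit_fun a x b g) = orbit_fun (c ** a) x b g.
Proof. by rewrite /orbit_fun -lactA dl_mul mul1g gact1 (gact_hom _ _).2. Qed.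

Lemma orbit_fun_ract c a x b g :
  ract (orbit_fun a x b g) (dB 1%g (gact beta g c) : SB) = orbit_fun a x (b ** c) g.
Proof. by rewrite /orbit_fun lractA -ractA dl_mul mulg1 gactM mulVg gact1. Qed.

Lemma orbit_fun_lin_l x b g : linear (fun a => orbit_fun a x b g).
Proof.
move=> c a a'; rewrite /orbit_fun (gact_hom _ _).1 dl_lin.
by rewrite (lact_bilinear (mX M)).2.
Qed.

Lemma orbit_fun_lin_r a x g : linear (fun b => orbit_fun a x b g).
Proof.
move=> c b b'; rewrite /orbit_fun dl_lin.
by rewrite (ract_bilinear (mX M)).1 (lact_bilinear (mX M)).1.
Qed.

(** Splitting [a] and [b] into products leaves room for the extra [delta_t] and
    [delta_t^-1] in the middle factor, so that translates of orbit functions are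
    orbit functions. *)
Lemma orbit_fun_shift a1 a2 x b1 b2 g t :
  orbit_fun (a1 ** a2) x (b1 ** b2) (g * t)%g =
  orbit_fun (gact alpha t a1) (orbit_fun a2 x b1 t) (gact beta t b2) g.
Proof.
rewrite /orbit_fun lractA -lactA -ractA !dl_mul !gactM mulVg gact1.
by rewrite -invgM -gactM -(gact_hom _ _).2 gactM (gact_hom _ _).2.
Qed.

Lemma orbit_fun_degree a x b g : Xg 1%g x -> Xg 1%g (orbit_fun a x b g).
Proof.
move=> Xx; rewrite -(mulgV g) -[g^-1%g]mul1g; apply: (gbimod_lact gX).
  exact: single_comp.
apply: (gbimod_ract gX) => //; exact: single_comp.
Qed.

End OrbitFunctions.

Section OrbitPairing.
Variable M : mcontext SA SB.
Variables (Xg : G -> set (mX M)) (Yg : G -> set (mY M)).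
Hypotheses (gX : graded_bimodule Xg) (gY : graded_bimodule Yg).
Hypotheses (uX : unital_bimodule (mX M)) (uY : unital_bimodule (mY M)).
Hypothesis tA : forall r s x y, Xg r x -> Yg s y -> hcomp (g:=SA) (r * s)%g (tauA x y).

Local Notation ofX := (@orbit_fun M).

(** For [x] and [y] of degree one this is the whole pairing of [x b b'] with [y]. *)
Definition core_pairing b b' (x : mX M) (y : mY M) : A :=
  (tauA (ract x (dB 1%g (b ** b') : SB)) y : skew _) 1%g.

(** The [delta_g^-1] ending the first function cancels against the [delta_g]
    starting the second one; what remains is the orbit of an element of [A]. *)
Lemma orbit_pairing ofY a x b b' y a' g : Xg 1%g x -> Yg 1%g y ->
  ofY = lact (dB g (gact beta g b') : SB) (ract y (dA g^-1%g a' : SA)) ->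
  tauA (ofX a x b g) ofY =
    (dA 1%g (gact alpha g (a ** core_pairing b b' x y ** a')) : SA).
Proof.
move=> Xx Yy ->; rewrite /orbit_fun tauA_lact -tauA_balanced tauA_ract -ractA.
rewrite dl_mul gactM mulVg gact1 /core_pairing.
have : skew_comp 1%g (tauA (ract x (dB 1%g (b ** b') : SB)) y).
  have := tA (gbimod_ract gX Xx (single_comp (ppaction_of_global BB beta) (t := 1%g) (b ** b'))) Yy.
  by rewrite !mulg1.
move/skew_compE => {1}->.
by rewrite !dl_mul mul1g mulgV gact1 -(gact_hom alpha _).2 amulA.
Qed.

Let single_gen (t : skew (ppaction_of_global BB beta)) :
  lspan [set t | exists s b, t = dB s b] t.
Proof.
rewrite (skew_decomp t); apply: submod_sum => [|s]; first exact: lspan_submod.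
by apply: sub_lspan; exists s, (t s).
Qed.

Let spanX x : lspan [set z | exists r s x b, Xg r x /\ z = ract x (dB s b : SB)] x.
Proof.
have : [set: mX M] x by []; rewrite -uX.2; move: x.
apply: setprod_sub => [|x t _ _]; first exact: lspan_submod.
apply: (bil_span (ract_bilinear (mX M)) (lspan_submod _) _
  (ds_span (gbimod_sum gX) x) (single_gen t)) => {}x _ [r _ Xx] [s [b ->]].
by apply: sub_lspan; exists r, s, x, b.
Qed.

Let spanY y : lspan [set z | exists v u y b, Yg u y /\ z = lact (dB v b : SB) y] y.
Proof.
have : [set: mY M] y by []; rewrite -uY.1; move: y.
apply: setprod_sub => [|t y _ _]; first exact: lspan_submod.
apply: (bil_span (lact_bilinear (mY M)) (lspan_submod _) _
  (single_gen t) (ds_span (gbimod_sum gY) y)) => _ {}y [v [b ->]] [u _ Yy].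
by apply: sub_lspan; exists v, u, y, b.
Qed.

(** The degree one part of the pairing of [mX M] and [mY M] comes from the
    degree one parts of these bimodules, because the skew group algebra of a
    global action is strongly graded: in a product of degrees [r s v u = 1]
    the middle factors can be split so that [x] and [y] move to degree one. *)
Lemma core_pairing_span (Z : set A) :
  setprod (@tauA _ _ _ M) [set: mX M] [set: mY M] = [set: SA] ->
  is_submod Z ->
  (forall b b' x y, Xg 1%g x -> Yg 1%g y -> Z (core_pairing b b' x y)) ->
  forall z, Z z.
Proof.
move=> sA Zs hZ z.
pose W := [set f : skew (ppaction_of_global AA alpha) | Z (f 1%g)].
have Ws : is_submod W by exact: (submod_preim (@skew_eval_lin _ _ _ _ 1%g) Zs).
suff h : W (dA 1%g z) by have : Z (dA 1%g z 1%g) := h; rewrite dl_at.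
have : [set: SA] (dA 1%g z) by []; rewrite -sA; move: (dA 1%g z).
apply: setprod_sub => // x y _ _.
apply: (bil_span (tauA_bilinear M) Ws _ (spanX x) (spanY y)).
move=> _ _ [r [s [{}x [b [Xx ->]]]]] [v [u [{}y [b' [Yy ->]]]]].
have [rsvu|rsvu] := eqVneq (r * s * (v * u))%g 1%g; last first.
  have h : skew_comp (r * s * (v * u))%g
      (tauA (ract x (dB s b : SB)) (lact (dB v b' : SB) y)).
    apply: tA; first by apply: (gbimod_ract gX) => //; exact: single_comp.
    by apply: (gbimod_lact gY) => //; exact: single_comp.
  by rewrite /W /= h; [exact: submod0|move=> e; rewrite -e eqxx in rsvu].
move: (idem_dec BB b); move: b; apply: setprod_sub => [|e f _ _].
  apply: (submod_preim (f := fun b => tauA (ract x (dB s b : SB)) (lact (dB v b' : SB) y))) Ws => c b1 b2.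
  by rewrite dl_lin (ract_bilinear (mX M)).1 (tauA_bilinear M).2.
move: (idem_dec BB b'); move: b'; apply: setprod_sub => [|f' e' _ _].
  apply: (submod_preim (f := fun b' => tauA (ract x (dB s (e ** f) : SB)) (lact (dB v b' : SB) y))) Ws => c b1 b2.
  by rewrite dl_lin (lact_bilinear (mY M)).2 (tauA_bilinear M).1.
have -> : dB s (e ** f) = dB r^-1%g e ** dB (r * s)%g (gact beta r f).
  by rewrite dl_mul mulKg gactM mulVg gact1.
have -> : dB v (f' ** e') = dB (v * u)%g f' ** dB u^-1%g (gact beta (v * u)^-1%g e').
  by rewrite dl_mul mulgK gactM mulgV gact1.
rewrite /W /= ractA lactA -tauA_balanced -ractA dl_mul rsvu.
apply: hZ.
  rewrite -(mulgV r); apply: (gbimod_ract gX) => //; exact: single_comp.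
rewrite -(mulVg u); apply: (gbimod_lact gY) => //; exact: single_comp.
Qed.

End OrbitPairing.

End GradedToEquivariant.

Section OrbitContext.
Variables (k : comPzRingType) (G : groupType) (A B : nuAlgType k).
Variables (alpha : gaction G A) (beta : gaction G B).
Variables (AA : idempotent_alg A) (BB : idempotent_alg B).
Local Notation SA := (skew_galg (ppaction_of_global AA alpha)).
Local Notation SB := (skew_galg (ppaction_of_global BB beta)).
Local Notation dA := (single (ppaction_of_global AA alpha)).
Local Notation dB := (single (ppaction_of_global BB beta)).
Variable M : mcontext SA SB.
Variables (Xg : G -> set (mX M)) (Yg : G -> set (mY M)).
Hypotheses (gX : graded_bimodule Xg) (gY : graded_bimodule Yg).
Hypotheses (uX : unital_bimodule (mX M)) (uY : unital_bimodule (mY M)).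
Hypothesis tA : forall r s x y, Xg r x -> Yg s y -> hcomp (g:=SA) (r * s)%g (tauA x y).
Hypothesis tB : forall r s y x, Yg r y -> Xg s x -> hcomp (g:=SB) (r * s)%g (tauB y x).
Hypothesis sM : tau_surjective M.

Local Notation M' := (mflip M).
Local Notation N := (falg G (ctx M)).

Definition orbitA (c : A) : N := fun g => cornerA M (dA 1%g (gact alpha g c) : SA).
Definition orbitB (c : B) : N := fun g => cornerB M (dB 1%g (gact beta g c) : SB).
Definition orbitX a x b : N := fun g => cornerX (orbit_fun (M := M) a x b g).
Definition orbitY b y a : N := fun g => cornerY (orbit_fun (M := M') b y a g : mY M).

Lemma orbitA_hom : alg_hom orbitA.
Proof.
split=> [c a b|a b]; apply: funext => g.
  by rewrite /orbitA (gact_hom _ _).1 dl_lin (cornerA_hom M).1.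
rewrite /orbitA (gact_hom _ _).2 -[RHS]/(orbitA a g ** orbitA b g) /orbitA -(cornerA_hom M).2.
by rewrite dl_mul mul1g gact1.
Qed.

Lemma orbitB_hom : alg_hom orbitB.
Proof.
split=> [c a b|a b]; apply: funext => g.
  by rewrite /orbitB (gact_hom _ _).1 dl_lin (cornerB_hom M).1.
rewrite /orbitB (gact_hom _ _).2 -[RHS]/(orbitB a g ** orbitB b g) /orbitB -(cornerB_hom M).2.
by rewrite dl_mul mul1g gact1.
Qed.

Lemma orbitA_inj : injective orbitA.
Proof.
move=> a b /(congr1 (fun f : N => f 1%g)) /cornerA_inj; rewrite !gact1.
by move=> /(congr1 (fun f : skew _ => skew_val f 1%g)); rewrite !dl_at.
Qed.

Lemma orbitB_inj : injective orbitB.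
Proof.
move=> a b /(congr1 (fun f : N => f 1%g)) /cornerB_inj; rewrite !gact1.
by move=> /(congr1 (fun f : skew _ => skew_val f 1%g)); rewrite !dl_at.
Qed.

Lemma orbitX_lin_l x b : linear (fun a => orbitX a x b).
Proof. by move=> c a a'; apply: funext => g; rewrite /orbitX orbit_fun_lin_l cornerX_lin. Qed.
Lemma orbitX_lin_r a x : linear (orbitX a x).
Proof. by move=> c b b'; apply: funext => g; rewrite /orbitX orbit_fun_lin_r cornerX_lin. Qed.
Lemma orbitY_lin_l y a : linear (fun b => orbitY b y a).
Proof. by move=> c b b'; apply: funext => g; rewrite /orbitY orbit_fun_lin_l cornerY_lin. Qed.
Lemma orbitY_lin_r b y : linear (orbitY b y).
Proof. by move=> c a a'; apply: funext => g; rewrite /orbitY orbit_fun_lin_r cornerY_lin. Qed.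

Lemma orbitAX c a x b : orbitA c ** orbitX a x b = orbitX (c ** a) x b.
Proof. by apply: funext => g; rewrite /orbitX -orbit_fun_lact -cornerAX. Qed.
Lemma orbitXB c a x b : orbitX a x b ** orbitB c = orbitX a x (b ** c).
Proof. by apply: funext => g; rewrite /orbitX -orbit_fun_ract -cornerXB. Qed.
Lemma orbitBY c b y a : orbitB c ** orbitY b y a = orbitY (c ** b) y a.
Proof. by apply: funext => g; rewrite /orbitY -orbit_fun_lact -cornerBY. Qed.
Lemma orbitYA c b y a : orbitY b y a ** orbitA c = orbitY b y (a ** c).
Proof. by apply: funext => g; rewrite /orbitY -orbit_fun_ract -cornerYA. Qed.

Lemma orbitXY a x b b' y a' : Xg 1%g x -> Yg 1%g y ->
  orbitX a x b ** orbitY b' y a' = orbitA (a ** core_pairing (M := M) b b' x y ** a').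
Proof.
move=> Xx Yy; apply: funext => g.
by rewrite /orbitA -(orbit_pairing gX tA a b Xx Yy (erefl (orbit_fun (M := M') b' y a' g))) -cornerXY.
Qed.

Lemma orbitYX b y a a' x b' : Xg 1%g x -> Yg 1%g y ->
  orbitY b y a ** orbitX a' x b' = orbitB (b ** core_pairing (M := M') a a' y x ** b').
Proof.
move=> Xx Yy; apply: funext => g.
by rewrite /orbitB -(orbit_pairing (M := M') gY tB b a Yy Xx (erefl (orbit_fun (M := M) a' x b' g))) -cornerYX.
Qed.

Definition orbitU : set N := lspan [set F | exists a x b, Xg 1%g x /\ F = orbitX a x b].
Definition orbitV : set N := lspan [set F | exists b y a, Yg 1%g y /\ F = orbitY b y a].

Lemma orbitX_in a x b : Xg 1%g x -> orbitU (orbitX a x b).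
Proof. by move=> Xx; apply: sub_lspan; exists a, x, b. Qed.
Lemma orbitY_in b y a : Yg 1%g y -> orbitV (orbitY b y a).
Proof. by move=> Yy; apply: sub_lspan; exists b, y, a. Qed.

Lemma orbit_embedded : embedded orbitA orbitB orbitU orbitV.
Proof.
split.
- exact: orbitA_hom.
- exact: orbitA_inj.
- exact: orbitB_hom.
- exact: orbitB_inj.
- exact: lspan_submod.
- exact: lspan_submod.
- move=> c; apply: lspan_sub; first exact: (submod_preim ((mulB N).1 _) (lspan_submod _)).
  by move=> _ [a [x [b [Xx ->]]]]; rewrite /preimage /= orbitAX; apply: orbitX_in.
- move=> u c; move: u; apply: lspan_sub; first exact: (submod_preim ((mulB N).2 _) (lspan_submod _)).
  by move=> _ [a [x [b [Xx ->]]]]; rewrite /preimage /= orbitXB; apply: orbitX_in.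
- move=> c; apply: lspan_sub; first exact: (submod_preim ((mulB N).1 _) (lspan_submod _)).
  by move=> _ [a [x [b [Xx ->]]]]; rewrite /preimage /= orbitBY; apply: orbitY_in.
- move=> u c; move: u; apply: lspan_sub; first exact: (submod_preim ((mulB N).2 _) (lspan_submod _)).
  by move=> _ [a [x [b [Xx ->]]]]; rewrite /preimage /= orbitYA; apply: orbitY_in.
- apply: (bil_span (mulB N)); first exact: submod_image orbitA_hom.1 (@submodT _ _).
  move=> _ _ [a [x [b [Xx ->]]]] [b' [y [a' [Yy ->]]]].
  by rewrite orbitXY //; eexists.
- apply: (bil_span (mulB N)); first exact: submod_image orbitB_hom.1 (@submodT _ _).
  move=> _ _ [b' [y [a' [Yy ->]]]] [a [x [b [Xx ->]]]].
  by rewrite orbitYX //; eexists.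
Qed.

Lemma orbitU_l : (orbitU `<=` range orbitA ** orbitU)%classic.
Proof.
apply: lspan_sub; first exact: lspan_submod.
move=> _ [a [x [b [Xx ->]]]]; move: (idem_dec AA a); move: a.
apply: setprod_sub => [|a a' _ _]; first exact: (submod_preim (orbitX_lin_l x b) (lspan_submod _)).
by rewrite /preimage /= -orbitAX; apply: in_setprod; [exists a|exact: orbitX_in].
Qed.

Lemma orbitU_r : (orbitU `<=` orbitU ** range orbitB)%classic.
Proof.
apply: lspan_sub; first exact: lspan_submod.
move=> _ [a [x [b [Xx ->]]]]; move: (idem_dec BB b); move: b.
apply: setprod_sub => [|b b' _ _]; first exact: (submod_preim (orbitX_lin_r a x) (lspan_submod _)).
by rewrite /preimage /= -orbitXB; apply: in_setprod; [exact: orbitX_in|exists b'].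
Qed.

Lemma orbitV_l : (orbitV `<=` range orbitB ** orbitV)%classic.
Proof.
apply: lspan_sub; first exact: lspan_submod.
move=> _ [a [x [b [Xx ->]]]]; move: (idem_dec BB a); move: a.
apply: setprod_sub => [|a a' _ _]; first exact: (submod_preim (orbitY_lin_l x b) (lspan_submod _)).
by rewrite /preimage /= -orbitBY; apply: in_setprod; [exists a|exact: orbitY_in].
Qed.

Lemma orbitV_r : (orbitV `<=` orbitV ** range orbitA)%classic.
Proof.
apply: lspan_sub; first exact: lspan_submod.
move=> _ [a [x [b [Xx ->]]]]; move: (idem_dec AA b); move: b.
apply: setprod_sub => [|b b' _ _]; first exact: (submod_preim (orbitY_lin_r a x) (lspan_submod _)).
by rewrite /preimage /= -orbitYA; apply: in_setprod; [exact: orbitY_in|exists b'].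
Qed.

Lemma orbitA_dec : (range orbitA `<=` orbitU ** orbitV)%classic.
Proof.
have UVs := lspan_submod [set u ** v | u in orbitU & v in orbitV].
move=> _ [c _ <-]; move: (idem_dec AA c); move: c.
apply: setprod_sub => [|a c _ _]; first exact: (submod_preim orbitA_hom.1 UVs).
move: (idem_dec AA c); move: c; apply: setprod_sub => [|c a' _ _].
  apply: (submod_preim (f := fun c => orbitA (a ** c))) UVs => e c c'.
  by rewrite (mulB A).1 orbitA_hom.1.
apply: (core_pairing_span gX gY uX uY tA (Z := [set c | (orbitU ** orbitV)%classic (orbitA (a ** (c ** a')))])).
- exact: sM.1.
- apply: (submod_preim (f := fun c => orbitA (a ** (c ** a')))) UVs => e c1 c2.
  by rewrite (mulB A).2 (mulB A).1 orbitA_hom.1.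
- move=> b b' x y Xx Yy; rewrite /= amulA -orbitXY //.
  by apply: in_setprod; [exact: orbitX_in|exact: orbitY_in].
Qed.

Lemma orbitB_dec : (range orbitB `<=` orbitV ** orbitU)%classic.
Proof.
have UVs := lspan_submod [set u ** v | u in orbitV & v in orbitU].
move=> _ [c _ <-]; move: (idem_dec BB c); move: c.
apply: setprod_sub => [|a c _ _]; first exact: (submod_preim orbitB_hom.1 UVs).
move: (idem_dec BB c); move: c; apply: setprod_sub => [|c a' _ _].
  apply: (submod_preim (f := fun c => orbitB (a ** c))) UVs => e c c'.
  by rewrite (mulB B).1 orbitB_hom.1.
apply: (core_pairing_span (M := M') gY gX uY uX tB (Z := [set c | (orbitV ** orbitU)%classic (orbitB (a ** (c ** a')))])).
- exact: sM.2.
- apply: (submod_preim (f := fun c => orbitB (a ** (c ** a')))) UVs => e c1 c2.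
  by rewrite (mulB B).2 (mulB B).1 orbitB_hom.1.
- move=> b b' x y Xx Yy; rewrite /= amulA -orbitYX //.
  by apply: in_setprod; [exact: orbitY_in|exact: orbitX_in].
Qed.

Lemma orbitU_translate t u : orbitU u -> orbitU (translate t u).
Proof.
move: u; apply: lspan_sub.
  apply: (submod_preim (f := translate t)) (lspan_submod _) => c f g.
  exact: (translate_hom (ctx M) t).1.
move=> _ [a [x [b [Xx ->]]]]; rewrite /preimage /=.
move: (idem_dec AA a); move: a; apply: setprod_sub => [|a1 a2 _ _].
  apply: (submod_preim (f := fun a => translate t (orbitX a x b))) (lspan_submod _) => c a a'.
  by rewrite orbitX_lin_l (translate_hom (ctx M) t).1.
move: (idem_dec BB b); move: b; apply: setprod_sub => [|b1 b2 _ _].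
  apply: (submod_preim (f := fun b => translate t (orbitX (a1 ** a2) x b))) (lspan_submod _) => c a a'.
  by rewrite orbitX_lin_r (translate_hom (ctx M) t).1.
rewrite /preimage /=.
have -> : translate t (orbitX (a1 ** a2) x (b1 ** b2)) =
    orbitX (gact alpha t a1) (orbit_fun a2 x b1 t) (gact beta t b2).
  by apply: funext => g; rewrite /translate /orbitX orbit_fun_shift.
by apply: orbitX_in; apply: orbit_fun_degree.
Qed.

Lemma orbitV_translate t u : orbitV u -> orbitV (translate t u).
Proof.
move: u; apply: lspan_sub.
  apply: (submod_preim (f := translate t)) (lspan_submod _) => c f g.
  exact: (translate_hom (ctx M) t).1.
move=> _ [a [x [b [Xx ->]]]]; rewrite /preimage /=.
move: (idem_dec BB a); move: a; apply: setprod_sub => [|a1 a2 _ _].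
  apply: (submod_preim (f := fun a => translate t (orbitY a x b))) (lspan_submod _) => c a a'.
  by rewrite orbitY_lin_l (translate_hom (ctx M) t).1.
move: (idem_dec AA b); move: b; apply: setprod_sub => [|b1 b2 _ _].
  apply: (submod_preim (f := fun b => translate t (orbitY (a1 ** a2) x b))) (lspan_submod _) => c a a'.
  by rewrite orbitY_lin_r (translate_hom (ctx M) t).1.
rewrite /preimage /=.
have -> : translate t (orbitY (a1 ** a2) x (b1 ** b2)) =
    orbitY (gact beta t a1) (orbit_fun (M := M') a2 x b1 t) (gact alpha t b2).
  by apply: funext => g; rewrite /translate /orbitY orbit_fun_shift.
by apply: orbitY_in; apply: (orbit_fun_degree (M := M') gY).
Qed.

Lemma orbit_morita_equiv :
  morita_equiv (ppaction_of_global AA alpha) (ppaction_of_global BB beta).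
Proof.
have ME := embedded_morita orbit_embedded AA BB orbitU_l orbitU_r orbitV_l orbitV_r orbitA_dec orbitB_dec.
apply: (equivariant_morita (@translate_hom k G (ctx M)) (@translate1 _ _ _)
  (@translateM _ _ _) orbitU_translate orbitV_translate _ _ AA BB ME) => t c.
  by apply: funext => g; rewrite /translate /orbitA gactM.
by apply: funext => g; rewrite /translate /orbitB gactM.
Qed.

End OrbitContext.

Lemma global_graded_equiv_morita_equiv (k : comPzRingType) (G : groupType)
    (A B : nuAlgType k) (alpha : gaction G A) (beta : gaction G B)
    (AA : idempotent_alg A) (BB : idempotent_alg B) :
  graded_equiv (skew_galg (ppaction_of_global AA alpha))
    (skew_galg (ppaction_of_global BB beta)) ->
  morita_equiv (ppaction_of_global AA alpha) (ppaction_of_global BB beta).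
Proof.
case=> _ _ [M [Xg [Yg [[uX uY] [gX gY] tA tB sM]]]].
exact: orbit_morita_equiv gX gY uX uY tA tB sM.
Qed.

(** * Products of domains, and finitely supported matrices *)

Section DomainLists.
Variables (k : comPzRingType) (G : groupType) (A : nuAlgType k).
Variable alpha : ppaction G A.
Local Notation D := (dom alpha).

(** The product of the ideals [D t] for [t] in [l]. As these ideals commute
    and are idempotent, it depends only on the set of entries of [l], and
    concatenation of lists is multiplication of ideals. *)
Definition doml (l : seq G) : set A := foldr (fun t P => (D t ** P)%classic) [set: A] l.

Lemma domT_idem : ([set: A] ** [set: A])%classic = [set: A].
Proof. by rewrite -(dom1 alpha) dom_idem. Qed.

Lemma domTl t : ([set: A] ** D t)%classic = D t.
Proof.
apply/seteqP; split.
  by apply: setprod_sub => [|u v _ Dv]; [exact: dom_submod|exact: dom_lmul].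
by rewrite -{1}dom_idem; apply: setprod_mono.
Qed.

Lemma domTr t : (D t ** [set: A])%classic = D t.
Proof.
apply/seteqP; split.
  by apply: setprod_sub => [|u v Dv _]; [exact: dom_submod|exact: dom_rmul].
by rewrite -{1}dom_idem; apply: setprod_mono.
Qed.

Lemma domlT l : ([set: A] ** doml l)%classic = doml l.
Proof. by case: l => [|t l] /=; [exact: domT_idem|rewrite -setprodA domTl]. Qed.

Lemma domlM l m : (doml l ** doml m)%classic = doml (l ++ m).
Proof. by elim: l => [|t l IH] /=; [exact: domlT|rewrite setprodA IH]. Qed.

Lemma domlS l m : {subset l <= m} -> doml m `<=` doml l.
Proof.
move=> lm; have absorb t n : t \in n -> (D t ** doml n)%classic = doml n.
  elim: n => //= s n IH; rewrite in_cons => /orP[/eqP ->|/IH e].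
    by rewrite -setprodA dom_idem.
  by rewrite -setprodA dom_comm setprodA e.
have -> : doml m = (doml l ** doml m)%classic.
  elim: l lm => [|t l IH] lm /=; first by rewrite domlT.
  rewrite setprodA -IH; first by rewrite absorb // lm // mem_head.
  by move=> x xl; apply: lm; rewrite in_cons xl orbT.
have li n : is_ideal (doml n).
  by elim: n => [|s n IH] /=; [exact: idealT|exact: ideal_prod (dom_ideal _ _) IH].
apply: setprod_sub; first by case: (li l).
by move=> x y hx _; apply: ideal_mulr.
Qed.

Lemma domlE l m : l =i m -> doml l = doml m.
Proof. by move=> lm; apply/seteqP; split; apply: domlS => x; rewrite lm. Qed.

Lemma doml_ideal l : is_ideal (doml l).
Proof. by elim: l => [|s n IH] /=; [exact: idealT|exact: ideal_prod (dom_ideal _ _) IH]. Qed.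

Lemma doml_submod l : is_submod (doml l).
Proof. by case: (doml_ideal l). Qed.

Lemma doml_mul l m x y : doml l x -> doml m y -> doml (l ++ m) (x ** y).
Proof. by move=> lx my; rewrite -domlM; apply: in_setprod. Qed.

Lemma doml1 t : doml [:: t] = D t.
Proof. by rewrite /= domTr. Qed.

Lemma doml_unit l : doml (1%g :: l) = doml l.
Proof. by rewrite /= dom1 domlT. Qed.

Lemma doml_dom t l : t \in l -> doml l `<=` D t.
Proof. by move=> tl; rewrite -doml1; apply: domlS => x; rewrite inE => /eqP ->. Qed.

Lemma act_setprod s (P Q : set A) : P `<=` D s^-1%g -> Q `<=` D s^-1%g ->
  (act alpha s @` (P ** Q) = (act alpha s @` P) ** (act alpha s @` Q))%classic.
Proof.
move=> PD QD; have PQD : (P ** Q)%classic `<=` D s^-1%g.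
  by apply: setprod_sub => [|u v /PD Du _]; [exact: dom_submod|exact: dom_rmul].
have /is_submodP[s0 sD] := dom_submod alpha s^-1%g.
apply/seteqP; split.
  move=> _ [x PQx <-].
  suff [] : [set x | D s^-1%g x /\ ((act alpha s @` P) ** (act alpha s @` Q))%classic
    (act alpha s x)] x by [].
  move: x PQx; apply: setprod_sub => [|u v Pu Qv].
    have /is_submodP[t0 tD] := lspan_submod
      [set u ** v | u in act alpha s @` P & v in act alpha s @` Q].
    apply/is_submodP; split=> [|c u v [Du hu] [Dv hv]]; first by rewrite /= act0.
    by split; [exact: sD|rewrite act_lin //; exact: tD].
  split; first exact/dom_rmul/PD.
  rewrite act_mul; [|exact: PD|exact: QD].
  by apply: in_setprod; [exists u|exists v].
apply: setprod_sub => [|_ _ [u Pu <-] [v Qv <-]].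
  have /is_submodP[t0 tD] := lspan_submod [set u ** v | u in P & v in Q].
  apply/is_submodP; split=> [|c _ _ [u PQu <-] [v PQv <-]].
    by exists 0; [exact: t0|rewrite act0].
  by exists (c *: u + v); [exact: tD|rewrite act_lin //; exact: PQD].
exists (u ** v); first exact: in_setprod.
by rewrite act_mul; [|exact: PD|exact: QD].
Qed.

(** [act s] is multiplicative on [D s^-1] and maps each [D s^-1 ** D t] onto
    [D s ** D (s * t)]. *)
Lemma act_doml s l :
  act alpha s @` doml (s^-1%g :: l) = doml (s :: map (fun t => s * t)%g l).
Proof.
elim: l => [|t l IH].
  rewrite !doml1; case: (act_isom alpha s) => -[h1 _ h2] _ _.
  by apply/seteqP; split=> [_ [x Dx <-]|x Dx]; [exact: h1|exact: h2].
have -> : doml [:: s^-1%g, t & l] = (doml [:: s^-1%g; t] ** doml (s^-1%g :: l))%classic.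
  by rewrite domlM; apply: domlE => x; rewrite !inE; do ?case: eqP.
rewrite act_setprod ?IH; last first.
- exact/doml_dom/mem_head.
- exact/doml_dom/mem_head.
have -> : act alpha s @` doml [:: s^-1%g; t] = doml [:: s; (s * t)%g].
  by rewrite /= !domTr act_dom.
by rewrite domlM; apply: domlE => x; rewrite !inE; do ?case: eqP.
Qed.

Lemma act_doml_in s l x : doml (s^-1%g :: l) x ->
  doml (s :: map (fun t => s * t)%g l) (act alpha s x).
Proof. by move=> hx; rewrite -act_doml; exists x. Qed.

End DomainLists.

Section FiniteMatrices.
Variables (k : comPzRingType) (R : nuAlgType k) (L : choiceType).

Record mxfam := MxFam {
  mxf :> L -> L -> set R;
  mxf_sub : forall p q, is_submod (mxf p q);
  mxf_mul : forall p q s x y, mxf p q x -> mxf q s y -> mxf p s (x ** y)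
}.

Variable F : mxfam.

Definition fmat_pred : {pred L * L -> R} :=
  fun f => `[< (forall p q, F p q (f (p, q))) /\ finite_set (f @^-1` [set~ 0]) >].

Lemma fmat_pred_closed : submod_closed fmat_pred.
Proof.
split=> [|c f g /asboolP[Ff ff] /asboolP[Fg gf]]; apply/asboolP; split.
- by move=> p q; apply: submod0 (mxf_sub F _ _).
- by rewrite (_ : _ @^-1` _ = set0) // -subset0 => t; apply.
- by move=> p q; case/is_submodP: (mxf_sub F p q) => _; apply.
- apply: (@sub_finite_set _ _ (f @^-1` [set~ 0] `|` g @^-1` [set~ 0])).
    move=> t /= h; apply/not_andP => -[f0 g0]; apply: h.
    by rewrite /GRing.add /= /GRing.scale /= f0 g0 scaler0 addr0.
  by rewrite finite_setU.
Qed.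

HB.instance Definition _ :=
  GRing.isSubmodClosed.Build k (L * L -> R) fmat_pred
    (GRing.submod_closed_semi fmat_pred_closed).

Record fmat := FMat {fmat_val :> L * L -> R; _ : fmat_val \in fmat_pred}.

HB.instance Definition _ := [isSub for fmat_val].
HB.instance Definition _ := [Choice of fmat by <:].
HB.instance Definition _ := [SubChoice_isSubLmodule of fmat by <:].

Implicit Types (f g h : fmat).

Lemma fmatP f g : (forall p q, f (p, q) = g (p, q)) -> f = g.
Proof. by move=> fg; apply/val_inj/funext => -[p q]; apply: fg. Qed.

Lemma fmat_in f p q : F p q (f (p, q)).
Proof. by case: f => f /= /asboolP[]. Qed.

Lemma fmat_finite f : finite_set (f @^-1` [set~ 0]).
Proof. by case: f => f /= /asboolP[]. Qed.

Definition fmat_supp f : {fset L} :=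
  fset_set (fst @` (f @^-1` [set~ 0]) `|` snd @` (f @^-1` [set~ 0])).

Lemma fmat_suppP f p q : ~~ ((p \in fmat_supp f) && (q \in fmat_supp f)) ->
  f (p, q) = 0.
Proof.
have fin : finite_set (fst @` (f @^-1` [set~ 0]) `|` snd @` (f @^-1` [set~ 0])).
  by rewrite finite_setU; split; apply: finite_image; apply: fmat_finite.
apply: contraNeq => /eqP fpq; rewrite !in_fset_set //.
by apply/andP; split; apply/mem_set; [left|right]; exists (p, q).
Qed.

Lemma fmat_suppl f p q : p \notin fmat_supp f -> f (p, q) = 0.
Proof. by move=> h; apply: fmat_suppP; rewrite negb_and h. Qed.

Lemma fmat_suppr f p q : q \notin fmat_supp f -> f (p, q) = 0.
Proof. by move=> h; apply: fmat_suppP; rewrite negb_and h orbT. Qed.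

Definition fmat_mul_fun (f g : L * L -> R) : L * L -> R :=
  fun z => \sum_(q \in [set: L]) f (z.1, q) ** g (q, z.2).

Lemma fmat_mul_closed f g : fmat_mul_fun f g \in fmat_pred.
Proof.
apply/asboolP; split=> [p q|].
  apply: submod_sum => [|r]; first exact: mxf_sub.
  by apply: (mxf_mul (q := r)); apply: fmat_in.
apply: (@sub_finite_set _ _ [set` (fmat_supp f `*` fmat_supp g)%fset]); last exact: finite_fset.
move=> [p q] /=; apply: contra_notT; rewrite in_fsetM /= negb_and => h.
apply: fsbig1 => r _; case/orP: h => h.
  by rewrite fmat_suppl // amul0l.
by rewrite [X in _ ** X]fmat_suppr // amul0r.
Qed.

Definition fmat_mul f g : fmat := FMat (fmat_mul_closed f g).

Lemma fmat_mulE f g p s (S : {fset L}) :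
  (forall q, q \notin S -> f (p, q) ** g (q, s) = 0) ->
  fmat_mul f g (p, s) = \sum_(q <- S) f (p, q) ** g (q, s).
Proof. by move=> h; apply: fsbigTE. Qed.

Lemma fmat_mulEl f g p s :
  fmat_mul f g (p, s) = \sum_(q <- fmat_supp f) f (p, q) ** g (q, s).
Proof. by apply: fmat_mulE => q h; rewrite fmat_suppr // amul0l. Qed.

Lemma fmat_mulEr f g p s :
  fmat_mul f g (p, s) = \sum_(q <- fmat_supp g) f (p, q) ** g (q, s).
Proof. by apply: fmat_mulE => q h; rewrite (fmat_suppl (f := g)) // amul0r. Qed.

Lemma fmat_mulA : associative fmat_mul.
Proof.
move=> f g h; apply: fmatP => p s; rewrite fmat_mulEl.
rewrite (fmat_mulE (S := fmat_supp g)) => [|r rg]; last first.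
  by rewrite fmat_mulEl big1 ?amul0l // => q _; rewrite (fmat_suppr (f := g)) // amul0r.
under eq_bigr => q _ do rewrite (fmat_mulEl g) (bil_sumr (mulB R)).
rewrite exchange_big /=; apply: eq_bigr => r _.
rewrite [X in X ** _]fmat_mulEl (bil_suml (mulB R)).
by apply: eq_bigr => q _; rewrite amulA.
Qed.

Lemma fmat_mul_bilinear : bilinear_op fmat_mul.
Proof.
split=> [f|h] c g g'; apply: fmatP => p s.
  rewrite [RHS](_ : _ = c *: fmat_mul f g (p, s) + fmat_mul f g' (p, s)) //.
  rewrite !fmat_mulEl scaler_sumr -big_split; apply: eq_bigr => q _.
  exact: (mulB R).1.
rewrite [RHS](_ : _ = c *: fmat_mul g h (p, s) + fmat_mul g' h (p, s)) //.
rewrite !fmat_mulEr scaler_sumr -big_split; apply: eq_bigr => q _.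
exact: (mulB R).2.
Qed.

HB.instance Definition _ :=
  Lmodule_isNUAlgebra.Build k fmat fmat_mulA fmat_mul_bilinear.

Lemma fmat_prodE f g p s (S : {fset L}) :
  (forall q, q \notin S -> f (p, q) ** g (q, s) = 0) ->
  (f ** g) (p, s) = \sum_(q <- S) f (p, q) ** g (q, s).
Proof. exact: fmat_mulE. Qed.

Lemma fmat_prodT f g p s :
  (f ** g) (p, s) = \sum_(q \in [set: L]) f (p, q) ** g (q, s).
Proof. by []. Qed.

Lemma fmat_eval_lin z : linear (fun f : fmat => f z).
Proof. by []. Qed.

Lemma fmat_sumE (I : Type) (r : seq I) (H : I -> fmat) z :
  (\sum_(i <- r) H i) z = \sum_(i <- r) H i z.
Proof. exact: lin_sum (fmat_eval_lin z). Qed.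

(** The value [0] on functions outside the family makes the constructor total. *)
Definition mkfmat (h : L * L -> R) : fmat := insubd 0 h.

Lemma mkfmatE (h : L * L -> R) z : h \in fmat_pred -> mkfmat h z = h z.
Proof. by move=> hP; rewrite /mkfmat (insubdK (0 : fmat) hP). Qed.

Definition elem p q a : fmat := mkfmat (fun z => if z == (p, q) then a else 0).

Lemma elemE p q a z : F p q a -> elem p q a z = if z == (p, q) then a else 0.
Proof.
move=> Fa; rewrite mkfmatE //; apply/asboolP; split=> [p' q'|].
  by case: eqP => [[-> ->]|_] //; apply: submod0 (mxf_sub F _ _).
apply: (@sub_finite_set _ _ [set (p, q)]); last exact: finite_set1.
by move=> z' /=; case: eqP.
Qed.

Lemma elem_lin p q c a b : F p q a -> F p q b ->
  elem p q (c *: a + b) = c *: elem p q a + elem p q b.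
Proof.
move=> Fa Fb; have Fab : F p q (c *: a + b).
  by case/is_submodP: (mxf_sub F p q) => _; apply.
apply: fmatP => p' q'.
rewrite [RHS](_ : _ = c *: elem p q a (p', q') + elem p q b (p', q')) //.
by rewrite !elemE //; case: eqP; rewrite ?scaler0 ?addr0.
Qed.

Lemma elem0 p q : elem p q 0 = 0.
Proof.
apply: fmatP => p' q'; rewrite elemE ?if_same //; exact: submod0 (mxf_sub F _ _).
Qed.

Lemma elem_mul p q s a b : F p q a -> F q s b ->
  elem p q a ** elem q s b = elem p s (a ** b).
Proof.
move=> Fa Fb; have Fab := mxf_mul Fa Fb.
apply: fmatP => p' s'; rewrite (fmat_prodE (S := [fset q]%fset)) => [|r rq].
  rewrite big_seq_fset1 !elemE // !xpair_eqE !eqxx andbT /=.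
  by case: eqP => //= _; [case: eqP; rewrite ?amul0r|rewrite amul0l].
rewrite in_fset1 in rq; rewrite elemE // xpair_eqE (negPf rq) andbF.
exact: amul0l.
Qed.

Lemma fmat_decomp f : f =
  \sum_(p <- fmat_supp f) \sum_(q <- fmat_supp f) elem p q (f (p, q)).
Proof.
set S := fmat_supp f; apply: fmatP => p q; rewrite fmat_sumE.
have E p' : (\sum_(q' <- S) elem p' q' (f (p', q'))) (p, q)
    = if p == p' then f (p, q) else 0.
  rewrite fmat_sumE; have [<-|pp'] := eqVneq p p'; last first.
    by rewrite big1 // => q' _; rewrite (elemE _ (fmat_in _ _ _)) xpair_eqE (negPf pp').
  have [qS|qS] := boolP (q \in S); last first.
    rewrite fmat_suppr // big1 // => q' _; rewrite (elemE _ (fmat_in _ _ _)).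
    by case: eqP => // -[<-]; rewrite fmat_suppr.
  rewrite (big_fsetD1 q) // (elemE _ (fmat_in _ _ _)) eqxx big_seq big1 => [|q']; first exact: addr0.
  rewrite in_fsetD1 => /andP[q'q _]; rewrite (elemE _ (fmat_in _ _ _)) xpair_eqE.
  by rewrite [q == _]eq_sym (negPf q'q) andbF.
under eq_bigr do rewrite E.
have [pS|pS] := boolP (p \in S); last first.
  by rewrite fmat_suppl // big1 // => p' _; rewrite if_same.
rewrite (big_fsetD1 p) // eqxx big_seq big1 => [|p']; first exact/esym/addr0.
by rewrite in_fsetD1 [p == _]eq_sym => /andP[/negPf ->].
Qed.

Lemma fmat_ind (Z : set fmat) f : is_submod Z ->
  (forall p q, Z (elem p q (f (p, q)))) -> Z f.
Proof.
move=> Zs h; rewrite (fmat_decomp f); apply: submod_sum => // p.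
exact: submod_sum.
Qed.

Lemma elem_span p q (P : set R) (Z : set fmat) : is_submod Z -> P `<=` F p q ->
  (forall a, P a -> Z (elem p q a)) -> forall a, lspan P a -> Z (elem p q a).
Proof.
move=> Zs PF h; pose Q := [set a | F p q a /\ Z (elem p q a)].
have Qs : is_submod Q.
  apply/is_submodP; split; first by rewrite /Q /= elem0; split; apply: submod0 => //; apply: mxf_sub.
  move=> c u v [Du Pu] [Dv Pv]; split.
    by case/is_submodP: (mxf_sub F p q) => _; apply.
  by rewrite elem_lin //; case/is_submodP: Zs => _; apply.
have PQ : P `<=` Q by move=> a Pa; split; [apply: PF|apply: h].
by move=> a /(lspan_sub Qs PQ)[].
Qed.

Definition fsub (H : L -> L -> set R) : set fmat := [set f | forall p q, H p q (f (p, q))].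

Lemma fsub_submod H : (forall p q, is_submod (H p q)) -> is_submod (fsub H).
Proof.
move=> Hs; apply/is_submodP; split=> [p q|c f g hf hg p q]; first exact: submod0.
by case/is_submodP: (Hs p q) => _; apply; [exact: hf|exact: hg].
Qed.

Lemma fsub_mul H H' H'' f g : (forall p q, is_submod (H'' p q)) ->
  (forall p q s x y, H p q x -> H' q s y -> H'' p s (x ** y)) ->
  fsub H f -> fsub H' g -> fsub H'' (f ** g).
Proof.
move=> Hs HM hf hg p s; rewrite fmat_prodT; apply: submod_sum => // q.
exact: HM (hf _ _) (hg _ _).
Qed.

Lemma elem_fsub H p q a : (forall p q, is_submod (H p q)) -> F p q a -> H p q a ->
  fsub H (elem p q a).
Proof.
move=> Hs Fa Ha p' q'; rewrite elemE //.
by case: eqP => [[-> ->]|_] //; apply: submod0.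
Qed.

(** Elementary matrices turn a factorization of the entry at [(p, s)] through one
    intermediate index [q] into a product of matrices. *)
Lemma fsub_prod H H' H'' : (forall p q, is_submod (H p q)) ->
  (forall p q, is_submod (H' p q)) -> (forall p q, is_submod (H'' p q)) ->
  (forall p q, H p q `<=` F p q) -> (forall p q, H' p q `<=` F p q) ->
  (forall p q s x y, H p q x -> H' q s y -> H'' p s (x ** y)) ->
  (forall p s, exists q, (H'' p s `<=` H p q ** H' q s)%classic) ->
  (fsub H ** fsub H')%classic = fsub H''.
Proof.
move=> Hs Hs' Hs'' HF HF' HM HD; apply/seteqP; split.
  apply: setprod_sub; first exact: fsub_submod.
  by move=> f g; apply: fsub_mul.
move=> f hf; apply: fmat_ind => [|p s]; first exact: lspan_submod.
have [q hq] := HD p s.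
apply: (elem_span (lspan_submod _) _ _ (hq _ (hf p s))).
  by move=> _ [x Hx [y Hy <-]]; apply: (mxf_mul (q := q)); [apply: HF|apply: HF'].
move=> _ [x Hx [y Hy <-]]; rewrite -(elem_mul (q := q)); [|exact: HF|exact: HF'].
by apply: in_setprod; apply: elem_fsub => //; [apply: HF|apply: HF'].
Qed.

End FiniteMatrices.

(** * Partial actions on matrices *)

Section MatrixAction.
Variables (k : comPzRingType) (G : groupType) (A : nuAlgType k).
Variable alpha : ppaction G A.
Local Notation D := (dom alpha).
Local Notation DD := (doml alpha).
Variables (L : choiceType) (idx : L -> seq G) (mv : G -> L -> L).
Hypotheses (mv1 : forall p, mv 1%g p = p).
Hypothesis mvM : forall s t p, mv s (mv t p) = mv (s * t)%g p.
Hypothesis idx_mv : forall t p, idx (mv t p) = map (fun s => t * s)%g (idx p).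

Definition dom_entry p q := DD (idx p ++ idx q).

Lemma dom_entry_mul p q s x y :
  dom_entry p q x -> dom_entry q s y -> dom_entry p s (x ** y).
Proof.
move=> hx hy; apply: domlS (doml_mul hx hy) => t; rewrite !mem_cat.
by case/orP => ->; rewrite ?orbT.
Qed.

(** For [idx p = [:: p]], the entry at [(p, q)] lies in [D p ** D q]. Multiplying it
    by [delta_p^-1] on the left and by [delta_q] on the right gives the product of
    the components of degrees [p^-1] and [q] of the skew group algebra. *)
Definition dom_fam : mxfam A L := MxFam (fun p q => doml_submod alpha (idx p ++ idx q)) dom_entry_mul.
Local Notation MM := (fmat dom_fam).
Implicit Types f g : MM.

Definition mdom_entry (l : seq G) p q := DD (l ++ (idx p ++ idx q)).
Definition mdoml l : set MM := fsub (mdom_entry l).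

Lemma mdom_entry_sub l p q : mdom_entry l p q `<=` dom_fam p q.
Proof. by apply: domlS => t ht; rewrite mem_cat ht orbT. Qed.

Lemma mdoml_ideal l : is_ideal (mdoml l).
Proof.
split; first by apply: fsub_submod => p q; apply: doml_submod.
move=> f g hg; split.
  apply: (fsub_mul (H := dom_entry) (H' := mdom_entry l)) (fmat_in f) hg => [p q|p q s x y hx hy].
    exact: doml_submod.
  apply: domlS (doml_mul hx hy) => t; rewrite !mem_cat => /or3P[] ->; by rewrite ?orbT.
apply: (fsub_mul (H := mdom_entry l) (H' := dom_entry)) hg (fmat_in f) => [p q|p q s x y hx hy].
  exact: doml_submod.
apply: domlS (doml_mul hx hy) => t; rewrite !mem_cat => /or3P[] ->; by rewrite ?orbT.
Qed.

Lemma mdomlM l m : (mdoml l ** mdoml m)%classic = mdoml (l ++ m).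
Proof.
apply: fsub_prod => [p q|p q|p q|p q|p q|p q s x y hx hy|p s].
- exact: doml_submod.
- exact: doml_submod.
- exact: doml_submod.
- exact: mdom_entry_sub.
- exact: mdom_entry_sub.
- apply: domlS (doml_mul hx hy) => t; rewrite !mem_cat => /orP[/orP[]|/orP[]] ->; by rewrite ?orbT.
(* The row index itself serves as intermediate index. *)
- exists p; rewrite /mdom_entry domlM; apply: domlS => t; rewrite !mem_cat.
  by move=> /orP[/or3P[]|/or3P[]] ->; rewrite ?orbT.
Qed.

Lemma mdomlE l m : l =i m -> mdoml l = mdoml m.
Proof.
move=> lm; have e p q : mdom_entry l p q = mdom_entry m p q.
  by apply: domlE => t; rewrite !mem_cat lm.
by apply/seteqP; split=> f hf p q; have := hf p q; rewrite e.
Qed.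

Definition mdom t : set MM := mdoml [:: t].

Definition mact_fun t (f : L * L -> A) : L * L -> A :=
  fun z => act alpha t (f (mv t^-1%g z.1, mv t^-1%g z.2)).
Definition mact t f : MM := mkfmat dom_fam (mact_fun t f).

Lemma mvK t : cancel (mv t) (mv t^-1%g).
Proof. by move=> p; rewrite mvM mulVg mv1. Qed.

Lemma mvVK t : cancel (mv t^-1%g) (mv t).
Proof. by move=> p; rewrite mvM mulgV mv1. Qed.

Lemma idx_shift t p q : map (fun s => t * s)%g
  (idx (mv t^-1%g p) ++ idx (mv t^-1%g q)) = idx p ++ idx q.
Proof. by rewrite map_cat -!idx_mv !mvVK. Qed.

Lemma mact_entry t l (f : MM) p q : mdoml (t^-1%g :: l) f ->
  mdom_entry (t :: map (fun s => t * s)%g l) p q (mact_fun t f (p, q)).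
Proof.
move=> hf; have := act_doml_in (hf (mv t^-1%g p) (mv t^-1%g q)).
by rewrite map_cat idx_shift.
Qed.

Lemma mact_pred t l (f : MM) : mdoml (t^-1%g :: l) f -> mact_fun t f \in fmat_pred dom_fam.
Proof.
move=> hf; apply/asboolP; split=> [p q|].
  exact/mdom_entry_sub/(mact_entry p q hf).
pose h (z : L * L) := (mv t z.1, mv t z.2).
apply: (@sub_finite_set _ _ (h @` (f @^-1` [set~ 0]))); last exact/finite_image/fmat_finite.
move=> [p q] /= hz; exists (mv t^-1%g p, mv t^-1%g q); last by rewrite /h /= !mvVK.
by move=> /= e; apply: hz; rewrite /mact_fun /= e act0.
Qed.

Lemma mactE t l (f : MM) p q : mdoml (t^-1%g :: l) f ->
  mact t f (p, q) = act alpha t (f (mv t^-1%g p, mv t^-1%g q)).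
Proof. by move=> hf; rewrite mkfmatE //; apply: mact_pred hf. Qed.

Lemma mdoml_dom t l f p q : mdoml (t :: l) f -> D t (f (p, q)).
Proof. by move=> hf; apply: doml_dom (hf p q); rewrite mem_head. Qed.

Lemma mact_in t l f : mdoml (t^-1%g :: l) f ->
  mdoml (t :: map (fun s => t * s)%g l) (mact t f).
Proof. by move=> hf p q; rewrite (mactE _ _ hf); apply: mact_entry. Qed.

Lemma mactVK t l f : mdoml (t :: l) f -> mact t (mact t^-1%g f) = f.
Proof.
move=> hf; have hf' : mdoml (t^-1%g^-1%g :: l) f by rewrite invgK.
apply: fmatP => p q; rewrite (mactE _ _ (mact_in hf')) (mactE _ _ hf') invgK !mvVK.
by rewrite actVK //; apply: mdoml_dom hf.
Qed.

Lemma mdom_ideal t : is_ideal (mdom t).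
Proof. exact: mdoml_ideal. Qed.

Lemma mact_isom t : alg_isom (mdom t^-1%g) (mdom t) (mact t).
Proof.
have K f : mdom t^-1%g f -> mact t^-1%g (mact t f) = f.
  by move=> hf; rewrite -{2}(mactVK hf) invgK.
split; first split.
- by move=> f hf; have := mact_in hf.
- by move=> f g; rewrite !inE => hf hg e; rewrite -(K f hf) -(K g hg) e.
- move=> f hf; exists (mact t^-1%g f); last exact: mactVK hf.
  by have := @mact_in t^-1%g [::] f; rewrite invgK; apply.
- move=> f g; rewrite !inE => hf hg c; apply: fmatP => p q.
  have hfg : mdom t^-1%g (c *: f + g).
    by case/is_submodP: (mdom_ideal t^-1%g).1 => _; apply.
  rewrite (mactE _ _ hfg) [RHS](_ : _ = c *: mact t f (p, q) + mact t g (p, q)) //.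
  rewrite (mactE _ _ hf) (mactE _ _ hg) -act_lin //; [exact: mdoml_dom hf|exact: mdoml_dom hg].
- move=> f g; rewrite !inE => hf hg; apply: fmatP => p q.
  have hfg : mdom t^-1%g (f ** g) by apply: ideal_mull (mdom_ideal _) hg.
  rewrite (mactE _ _ hfg) (fmat_prodE (S := fmat_supp f)) => [|r rf]; last first.
    by rewrite fmat_suppr // amul0l.
  rewrite (fmat_prodE (S := [fset mv t r | r in fmat_supp f]%fset)) => [|r rf]; last first.
    rewrite (mactE _ _ hf) [X in act _ _ X](fmat_suppr (f := f)) ?act0 ?amul0l //.
    by apply: contra rf => rf; apply/imfsetP; exists (mv t^-1%g r) => //; rewrite mvVK.
  rewrite big_imfset /=; last by move=> x y _ _; apply: can_inj (mvK t) _ _.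
  rewrite act_sum => [|r]; last by apply: dom_rmul; apply: mdoml_dom hf.
  apply: eq_bigr => r _; rewrite (mactE _ _ hf) (mactE _ _ hg) mvK act_mul //.
    exact: mdoml_dom hf.
  exact: mdoml_dom hg.
Qed.

Lemma mdom1 : mdom 1%g = [set: MM].
Proof.
apply/seteqP; split=> // f _ p q.
by rewrite /mdom_entry cat1s doml_unit; apply: fmat_in.
Qed.

Lemma mact1 f : mact 1%g f = f.
Proof.
have hf : mdom 1%g^-1%g f by rewrite invg1 mdom1.
by apply: fmatP => p q; rewrite (mactE _ _ hf) act1 invg1 !mv1.
Qed.

Lemma mdom_idem t : (mdom t ** mdom t)%classic = mdom t.
Proof. by rewrite mdomlM; apply: mdomlE => x; rewrite !inE orbb. Qed.

Lemma mdom_comm s t : (mdom s ** mdom t)%classic = (mdom t ** mdom s)%classic.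
Proof. by rewrite !mdomlM; apply: mdomlE => x; rewrite !inE orbC. Qed.

Lemma mact_dom s t :
  mact s @` (mdom s^-1%g ** mdom t)%classic = (mdom s ** mdom (s * t)%g)%classic.
Proof.
rewrite !mdomlM /=; apply/seteqP; split=> [_ [f hf <-]|f hf]; first exact: mact_in hf.
exists (mact s^-1%g f); last exact: mactVK hf.
have hf' : mdoml [:: s^-1^-1%g; (s * t)%g] f by rewrite invgK.
by have := mact_in hf'; rewrite /= mulKg.
Qed.

Lemma mactM s t f : (mdom t^-1%g ** mdom (s * t)^-1%g)%classic f ->
  mact s (mact t f) = mact (s * t)%g f.
Proof.
rewrite mdomlM /= => hf; apply: fmatP => p q.
have h1 := mact_in hf; rewrite /= invgM mulVKg in h1.
have h2 : mdoml [:: s^-1%g; t] (mact t f).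
  by rewrite (mdomlE (m := [:: t; s^-1%g])) // => x; rewrite !inE orbC.
have h3 : mdoml [:: (s * t)^-1%g; t^-1%g] f.
  by rewrite (mdomlE (m := [:: t^-1%g; (s * t)^-1%g])) // => x; rewrite !inE orbC.
rewrite (mactE _ _ h2) (mactE _ _ hf) (mactE _ _ h3) !mvM invgM actM //.
have := hf (mv (t^-1 * s^-1)%g p) (mv (t^-1 * s^-1)%g q).
rewrite -invgM (_ : (D _ ** D _)%classic = DD [:: t^-1%g; (s * t)^-1%g]); last by rewrite /= domTr.
by apply: domlS => x; rewrite mem_cat => ->.
Qed.

Definition matrix_ppaction : ppaction G MM :=
  PPAction mdom_ideal mact_isom mdom1 mact1 mdom_idem mdom_comm mact_dom mactM.

End MatrixAction.

(** * Globalization of the partial action on matrices *)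

Section TranslationGlobalization.
Variables (k : comPzRingType) (G : groupType) (A : nuAlgType k).
Variable alpha : ppaction G A.
Local Notation D := (dom alpha).
Local Notation DD := (doml alpha).
Local Notation S := (skew alpha).

Lemma actMl s t x : DD [:: t^-1%g; (s * t)^-1%g] x ->
  act alpha s (act alpha t x) = act alpha (s * t)%g x.
Proof. by move=> hx; apply: actM; rewrite /= domTr in hx. Qed.

Definition skew_part r l : set S := [set x | skew_comp r x /\ DD (r :: l) (x r)].

Lemma skew_part_submod r l : is_submod (skew_part r l).
Proof.
apply: submodI; first exact: direct_sum_submod (skew_comp_sum alpha) r.
apply: (submod_preim (f := fun x : S => x r)); first exact: skew_eval_lin.
exact: doml_submod.
Qed.

Lemma skew_part_single r l a : DD (r :: l) a -> skew_part r l (single alpha r a).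
Proof.
move=> ha; split; first exact: single_comp.
by rewrite single_at //; apply: doml_dom ha; rewrite mem_head.
Qed.

Lemma skew_part_mono r l m : {subset l <= r :: m} -> skew_part r m `<=` skew_part r l.
Proof.
move=> lm x [xr hx]; split=> //; apply: domlS hx => t; rewrite in_cons.
by case/orP => [/eqP ->|/lm //]; rewrite mem_head.
Qed.

Lemma skew_part_nil r x : skew_comp r x -> skew_part r [::] x.
Proof. by move=> xr; split=> //; rewrite doml1; apply: skew_dom. Qed.

Lemma map_mulgK r (l : seq G) : map (fun s => r * s)%g (map (fun s => r^-1 * s)%g l) = l.
Proof. by rewrite -map_comp map_id_in // => x _ /=; rewrite mulVKg. Qed.

(** The identity [act r (D r^-1 ** D s) = D r ** D (r * s)], with further domains
    carried along. *)
Lemma skew_partM r s l m : (skew_part r l ** skew_part s m)%classic =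
  skew_part (r * s)%g (r :: l ++ map (fun t => r * t)%g m).
Proof.
apply/seteqP; split.
  apply: setprod_sub; first exact: skew_part_submod.
  move=> x y [xr hx] [ys hy]; rewrite (skew_compE xr) (skew_compE ys).
  rewrite skew_mul_single; try exact: skew_dom.
  apply: skew_part_single; rewrite /skew_coef.
  have h1 : DD (r^-1%g :: map (fun t => r^-1 * t)%g l) (act alpha r^-1%g (x r)).
    by apply: act_doml_in; rewrite invgK.
  apply: domlS (act_doml_in (doml_mul h1 hy)) => t.
  rewrite !map_cat map_mulgK !inE !mem_cat !inE.
  by move=> /or3P[->|->|/orP[->|->]]; rewrite ?orbT.
move=> x [xrs hx]; rewrite (skew_compE xrs); move: (x _) hx => a {x xrs}.
have -> : DD [:: (r * s)%g, r & l ++ map (fun t => r * t)%g m] =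
    act alpha r @` (DD (r^-1%g :: map (fun t => r^-1 * t)%g l) ** DD (s :: m))%classic.
  rewrite domlM cat_cons act_doml map_cat map_mulgK; apply: domlE => t.
  by rewrite /= !inE !mem_cat !inE; do ?case: eqP; rewrite ?orbT.
case=> c hc <-.
suff [] : [set c | D r^-1%g c /\ (skew_part r l ** skew_part s m)%classic
  (single alpha (r * s)%g (act alpha r c))] c by [].
have Drs u v : DD (r^-1%g :: map (fun t => r^-1 * t)%g l) u -> DD (s :: m) v ->
    act alpha r (u ** v) = skew_coef alpha r (act alpha r u) v.
  by move=> hu _; rewrite /skew_coef actK //; apply: doml_dom hu; rewrite mem_head.
pose Z := [set a | D (r * s)%g a /\ (skew_part r l ** skew_part s m)%classic (single alpha (r * s)%g a)].
have Zs : is_submod Z.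
  have /is_submodP[t0 tD] := lspan_submod [set u ** v | u in skew_part r l & v in skew_part s m].
  have /is_submodP[d0 dD] := dom_submod alpha (r * s)%g.
  apply/is_submodP; split=> [|e u v [Du hu] [Dv hv]].
    by split=> //; rewrite single0.
  by split; [exact: dD|rewrite single_lin //; exact: tD].
suff [] : [set c | D r^-1%g c /\ Z (act alpha r c)] c by move=> h1 [h2 h3].
move: c hc; apply: setprod_sub => [|u v hu hv].
  have /is_submodP[t0 tD] := Zs.
  have /is_submodP[d0 dD] := dom_submod alpha r^-1%g.
  apply/is_submodP; split=> [|e u v [Du hu] [Dv hv]]; first by rewrite /= act0.
  by split; [exact: dD|rewrite act_lin //; exact: tD].
have Du : D r^-1%g u by apply: doml_dom hu; rewrite mem_head.
have Dv : D s v by apply: doml_dom hv; rewrite mem_head.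
split; first exact: dom_rmul.
rewrite Drs //; split; first by apply: coef_dom => //; apply: act_in.
rewrite -skew_mul_single //; last exact: act_in.
apply: in_setprod; apply: skew_part_single => //.
by have := act_doml_in hu; rewrite map_mulgK.
Qed.

Lemma smash_fam_mul (p q s : G) (x y : S) : skew_comp (p^-1 * q)%g x ->
  skew_comp (q^-1 * s)%g y -> skew_comp (p^-1 * s)%g (x ** y).
Proof. by move=> hx hy; have := skew_comp_mul hx hy; rewrite mulgA mulgK. Qed.

(** The smash product of the skew group algebra with the group: matrices whose
    entry at [(p, q)] has degree [p^-1 * q]. *)
Definition smash_fam : mxfam S G :=
  MxFam (fun p q : G => direct_sum_submod (skew_comp_sum alpha) (p^-1 * q)%g) smash_fam_mul.
Local Notation K := (fmat smash_fam).

Definition smash_shift_fun t (f : G * G -> S) : G * G -> S :=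
  fun z => f (t^-1 * z.1, t^-1 * z.2)%g.

Lemma smash_shift_pred t (f : K) : smash_shift_fun t f \in fmat_pred smash_fam.
Proof.
apply/asboolP; split=> [p q|].
  have := fmat_in f (t^-1 * p)%g (t^-1 * q)%g.
  by rewrite /= invgM invgK -mulgA mulVKg.
pose h (z : G * G) := (t * z.1, t * z.2)%g.
apply: (@sub_finite_set _ _ (h @` (f @^-1` [set~ 0]))); last exact/finite_image/fmat_finite.
by move=> [p q] hz; exists (t^-1 * p, t^-1 * q)%g => //; rewrite /h /= !mulVKg.
Qed.

Definition smash_shift t (f : K) : K := FMat (smash_shift_pred t f).

Lemma smash_shift1 f : smash_shift 1%g f = f.
Proof. by apply: fmatP => p q; rewrite /= /smash_shift_fun invg1 !mul1g. Qed.

Lemma smash_shiftM s t f : smash_shift s (smash_shift t f) = smash_shift (s * t)%g f.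
Proof. by apply: fmatP => p q; rewrite /= /smash_shift_fun /= invgM !mulgA. Qed.

Lemma smash_shift_lin t : linear (smash_shift t).
Proof. by move=> c f g; apply: fmatP. Qed.

Lemma smash_shift_mul t : {morph smash_shift t : f g / f ** g}.
Proof.
move=> f g; apply: fmatP => p s.
rewrite [LHS](_ : _ = \sum_(q \in [set: G]) f (t^-1 * p, q)%g ** g (q, t^-1 * s)%g) //.
rewrite [RHS](_ : _ = \sum_(q \in [set: G])
  f (t^-1 * p, t^-1 * q)%g ** g (t^-1 * q, t^-1 * s)%g) //.
rewrite (@reindex_fsbigT _ _ _ _ _ (fun q => t^-1 * q)%g) //.
by exists (fun q => t * q)%g => q; rewrite ?mulVKg ?mulKg.
Qed.

Lemma smash_shift_isom t : alg_isom [set: K] [set: K] (smash_shift t).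
Proof.
have Kt u : cancel (smash_shift u) (smash_shift u^-1%g) by move=> f; rewrite smash_shiftM mulVg smash_shift1.
split.
- split=> // [x y _ _|f _]; first exact: (can_inj (Kt t)).
  by exists (smash_shift t^-1%g f) => //; rewrite smash_shiftM mulgV smash_shift1.
- by move=> f g _ _ c; rewrite smash_shift_lin.
- by move=> f g _ _; rewrite smash_shift_mul.
Qed.

Definition smash_gaction : gaction G K := GAction smash_shift_isom smash_shift1 smash_shiftM.

Definition translate_ideal_entry l (p q : G) : set S :=
  skew_part (p^-1 * q)%g (map (fun t => p^-1 * t)%g l).

(** For a singleton [[:: t]] this is the translate by [t] of the ideal of the
    globalization; in general it is the product of the translates by the
    elements of [l]. *)
Definition translate_ideal l : set K := fsub (translate_ideal_entry l).
Local Notation J := translate_ideal.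

Lemma translate_ideal_entry_mul l m p q s x y :
  translate_ideal_entry l p q x -> translate_ideal_entry m q s y ->
  translate_ideal_entry (l ++ m) p s (x ** y).
Proof.
move=> hx hy; have := in_setprod (@amul k S) hx hy; rewrite skew_partM mulgA mulgK.
apply: skew_part_mono => t; rewrite -map_comp map_cat !inE !mem_cat => /orP[->|].
  by rewrite !orbT.
move=> /mapP[u um ->]; apply/or3P/Or33/orP; right.
by apply/mapP; exists u => //=; rewrite -!mulgA mulVKg.
Qed.

Lemma translate_ideal_entry_sub l p q : translate_ideal_entry l p q `<=` smash_fam p q.
Proof. by move=> x []. Qed.

Lemma translate_ideal_nil (f : K) : J [::] f.
Proof. by move=> p q; apply/skew_part_nil/(fmat_in f). Qed.

Lemma translate_ideal_submod l p q : is_submod (translate_ideal_entry l p q).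
Proof. exact: skew_part_submod. Qed.

Lemma translate_ideal_is_ideal l : is_ideal (J l).
Proof.
split; first by apply: fsub_submod => p q; apply: translate_ideal_submod.
move=> f g hg; split.
  apply: (fsub_mul _ _ (translate_ideal_nil f) hg) => [p q|p q s x y]; first exact: skew_part_submod.
  exact: translate_ideal_entry_mul.
apply: (fsub_mul _ _ hg (translate_ideal_nil f)) => [p q|p q s x y]; first exact: skew_part_submod.
by move=> hx hy; have := translate_ideal_entry_mul hx hy; rewrite cats0.
Qed.

Lemma translate_idealM s t : (J [:: s] ** J [:: t])%classic = J [:: s; t].
Proof.
apply: fsub_prod.
- exact: translate_ideal_submod.
- exact: translate_ideal_submod.
- exact: translate_ideal_submod.
- exact: translate_ideal_entry_sub.
- exact: translate_ideal_entry_sub.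
- by move=> p q r x y; apply: translate_ideal_entry_mul.
(* At the intermediate index [s] the first factor carries only [p^-1 * s]. *)
- move=> p r; exists s; rewrite skew_partM mulgA mulgK.
  apply: skew_part_mono => u; rewrite /= !inE mulgA mulgK orbA orbb.
  by move=> ->; rewrite orbT.
Qed.

Lemma translate_idealC s t : J [:: s; t] = J [:: t; s].
Proof.
apply/seteqP; split=> f hf p q; have := hf p q; apply: skew_part_mono => u;
  by rewrite !inE => /orP[] ->; rewrite ?orbT.
Qed.

Lemma smash_shift_ideal s t : smash_shift s @` J [:: t] = J [:: (s * t)%g].
Proof.
have sub u v f : J [:: v] f -> J [:: (u * v)%g] (smash_shift u f).
  move=> hf p q; have := hf (u^-1 * p)%g (u^-1 * q)%g.
  by rewrite /translate_ideal_entry /= !invgM !invgK -!mulgA mulVKg.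
apply/seteqP; split=> [_ [f hf <-]|f hf]; first exact: sub.
exists (smash_shift s^-1%g f); last by rewrite smash_shiftM mulgV smash_shift1.
by have := sub s^-1%g _ _ hf; rewrite mulKg.
Qed.

Local Notation idx := (fun p : G => [:: p]).
Local Notation mv := (fun s p : G => (s * p)%g).

Lemma regular_mv1 (p : G) : mv 1%g p = p. Proof. exact: mul1g. Qed.
Lemma regular_mvM (s t p : G) : mv s (mv t p) = mv (s * t)%g p. Proof. exact: mulgA. Qed.

Definition regular_ppaction :=
  @matrix_ppaction k G A alpha G idx mv regular_mv1 regular_mvM (fun _ _ => erefl).
Local Notation MM := (fmat (dom_fam alpha idx)).

Lemma regular_dom (l : seq G) (f : MM) p q : mdoml (idx := idx) l f ->
  DD ([:: p; q] ++ l) (f (p, q)).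
Proof.
move=> hf; apply: domlS (hf p q) => t; rewrite !mem_cat !inE orbC.
by case/or3P => ->; rewrite ?orbT.
Qed.

Definition glob_fun (f : G * G -> A) : G * G -> S :=
  fun z => single alpha (z.1^-1 * z.2)%g (act alpha z.1^-1%g (f z)).

Lemma glob_pred (f : MM) : glob_fun f \in fmat_pred smash_fam.
Proof.
apply/asboolP; split=> [p q|]; first exact: single_comp.
apply: sub_finite_set (fmat_finite f) => z /=; apply: contra_not => e.
by rewrite /glob_fun e act0 single0.
Qed.

(** The entry [a] at [(p, q)] becomes [delta_p^-1 a delta_q]. *)
Definition glob (f : MM) : K := FMat (glob_pred f).

Lemma act_regular (l : seq G) (f : MM) p q : mdoml (idx := idx) l f ->
  DD ([:: p^-1; p^-1 * q]%g ++ map (fun t => p^-1 * t)%g l) (act alpha p^-1%g (f (p, q))).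
Proof.
by move=> hf; apply: (@act_doml_in _ _ _ alpha p^-1%g (q :: l)); rewrite invgK; apply: regular_dom.
Qed.

Lemma mdoml_nil (f : MM) : mdoml (idx := idx) [::] f.
Proof. move=> p q; exact: (fmat_in f). Qed.

Lemma act_regular_dom (f : MM) p q : D (p^-1 * q)%g (act alpha p^-1%g (f (p, q))).
Proof. by apply: doml_dom (act_regular p q (mdoml_nil f)); rewrite !inE eqxx orbT. Qed.

Lemma regular_domp (f : MM) p q : D p^-1%g^-1%g (f (p, q)).
Proof.
rewrite invgK; apply: doml_dom (regular_dom p q (mdoml_nil f)).
by rewrite mem_head.
Qed.

Lemma glob_lin : linear glob.
Proof.
move=> c f g; apply: fmatP => p q.
rewrite [RHS](_ : _ = c *: glob f (p, q) + glob g (p, q)) //=.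
rewrite /glob_fun -single_lin; try exact: act_regular_dom.
by rewrite -act_lin //; apply: regular_domp.
Qed.

Lemma glob_inj : injective glob.
Proof.
move=> f g e; apply: fmatP => p q.
have : glob f (p, q) (p^-1 * q)%g = glob g (p, q) (p^-1 * q)%g by rewrite e.
rewrite /= -[X in X = _]/(single _ _ _ _) -[X in _ = X]/(single _ _ _ _).
rewrite !single_at; try exact: act_regular_dom.
move=> h; have := congr1 (act alpha p) h.
by rewrite !actVK //; have := regular_domp _ p q; rewrite invgK; apply.
Qed.

Lemma glob_mul : {morph glob : f g / f ** g}.
Proof.
move=> f g; apply: fmatP => p s.
rewrite (fmat_prodE (S := fmat_supp f)) => [|q qf]; last first.
  by rewrite /= /glob_fun /= fmat_suppr // act0 single0 amul0l.
rewrite [LHS](_ : _ = single alpha (p^-1 * s)%g (act alpha p^-1%g ((f ** g) (p, s)))) //.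
rewrite (fmat_prodE (S := fmat_supp f)) => [|q qf]; last by rewrite fmat_suppr ?amul0l.
rewrite act_sum => [|q]; last exact/dom_rmul/regular_domp.
have Dq q : DD [:: p; q; s] (f (p, q) ** g (q, s)).
  apply: domlS (doml_mul (regular_dom p q (mdoml_nil f)) (regular_dom q s (mdoml_nil g))) => t.
  by rewrite !mem_cat !inE; case/or3P => ->; rewrite ?orbT.
have E q : single alpha (p^-1 * s)%g (act alpha p^-1%g (f (p, q) ** g (q, s))) =
    glob f (p, q) ** glob g (q, s).
  rewrite /= /glob_fun /= skew_mul_single; try exact: act_regular_dom.
  rewrite mulgA mulgK; congr single; rewrite /skew_coef.
  rewrite (actMl (t := p^-1%g)); last first.
    apply: domlS (regular_dom p q (mdoml_nil f)) => t.
    by rewrite !invgM !invgK mulVKg !inE.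
  rewrite invgM invgK mulgK -act_mul; try exact: regular_domp; last first.
    rewrite invgK; apply: doml_dom (regular_dom p q (mdoml_nil f)).
    by rewrite !inE eqxx orbT.
  rewrite actMl ?mulgK //; apply: domlS (Dq q) => t.
  by rewrite !invgK !inE => /orP[] ->; rewrite ?orbT.
rewrite single_sum => [|q]; first by apply: eq_bigr => q _; apply: E.
have : DD [:: p^-1; p^-1 * q; p^-1 * s]%g (act alpha p^-1%g (f (p, q) ** g (q, s))).
  by apply: (@act_doml_in _ _ _ alpha p^-1%g [:: q; s]); rewrite invgK.
by apply: doml_dom; rewrite !inE eqxx !orbT.
Qed.

Lemma glob_hom : alg_hom glob.
Proof. by split; [exact: glob_lin|exact: glob_mul]. Qed.

Lemma glob_image l : glob @` mdoml (idx := idx) l = J (1%g :: l).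
Proof.
apply/seteqP; split=> [_ [f hf <-] p q|h hh].
  rewrite /translate_ideal_entry /= mulg1; apply: skew_part_single.
  apply: domlS (act_regular p q hf) => t; rewrite mem_cat !inE.
  by case/or3P => ->; rewrite ?orbT.
pose f z := act alpha z.1 (h z (z.1^-1 * z.2)%g).
have fE p q : DD ([:: p; q] ++ l) (f (p, q)).
  have [_ hpq] := hh p q.
  have : DD (p^-1%g :: (p^-1 * q)%g :: map (fun t => p^-1 * t)%g l) (h (p, q) (p^-1 * q)%g).
    by apply: domlS hpq => t; rewrite map_cons mulg1 !inE => /or3P[] ->; rewrite ?orbT.
  by move=> /act_doml_in; rewrite map_cons mulVKg map_mulgK.
have fP : f \in fmat_pred (dom_fam alpha idx).
  apply/asboolP; split=> [p q|].
    suff : DD [:: p; q] (f (p, q)) by [].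
    by apply: domlS (fE p q) => t; rewrite mem_cat => ->.
  apply: sub_finite_set (fmat_finite h) => z /=; apply: contra_not => e.
  by rewrite /f e act0.
exists (FMat fP).
  move=> p q; apply: domlS (fE p q) => t; rewrite !mem_cat !inE.
  by case/or3P => ->; rewrite ?orbT.
apply: fmatP => p q; have [hc hpq] := hh p q.
rewrite (skew_compE hc) /= /glob_fun /f /= actK //.
by apply: doml_dom hpq; rewrite !inE mulg1 eqxx orbT.
Qed.

Lemma glob_range : range glob = J [:: 1%g].
Proof.
rewrite -glob_image; congr image; apply/seteqP; split=> // f _; exact: mdoml_nil.
Qed.

Lemma smash_shift_range t : gact smash_gaction t @` range glob = J [:: t].
Proof. by rewrite glob_range smash_shift_ideal mulg1. Qed.

Lemma glob_act t (f : MM) : dom regular_ppaction t^-1%g f ->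
  glob (act regular_ppaction t f) = smash_shift t (glob f).
Proof.
move=> hf; apply: fmatP => p q.
rewrite [LHS](_ : _ = single alpha (p^-1 * q)%g (act alpha p^-1%g ((act regular_ppaction t f : MM) (p, q)))) //.
rewrite (mactE regular_mv1 regular_mvM (fun _ _ => erefl) _ _ (l := [::])) // actMl; last first.
  apply: domlS (regular_dom (t^-1 * p)%g (t^-1 * q)%g hf) => u.
  by rewrite invgM invgK mem_cat !inE => /orP[] ->; rewrite ?orbT.
by rewrite /= /smash_shift_fun /glob_fun /= !invgM !invgK -mulgA mulVKg.
Qed.

Lemma regular_minimal_globalization : minimal_globalization regular_ppaction smash_gaction.
Proof.
exists glob; split.
  split.
  - exact: alg_hom_isom glob_hom glob_inj.
  - by rewrite glob_range; apply: translate_ideal_is_ideal.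
  - by move=> t; rewrite smash_shift_range glob_range !translate_idealM translate_idealC.
  - move=> t; rewrite smash_shift_range glob_range translate_idealM.
    exact: (glob_image [:: t]).
  - exact: glob_act.
apply/seteqP; split=> // f _; apply: fmat_ind => [|p q]; first exact: lspan_submod.
(* The entry at [(p, q)] lies in the translate by [p], where [D (p^-1 * p) = A]. *)
apply: sub_lspan; exists p => //; rewrite smash_shift_range.
apply: elem_fsub; first exact: translate_ideal_submod.
  exact: fmat_in f p q.
rewrite /translate_ideal_entry /= mulVg.
have [hc hpq] := skew_part_nil (fmat_in f p q); split=> //.
rewrite (domlE _ (m := [:: 1%g; (p^-1 * q)%g])) ?doml_unit // => t.
by rewrite !inE orbC.
Qed.

End TranslationGlobalization.

(** * Transport of partial actions, and corners of matrix algebras *)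

Section Transport.
Variables (k : comPzRingType) (G : groupType) (C N : nuAlgType k).
Variables (theta : ppaction G N) (phi : C -> N) (psi : N -> C).
Hypotheses (phi_hom : alg_hom phi) (phiK : cancel phi psi) (psiK : cancel psi phi).

Lemma transport_hom : alg_hom psi.
Proof.
split=> [c x y|x y]; apply: (can_inj phiK).
  by rewrite phi_hom.1 !psiK.
by rewrite phi_hom.2 !psiK.
Qed.

Definition tdom t : set C := psi @` dom theta t.
Definition tact t x : C := psi (act theta t (phi x)).

Lemma tdomP t x : tdom t x <-> dom theta t (phi x).
Proof.
by split=> [[y Dy <-]|Dx]; [rewrite psiK|exists (phi x)].
Qed.

Lemma tdom_ideal t : is_ideal (tdom t).
Proof.
split; first exact: submod_image transport_hom.1 (dom_submod _ _).
by move=> a x /tdomP Dx; split; apply/tdomP; rewrite phi_hom.2; [exact: dom_lmul|exact: dom_rmul].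
Qed.

Lemma tact_isom t : alg_isom (tdom t^-1%g) (tdom t) (tact t).
Proof.
split.
- split=> [x /tdomP Dx|x y|x /tdomP Dx].
  + by apply/tdomP; rewrite psiK; apply: act_in.
  + rewrite !inE => /tdomP Dx /tdomP Dy /(can_inj psiK) e; apply: (can_inj phiK).
    by rewrite -(actK Dx) -(actK Dy) e.
  + exists (psi (act theta t^-1%g (phi x))); last by rewrite /tact psiK actVK ?phiK.
    by apply/tdomP; rewrite psiK; apply: act_inV.
- move=> x y; rewrite !inE => /tdomP Dx /tdomP Dy c.
  by rewrite /tact phi_hom.1 act_lin // transport_hom.1.
- move=> x y; rewrite !inE => /tdomP Dx /tdomP Dy.
  by rewrite /tact phi_hom.2 act_mul // transport_hom.2.
Qed.

Lemma tdomM s t : (tdom s ** tdom t)%classic = psi @` (dom theta s ** dom theta t)%classic.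
Proof. by rewrite (image_setprod _ _ transport_hom). Qed.

Lemma tdom1 : tdom 1%g = [set: C].
Proof. by apply/seteqP; split=> // x _; apply/tdomP; rewrite dom1. Qed.

Lemma tact1 x : tact 1%g x = x.
Proof. by rewrite /tact act1 phiK. Qed.

Lemma tdom_idem t : (tdom t ** tdom t)%classic = tdom t.
Proof. by rewrite tdomM dom_idem. Qed.

Lemma tdom_comm s t : (tdom s ** tdom t)%classic = (tdom t ** tdom s)%classic.
Proof. by rewrite !tdomM dom_comm. Qed.

Lemma tact_dom s t :
  tact s @` (tdom s^-1%g ** tdom t)%classic = (tdom s ** tdom (s * t)%g)%classic.
Proof.
rewrite !tdomM -act_dom; apply/seteqP; split=> [_ [_ [x Dx <-] <-]|_ [_ [x Dx <-] <-]].
  by rewrite /tact psiK; exists (act theta s x) => //; exists x.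
by exists (psi x); [exists x|rewrite /tact psiK].
Qed.

Lemma tactM s t x : (tdom t^-1%g ** tdom (s * t)^-1%g)%classic x ->
  tact s (tact t x) = tact (s * t)%g x.
Proof. by rewrite tdomM => -[y Dy <-]; rewrite /tact !psiK actM. Qed.

Definition transport_ppaction : ppaction G C :=
  PPAction tdom_ideal tact_isom tdom1 tact1 tdom_idem tdom_comm tact_dom tactM.

End Transport.

Section MaskPeirce.
Variables (k : comPzRingType) (R : nuAlgType k) (L : choiceType) (F : mxfam R L).
Variable side : L -> bool.
Implicit Types (f g : fmat F) (c : L * L -> bool).

Definition mask_fun c (f : L * L -> R) : L * L -> R := fun z => if c z then f z else 0.

Lemma mask_pred c f : mask_fun c f \in fmat_pred F.
Proof.
apply/asboolP; split=> [p q|].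
  by rewrite /mask_fun; case: (c _); [exact: fmat_in|exact: submod0 (mxf_sub F _ _)].
apply: sub_finite_set (fmat_finite f) => z /=; apply: contra_not => e.
by rewrite /mask_fun e if_same.
Qed.

Definition mask c f : fmat F := FMat (mask_pred c f).

Definition row_mask b := mask (fun z => side z.1 == b).
Definition col_mask b := mask (fun z => side z.2 == b).

Lemma mask_lin c : linear (mask c).
Proof.
move=> e f g; apply: fmatP => p q.
rewrite [RHS](_ : _ = e *: mask c f (p, q) + mask c g (p, q)) //= /mask_fun.
by case: (c _); rewrite ?scaler0 ?addr0.
Qed.

Lemma row_mask_mul b f g : row_mask b (f ** g) = row_mask b f ** g.
Proof.
apply: fmatP => p q.
rewrite (fmat_prodE (S := fmat_supp f)) => [|r rf]; last first.
  by rewrite /= /mask_fun fmat_suppr // if_same amul0l.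
rewrite /= {1}/mask_fun -[fmat_mul_fun f g _]/((f ** g) (p, q)).
rewrite (fmat_prodE (S := fmat_supp f)) => [|r rf]; last by rewrite fmat_suppr // amul0l.
rewrite /mask_fun /=; case: eqP => _ //.
by rewrite big1 // => r _; rewrite amul0l.
Qed.

Lemma col_mask_mul b f g : col_mask b (f ** g) = f ** col_mask b g.
Proof.
apply: fmatP => p q.
rewrite (fmat_prodE (S := fmat_supp f)) => [|r rf]; last by rewrite fmat_suppr // amul0l.
rewrite /= {1}/mask_fun -[fmat_mul_fun f g _]/((f ** g) (p, q)).
rewrite (fmat_prodE (S := fmat_supp f)) => [|r rf]; last by rewrite fmat_suppr // amul0l.
rewrite /mask_fun /=; case: eqP => _ //.
by rewrite big1 // => r _; rewrite amul0r.
Qed.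

Lemma mask_mid b f g : col_mask b f ** g = f ** row_mask b g.
Proof.
apply: fmatP => p q.
rewrite !(fmat_prodE (S := fmat_supp f)) => [|r rf|r rf].
- apply: eq_bigr => r _; rewrite /= /mask_fun /=.
  by case: eqP => _ //; rewrite amul0l amul0r.
- by rewrite fmat_suppr // amul0l.
- by rewrite /= /mask_fun fmat_suppr // if_same amul0l.
Qed.

Definition mask_peirce : peirce (fmat F).
Proof.
apply: (@Peirce k _ row_mask col_mask (fun b => mask_lin _) (fun b => mask_lin _)
  row_mask_mul col_mask_mul mask_mid).
- move=> b f; apply: fmatP => p q.
  rewrite [LHS](_ : _ = row_mask b f (p, q) + row_mask (~~ b) f (p, q)) //= /mask_fun /=.
  by case: (side p) b => [] [] /=; rewrite ?addr0 ?add0r.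
- move=> b f; apply: fmatP => p q.
  rewrite [LHS](_ : _ = col_mask b f (p, q) + col_mask (~~ b) f (p, q)) //= /mask_fun /=.
  by case: (side q) b => [] [] /=; rewrite ?addr0 ?add0r.
- by move=> b f; apply: fmatP => p q; rewrite /= /mask_fun /=; case: eqP.
- by move=> b f; apply: fmatP => p q; rewrite /= /mask_fun /=; case: eqP.
- by move=> b f; apply: fmatP => p q; rewrite /= /mask_fun /=; case: (side p) b => [] [].
- by move=> b f; apply: fmatP => p q; rewrite /= /mask_fun /=; case: (side q) b => [] [].
- by move=> b d f; apply: fmatP => p q; rewrite /= /mask_fun /=; do 2?case: eqP.
Defined.

Lemma mask_blockP (b c : bool) f : block mask_peirce b c f <->
  forall p q, (side p != b) || (side q != c) -> f (p, q) = 0.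
Proof.
split=> [[hl hr] p q|h].
  case/orP=> [/negPf pb|/negPf qc].
    by rewrite -hl /= /mask_fun /= pb.
  by rewrite -hr /= /mask_fun /= qc.
split; apply: fmatP => p q; rewrite /= /mask_fun /=; case: ifP => // /negbT hs;
  by rewrite h // hs ?orbT.
Qed.

Lemma elem_block p q a : F p q a -> block mask_peirce (side p) (side q) (elem F p q a).
Proof.
move=> Fa; apply/mask_blockP => p' q' h; rewrite elemE // xpair_eqE.
by case: ifP => // /andP[/eqP ep /eqP eq]; rewrite ep eq !eqxx in h.
Qed.

End MaskPeirce.

(** * The Morita context between an algebra and its matrices *)

Section CornerEquivalence.
Variables (k : comPzRingType) (G : groupType) (A : nuAlgType k).
Variable alpha : ppaction G A.
Local Notation D := (dom alpha).
Local Notation DD := (doml alpha).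

(** The additional index [None] carries the whole algebra, and the group fixes it. *)
Definition oidx (o : option G) : seq G := if o is Some p then [:: p] else [::].
Definition omv (s : G) (o : option G) : option G := omap (fun p => s * p)%g o.

Lemma omv1 o : omv 1%g o = o.
Proof. by case: o => //= p; rewrite mul1g. Qed.

Lemma omvM s t o : omv s (omv t o) = omv (s * t)%g o.
Proof. by case: o => //= p; rewrite mulgA. Qed.

Lemma oidx_omv t o : oidx (omv t o) = map (fun s => t * s)%g (oidx o).
Proof. by case: o. Qed.

Definition extended_ppaction := matrix_ppaction alpha omv1 omvM oidx_omv.
Local Notation NN := (fmat (dom_fam alpha oidx)).
Local Notation MM := (fmat (dom_fam alpha (fun p : G => [:: p]))).
Local Notation EN := (elem (dom_fam alpha oidx)).
Local Notation EM := (elem (dom_fam alpha (fun p : G => [:: p]))).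
Local Notation theta := extended_ppaction.
Local Notation alpha' := (regular_ppaction alpha).
Local Notation P := (mask_peirce (dom_fam alpha oidx) isSome).
Local Notation blk := (block P).

Let inA a : dom_fam alpha oidx None None a.
Proof. by []. Qed.

Definition cornerI (a : A) : NN := EN None None a.

Lemma cornerI_hom : alg_hom cornerI.
Proof. by split=> [c a b|a b]; [apply: elem_lin|rewrite /cornerI elem_mul]. Qed.

Lemma cornerI_inj : injective cornerI.
Proof.
move=> a b /(congr1 (fun f : NN => f (None, None))).
by rewrite !elemE //= eqxx.
Qed.

Lemma cornerI_range : range cornerI = blk false false.
Proof.
apply/seteqP; split=> [_ [a _ <-]|f /mask_blockP hf].
  exact: (elem_block isSome (inA a)).
exists (f (None, None)) => //; apply: fmatP => p q; rewrite elemE //.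
case: eqP => [[-> ->] //|h]; rewrite hf //.
by case: p q h => [p|] [q|].
Qed.

Definition cornerJ_fun (f : G * G -> A) : option G * option G -> A :=
  fun z => if z is (Some p, Some q) then f (p, q) else 0.

Lemma cornerJ_pred (f : MM) : cornerJ_fun f \in fmat_pred (dom_fam alpha oidx).
Proof.
apply/asboolP; split=> [[p|] [q|]|] /=.
- exact: (fmat_in f p q).
- exact: (submod0 (mxf_sub (dom_fam alpha oidx) (Some p) None)).
- exact: (submod0 (mxf_sub (dom_fam alpha oidx) None (Some q))).
- exact: (submod0 (mxf_sub (dom_fam alpha oidx) None None)).
pose h (z : G * G) := (Some z.1, Some z.2).
apply: (@sub_finite_set _ _ (h @` (f @^-1` [set~ 0]))); last exact/finite_image/fmat_finite.
by move=> [[p|] [q|]] //= hz; exists (p, q).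
Qed.

Definition cornerJ (f : MM) : NN := FMat (cornerJ_pred f).

Lemma cornerJ_hom : alg_hom cornerJ.
Proof.
split=> [c f g|f g]; apply: fmatP => p q.
  rewrite [RHS](_ : _ = c *: cornerJ f (p, q) + cornerJ g (p, q)) //=.
  by case: p q => [p|] [q|] //=; rewrite scaler0 addr0.
rewrite (fmat_prodE (S := [fset Some r | r in fmat_supp f]%fset)) => [|r rf]; last first.
  case: p r rf => [p|] [r|] rf /=; rewrite ?amul0l // fmat_suppr ?amul0l //.
  by apply: contra rf => rf; apply/imfsetP; exists r.
rewrite big_imfset /=; last by move=> x y _ _ [].
case: p q => [p|] [q|] /=.
- rewrite -[LHS]/((f ** g) (p, q)) (fmat_prodE (S := fmat_supp f)) // => r rf.
  by rewrite fmat_suppr // amul0l.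
- by rewrite big1 // => r _; rewrite amul0r.
- by rewrite big1 // => r _; rewrite amul0l.
- by rewrite big1 // => r _; rewrite amul0l.
Qed.

Lemma cornerJ_inj : injective cornerJ.
Proof.
move=> f g e; apply: fmatP => p q.
exact: (congr1 (fun h : NN => h (Some p, Some q)) e).
Qed.

Lemma cornerJ_range : range cornerJ = blk true true.
Proof.
apply/seteqP; split=> [_ [f _ <-]|f /mask_blockP hf].
  by apply/mask_blockP => -[p|] [q|].
have hP : (fun z : G * G => f (Some z.1, Some z.2)) \in fmat_pred (dom_fam alpha (fun p : G => [:: p])).
  apply/asboolP; split=> [p q|]; first exact: (fmat_in f (Some p) (Some q)).
  pose h (z : option G * option G) := (odflt 1%g z.1, odflt 1%g z.2).
  apply: (@sub_finite_set _ _ (h @` (f @^-1` [set~ 0]))); last exact/finite_image/fmat_finite.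
  by move=> [p q] /= hz; exists (Some p, Some q).
by exists (FMat hP) => //; apply: fmatP => -[p|] [q|] //=; rewrite hf.
Qed.

Local Notation U := (blk false true).
Local Notation V := (blk true false).

Let Iin a : blk false false (cornerI a).
Proof. by rewrite -cornerI_range; exists a. Qed.

Let Jin f : blk true true (cornerJ f).
Proof. by rewrite -cornerJ_range; exists f. Qed.

Lemma extended_embedded : embedded cornerI cornerJ U V.
Proof.
split.
- exact: cornerI_hom.
- exact: cornerI_inj.
- exact: cornerJ_hom.
- exact: cornerJ_inj.
- exact: block_submod.
- exact: block_submod.
- by move=> a u; apply: block_mul.
- by move=> u b hu; apply: block_mul hu _.
- by move=> b v; apply: block_mul.
- by move=> v a hv; apply: block_mul hv _.
- by move=> u v hu hv; rewrite cornerI_range; apply: block_mul hu hv.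
- by move=> u v hu hv; rewrite cornerJ_range; apply: block_mul hu hv.
Qed.

Local Notation M := (emb_context extended_embedded).

(** Every block is the product of the blocks in its row and column: an entry
    at [(p, q)] factors through an index [r] on the required side whose domain
    contains the entry, namely [p], [q], or the trivial group element. *)
Lemma extended_block_span b c d : (blk b d `<=` blk b c ** blk c d)%classic.
Proof.
move=> f hf; apply: fmat_ind => [|p q]; first exact: lspan_submod.
have [[pb qd]|h] := pselect (isSome p = b /\ isSome q = d); last first.
  move/mask_blockP: hf => ->; rewrite ?elem0; first exact: submod0 (lspan_submod _).
  by rewrite -negb_and; apply/negP => /andP[/eqP pb /eqP qd]; apply: h.
have [r [rc hr]] : exists r, isSome r = c /\ {subset oidx r <= 1%g :: oidx p ++ oidx q}.
  case: c; last by exists None.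
  case: p {pb} => [p|]; first by exists (Some p); split=> // x /=; rewrite !inE => ->; rewrite orbT.
  case: q {qd} => [q|]; first by exists (Some q); split=> // x /=; rewrite !inE => ->; rewrite orbT.
  by exists (Some 1%g); split=> // x.
have Dpq : (DD (oidx p ++ oidx r) ** DD (oidx r ++ oidx q))%classic (f (p, q)).
  rewrite domlM; have := fmat_in f p q; rewrite /= /dom_entry -doml_unit.
  apply: domlS => x; rewrite !mem_cat !inE mem_cat.
  move=> /orP[/orP[->|/hr]|/orP[/hr|->]]; rewrite ?orbT // inE mem_cat //.
apply: (elem_span (lspan_submod _) _ _ Dpq).
  by move=> _ [x hx [y hy <-]]; apply: (mxf_mul (q := r)).
move=> _ [x hx [y hy <-]]; rewrite -(elem_mul (q := r)) //.
have := elem_block isSome (F := dom_fam alpha oidx) (p := p) (q := r) hx.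
have := elem_block isSome (F := dom_fam alpha oidx) (p := r) (q := q) hy.
by rewrite pb qd rc => h1 h2; apply: in_setprod.
Qed.

Lemma matrix_idempotent (L : choiceType) (idx : L -> seq G) (mv : G -> L -> L)
  (mv1 : forall p, mv 1%g p = p) (mvM : forall s t p, mv s (mv t p) = mv (s * t)%g p)
  (idx_mv : forall t p, idx (mv t p) = map (fun s => t * s)%g (idx p)) :
  idempotent_alg (fmat (dom_fam alpha idx)).
Proof.
have := dom_idem (matrix_ppaction alpha mv1 mvM idx_mv) 1%g.
by rewrite (dom1 (matrix_ppaction alpha mv1 mvM idx_mv)).
Qed.

Lemma extended_morita : morita_equivalence M.
Proof.
apply: embedded_morita; rewrite ?cornerI_range ?cornerJ_range; try exact: extended_block_span.
  exact: domT_idem alpha.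
exact: matrix_idempotent (@regular_mv1 G) (@regular_mvM G) (fun _ _ => erefl).
Qed.

Let inU (x : mX M) : U (span_val (x : spanT U)).
Proof. exact: span_submod_in (emb_U extended_embedded) x. Qed.

Let inV (y : mY M) : V (span_val (y : spanT V)).
Proof. exact: span_submod_in (emb_V extended_embedded) y. Qed.

Definition ctx_to_matrix (m : ctx M) : NN :=
  cornerI m.1.1 + span_val (m.1.2 : spanT U) + (span_val (m.2.1 : spanT V) + cornerJ m.2.2).

Let lin_add (V1 V2 : lmodType k) (f g : V1 -> V2) : linear f -> linear g ->
  linear (fun x => f x + g x).
Proof. by move=> fl gl c x y; rewrite fl gl scalerDr addrACA. Qed.

Lemma ctx_to_matrix_hom : alg_hom ctx_to_matrix.
Proof.
split=> [|m n].
  apply: lin_add; apply: lin_add => // c m n; first exact: cornerI_hom.1.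
  exact: cornerJ_hom.1.
rewrite /ctx_to_matrix ctx_mulE /= (linD cornerI_hom.1) (linD cornerJ_hom.1).
rewrite cornerI_hom.2 cornerJ_hom.2.
rewrite (emb_tauK extended_embedded) (emb_tauK (embedded_flip extended_embedded)).
have ha := Iin m.1.1; have ha' := Iin n.1.1; have hb := Jin m.2.2; have hb' := Jin n.2.2.
have hx := inU m.1.2; have hx' := inU n.1.2; have hy := inV m.2.1; have hy' := inV n.2.1.
move: (cornerI m.1.1) (cornerI n.1.1) (cornerJ m.2.2) (cornerJ n.2.2)
  (span_val (m.1.2 : spanT U)) (span_val (n.1.2 : spanT U))
  (span_val (m.2.1 : spanT V)) (span_val (n.2.1 : spanT V)) ha ha' hb hb' hx hx' hy hy'.
move=> a a' b b' x x' y y' ha ha' hb hb' hx hx' hy hy'.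
rewrite !amulDl !amulDr.
rewrite (block_mul0 _ ha hy') // (block_mul0 _ ha hb') // (block_mul0 _ hx ha') //.
rewrite (block_mul0 _ hx hx') // (block_mul0 _ hy hy') // (block_mul0 _ hy hb') //.
rewrite (block_mul0 _ hb ha') // (block_mul0 _ hb hx') // !addr0 !add0r.
by congr (_ + _); rewrite addrACA.
Qed.

Lemma pRL_corner b c d e (f : NN) : blk c d f ->
  pR P e (pL P b f) = if (b == c) && (e == d) then f else 0.
Proof.
move=> [Lf Rf]; have [->|bc] := eqVneq b c.
  rewrite Lf -{1}Rf; have [->|ed] := eqVneq e d; first by rewrite Rf.
  have -> : d = ~~ e by move: ed; clear; case: d e => [] [].
  by rewrite pRN.
rewrite -Lf; have -> : c = ~~ b by move: bc; clear; case: b c => [] [].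
by rewrite pLN (lin0 (pR_lin P e)).
Qed.

Lemma ctx_to_matrix_inj : injective ctx_to_matrix.
Proof.
move=> m n e.
have E b c : pR P c (pL P b (ctx_to_matrix m)) = pR P c (pL P b (ctx_to_matrix n)).
  by rewrite e.
move: E; rewrite /ctx_to_matrix => E.
have pr b c (q : ctx M) : pR P c (pL P b (ctx_to_matrix q)) =
    match b, c with
    | false, false => cornerI q.1.1
    | false, true => span_val (q.1.2 : spanT U)
    | true, false => span_val (q.2.1 : spanT V)
    | true, true => cornerJ q.2.2
    end.
  rewrite /ctx_to_matrix !(linD (pL_lin P b)) !(linD (pR_lin P c)).
  rewrite (pRL_corner _ _ (Iin _)) (pRL_corner _ _ (Jin _)) (pRL_corner _ _ (inU _))
    (pRL_corner _ _ (inV _)).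
  by case: b; case: c; rewrite /= ?addr0 ?add0r.
apply: ctxP.
- by apply: cornerI_inj; have := E false false; rewrite !pr.
- by apply: spanP; have := E false true; rewrite !pr.
- by apply: spanP; have := E true false; rewrite !pr.
- by apply: cornerJ_inj; have := E true true; rewrite !pr.
Qed.

Lemma ctx_to_matrix_surj (f : NN) : exists m, ctx_to_matrix m = f.
Proof.
have h b c : blk b c (pR P c (pL P b f)) by exact: pRL_block.
have := h false false; rewrite -cornerI_range => -[a _ ea].
have := h true true; rewrite -cornerJ_range => -[b _ eb].
exists ((a, mkspan (sub_lspan (h false true))), (mkspan (sub_lspan (h true false)), b)).
rewrite [LHS](_ : _ = cornerI a + pR P true (pL P false f) +
  (pR P false (pL P true f) + cornerJ b)) // ea eb.
have sR x : pR P false x + pR P true x = x := pR_sum P false x.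
by rewrite !sR; apply: (pL_sum P false f).
Qed.

Definition matrix_to_ctx (f : NN) : ctx M := xget 0 [set m | ctx_to_matrix m = f].

Lemma matrix_to_ctxK : cancel matrix_to_ctx ctx_to_matrix.
Proof.
move=> f; rewrite /matrix_to_ctx; case: xgetP => // h.
by have [m e] := ctx_to_matrix_surj f; have := h m.
Qed.

Lemma ctx_to_matrixK : cancel ctx_to_matrix matrix_to_ctx.
Proof. by move=> m; apply: ctx_to_matrix_inj; rewrite matrix_to_ctxK. Qed.

Definition context_ppaction : ppaction G (ctx M) :=
  transport_ppaction theta ctx_to_matrix_hom ctx_to_matrixK matrix_to_ctxK.

Lemma context_domP t m : dom context_ppaction t m <-> dom theta t (ctx_to_matrix m).
Proof. exact: tdomP ctx_to_matrixK matrix_to_ctxK _ _. Qed.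

Lemma ctx_to_matrixA a : ctx_to_matrix (cornerA M a) = cornerI a.
Proof. by rewrite /ctx_to_matrix /= (lin0 cornerJ_hom.1) !addr0. Qed.

Lemma ctx_to_matrixB f : ctx_to_matrix (cornerB M f) = cornerJ f.
Proof. by rewrite /ctx_to_matrix /= (lin0 cornerI_hom.1) !add0r. Qed.

Lemma cornerI_dom t a : dom theta t (cornerI a) <-> D t a.
Proof.
split=> [/(_ None None)|Da].
  by rewrite /mdom_entry elemE // eqxx doml1.
apply: elem_fsub => // [p q|]; first exact: doml_submod.
by rewrite /mdom_entry doml1.
Qed.

Lemma cornerJ_dom t f : dom theta t (cornerJ f) <-> dom alpha' t f.
Proof.
split=> [h p q|h p q]; first exact: (h (Some p) (Some q)).
case: p q => [p|] [q|]; first exact: (h p q).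
- exact: (submod0 (doml_submod alpha ([:: t] ++ (oidx (Some p) ++ oidx None)))).
- exact: (submod0 (doml_submod alpha ([:: t] ++ (oidx None ++ oidx (Some q))))).
- exact: (submod0 (doml_submod alpha ([:: t] ++ (oidx None ++ oidx None)))).
Qed.

Lemma cornerI_act t a : D t^-1%g a -> act theta t (cornerI a) = cornerI (act alpha t a).
Proof.
move=> Da; apply: fmatP => p q.
have h : mdoml (idx := oidx) [:: t^-1%g] (cornerI a) by exact/(cornerI_dom t^-1%g a).2.
rewrite [LHS](mactE omv1 omvM oidx_omv _ _ h) !elemE //.
by case: p q => [p|] [q|]; rewrite //= act0.
Qed.

Lemma cornerJ_act t f : dom alpha' t^-1%g f ->
  act theta t (cornerJ f) = cornerJ (act alpha' t f).
Proof.
move=> hf; apply: fmatP => p q.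
have h : mdoml (idx := oidx) [:: t^-1%g] (cornerJ f) by exact/(cornerJ_dom t^-1%g f).2.
rewrite [LHS](mactE omv1 omvM oidx_omv _ _ h).
case: p q => [p|] [q|]; rewrite /= ?act0 //.
exact: esym (mactE (@regular_mv1 G) (@regular_mvM G) (fun _ _ => erefl) _ _ hf).
Qed.

Lemma cornerJ_elem p q z : dom_fam alpha (fun p : G => [:: p]) p q z ->
  cornerJ (EM p q z) = EN (Some p) (Some q) z.
Proof.
move=> hz; have hz' : dom_fam alpha oidx (Some p) (Some q) z by exact: hz.
apply: fmatP => p' q'; rewrite [RHS](elemE _ hz').
case: p' q' => [p'|] [q'|]; rewrite xpair_eqE ?andbF //.
by rewrite [LHS](_ : _ = EM p q z (p', q')) // elemE.
Qed.

(** An entry in [D p ** D t ** D q] factors through the index [None], with middle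
    factor in [D t]. *)
Lemma extended_dom_prod t :
  setprod (@tauB k A _ M)
    (setprod (@ract k _ A (mY M)) [set: mY M] (D t)) [set: mX M]
  = dom alpha' t.
Proof.
apply/seteqP; split.
  apply: setprod_sub => [|y x + _]; first exact: dom_submod.
  move: y; apply: setprod_sub => [|y d _ Dd].
    exact: (submod_preim ((tauB_bilinear M).2 x) (dom_submod _ _)).
  apply/cornerJ_dom; rewrite (emb_tauK (embedded_flip extended_embedded)).
  have -> : span_val (ract y d : spanT V) = span_val (y : spanT V) ** cornerI d by [].
  by apply: dom_rmul; apply: dom_lmul; apply/cornerI_dom.
move=> f hf; apply: fmat_ind => [|p q]; first exact: lspan_submod.
have hDD : (DD [:: p] ** D t ** DD [:: q])%classic `<=` DD ([:: p] ++ [:: q]).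
  rewrite -[D t](doml1 alpha) !domlM; apply: domlS => x.
  by rewrite !mem_cat => /orP[] ->; rewrite ?orbT.
pose Tri := [set z | exists y d x, [/\ DD [:: p] y, D t d, DD [:: q] x & z = y ** d ** x]].
have hz : lspan Tri (f (p, q)).
  have : (DD [:: p] ** D t ** DD [:: q])%classic (f (p, q)).
    rewrite -[D t](doml1 alpha) !domlM; apply: domlS (hf p q) => x.
    by rewrite !mem_cat !inE -orbA; case/or3P => ->; rewrite ?orbT.
  move: (f (p, q)); apply: setprod_sub => [|w x + hx]; first exact: lspan_submod.
  move: w; apply: setprod_sub => [|y d hy hd].
    exact: (submod_preim ((mulB A).2 x) (lspan_submod _)).
  by apply: sub_lspan; exists y, d, x.
apply: elem_span hz; first exact: lspan_submod.
  by move=> _ [y [d [x [hy hd hx ->]]]]; apply: hDD; apply: in_setprod => //; apply: in_setprod.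
move=> _ [y [d [x [hy hd hx ->]]]].
have hz : dom_fam alpha (fun p : G => [:: p]) p q (y ** d ** x).
  by apply: hDD; apply: in_setprod => //; apply: in_setprod.
have Yb : V (EN (Some p) None y) := elem_block isSome (F := dom_fam alpha oidx) (p := Some p) (q := None) hy.
have Xb : U (EN None (Some q) x) := elem_block isSome (F := dom_fam alpha oidx) (p := None) (q := Some q) hx.
pose Y : mY M := mkspan (sub_lspan Yb); pose X : mX M := mkspan (sub_lspan Xb).
have -> : EM p q (y ** d ** x) = tauB (ract Y d) X.
  apply: cornerJ_inj; rewrite cornerJ_elem // (emb_tauK (embedded_flip extended_embedded)) /=.
  have hyd : dom_fam alpha oidx (Some p) None (y ** d) by apply: ideal_mulr (doml_ideal _ _) hy.
  by rewrite /cornerI elem_mul // elem_mul.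
by apply: in_setprod => //; apply: in_setprod.
Qed.

Lemma regular_morita_equiv : morita_equiv alpha alpha'.
Proof.
exists M; split; first exact: extended_morita.
exists context_ppaction; split; first exact: extended_dom_prod.
- move=> t; split.
    apply/seteqP; split=> a h.
      by apply/cornerI_dom; rewrite -ctx_to_matrixA; apply/context_domP.
    by apply/context_domP; rewrite ctx_to_matrixA; apply/cornerI_dom.
  by move=> a Da; apply: (can_inj ctx_to_matrixK); rewrite /= /tact matrix_to_ctxK
    !ctx_to_matrixA cornerI_act.
- move=> t; split.
    apply/seteqP; split=> a h.
      by apply/cornerJ_dom; rewrite -ctx_to_matrixB; apply/context_domP.
    by apply/context_domP; rewrite ctx_to_matrixB; apply/cornerJ_dom.
  by move=> a Da; apply: (can_inj ctx_to_matrixK); rewrite /= /tact matrix_to_ctxK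
    !ctx_to_matrixB cornerJ_act.
Qed.


End CornerEquivalence.

(** * Existence and uniqueness of Morita enveloping actions *)

Theorem theorem8p8 (k : comPzRingType) (G : groupType) (A : nuAlgType k)
    (alpha : ppaction G A) :
  (exists (B : nuAlgType k) (beta : gaction G B),
     morita_enveloping alpha beta) /\
  (forall (B B' : nuAlgType k) (beta : gaction G B) (beta' : gaction G B')
     (e : morita_enveloping alpha beta) (e' : morita_enveloping alpha beta'),
     morita_equiv (ppaction_of_global (enveloping_idempotent e) beta)
                  (ppaction_of_global (enveloping_idempotent e') beta')) /\
  (forall (B : nuAlgType k) (beta : gaction G B)
     (e : morita_enveloping alpha beta),
     graded_equiv (skew_galg alpha)
       (skew_galg (ppaction_of_global (enveloping_idempotent e) beta))).
Proof.
have skew_equiv (B : nuAlgType k) (beta : gaction G B) (BB : idempotent_alg B) :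
    morita_enveloping alpha beta ->
    graded_equiv (skew_galg alpha) (skew_galg (ppaction_of_global BB beta)).
  move=> [A' [alpha' [me mg]]].
  apply: graded_equiv_trans (morita_equiv_graded_equiv me) _.
  exact: minimal_globalization_graded_equiv.
split; first last.
  split=> [B B' beta beta' e e'|B beta e]; last exact: skew_equiv.
  apply: global_graded_equiv_morita_equiv.
  apply: graded_equiv_trans (graded_equiv_sym _) (skew_equiv _ _ _ e').
  exact: skew_equiv.
exists (fmat (smash_fam alpha)), (smash_gaction alpha).
exists (fmat (dom_fam alpha (fun p : G => [:: p]))), (regular_ppaction alpha).
split; first exact: regular_morita_equiv.
exact: regular_minimal_globalization.
Qed.
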